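(* Fix an element $\overline{p}_i\in\mathbb Z_2=\mathbb Z/2\mathbb Z$ for each $i\in I$. The $\mathbb K(q)$-algebra $\mathbf U^\imath_{\varsigma,\kappa}$ has a presentation with generators $B_i$ $(i\in I)$, $K_\mu$ $(\mu\in Y^\imath)$ and the following relations, for $\mu,\mu'\in Y^\imath$ and $i\neq j\in I$: (1) $K_\mu K_{-\mu}=1$ and $K_\mu K_{\mu'}=K_{\mu+\mu'}$; (2) $K_\mu B_i-q^{-\langle\mu,\alpha_i\rangle}B_iK_\mu=0$; (3) $B_iB_j-B_jB_i=0$, if $a_{ij}=0$ and $\tau i\neq j$; (4) $\sum_{n=0}^{1-a_{ij}}(-1)^nB_i^{(n)}B_jB_i^{(1-a_{ij}-n)}=0$, if $j\neq\tau i$ and $\tau i\neq i$; (5) if $\tau i\neq i$, $$\sum_{n=0}^{1-a_{i,\tau i}}(-1)^{n+a_{i,\tau i}}B_i^{(n)}B_{\tau i}B_i^{(1-a_{i,\tau i}-n)}=\frac{1}{q_i-q_i^{-1}}\Big(q_i^{a_{i,\tau i}}(q_i^{-2};q_i^{-2})_{-a_{i,\tau i}}\,\varsigma_{\tau i}B_i^{(-a_{i,\tau i})}\widetilde K_i\widetilde K_{\tau i}^{-1}-(q_i^2;q_i^2)_{-a_{i,\tau i}}\,\varsigma_iB_i^{(-a_{i,\tau i})}\widetilde K_{\tau i}\widetilde K_i^{-1}\Big);$$ (6) $\sum_{n=0}^{1-a_{ij}}(-1)^nB_{i,\overline{a_{ij}}+\overline{p}_i}^{(n)}B_jB_{i,\overline{p}_i}^{(1-a_{ij}-n)}=0$,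 if $\tau i=i$.
   Context: Root datum. $(I,\cdot)$ is a Cartan datum: $I$ is a finite set and $\cdot$ is a symmetric bilinear form on $\mathbb Z[I]$ with $i\cdot i\in\{2,4,6,\dots\}$ and $2\frac{i\cdot j}{i\cdot i}\in\{0,-1,-2,\dots\}$ for $i\ne j$. A root datum of type $(I,\cdot)$ is given: finitely generated free abelian groups $Y,X$ with a perfect bilinear pairing $\langle\cdot,\cdot\rangle:Y\times X\to\mathbb Z$, and embeddings $I\to X$, $i\mapsto\alpha_i$, $I\to Y$, $i\mapsto h_i$, with $a_{ij}:=\langle h_i,\alpha_j\rangle=2\frac{i\cdot j}{i\cdot i}$. The families $\{\alpha_i\}$ and $\{h_i\}$ are assumed linearly independent. Put $\epsilon_i=\frac{i\cdot i}{2}$. $\mathbb K$ is a field of characteristic $0$, $q$ an indeterminate, $q_i=q^{\epsilon_i}$. Put $[n]_{q_i}=\frac{q_i^n-q_i^{-n}}{q_i-q_i^{-1}}$, $[m]_{q_i}^!=[1]_{q_i}\cdots[m]_{q_i}$, $\begin{bmatrix}n\\d\end{bmatrix}_{q_i}=\frac{[n]_{q_i}\cdots[n-d+1]_{q_i}}{[d]_{q_i}^!}$ for $d\ge0$. Also $(a;x)_0=1$ and $(a;x)_n=(1-a)(1-ax)\cdots(1-ax^{n-1})$ for $n\ge1$. Quantum group. $\mathbf U$ is the associative $\mathbb K(q)$-algebra with generators $E_i,F_i$ ($i\in I$), $K_h$ ($h\in Y$) and relations $K_0=1$, $K_hK_{h'}=K_{h+h'}$, $K_hE_i=q^{\langle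 h,\alpha_i\rangle}E_iK_h$, $K_hF_i=q^{-\langle h,\alpha_i\rangle}F_iK_h$, $[E_i,F_j]=\delta_{ij}\frac{\widetilde K_i-\widetilde K_i^{-1}}{q_i-q_i^{-1}}$ with $\widetilde K_i=K_{h_i}^{\epsilon_i}$, and $S_{ij}(E_i,E_j)=0=S_{ij}(F_i,F_j)$ for $i\ne j$, where $S_{ij}(x,y)=\sum_{n=0}^{1-a_{ij}}(-1)^n\begin{bmatrix}1-a_{ij}\\ n\end{bmatrix}_{q_i}x^nyx^{1-a_{ij}-n}$. Quasi-split $\imath$quantum group. $\tau$ is a permutation of $I$ with $\tau^2=\mathrm{id}$ ($\tau=\mathrm{id}$ allowed) and $\tau i\cdot\tau j=i\cdot j$, which is assumed to extend to involutions (also denoted $\tau$) of $X$ and of $Y$ (with $\tau(\alpha_i)=\alpha_{\tau i}$, $\tau(h_i)=h_{\tau i}$) preserving the pairing. Put $Y^\imath=\{h\in Y\mid\tau(h)=-h\}$. The parameters $\varsigma=(\varsigma_i)_{i\in I}\in(\mathbb K(q)^\times)^I$ and $\kappa=(\kappa_i)_{i\in I}\in\mathbb K(q)^I$ satisfy: $\kappa_i=0$ unless $\tau i=i$ and $\langle h_k,\alpha_i\rangle\in2\mathbb Z$ for all $k\in I$ with $\tau k=k$; and $\varsigma_i=\varsigma_{\tau i}$ if $a_{i,\tau i}=0$. Then $\mathbf U^\imath=\mathbf U^\imath_{\varsigma,\kappa}$ is the $\mathbb K(q)$-subalgebra of $\mathbf U$ generated by $B_i=F_i+\varsigma_iE_{\tau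 i}\widetilde K_i^{-1}+\kappa_i\widetilde K_i^{-1}$ ($i\in I$) and $K_\mu$ ($\mu\in Y^\imath$). Note that $\widetilde K_i\widetilde K_{\tau i}^{-1}=K_{\epsilon_i(h_i-h_{\tau i})}$ with $\epsilon_i(h_i-h_{\tau i})\in Y^\imath$. $\imath$Divided powers. If $\tau i\ne i$: $B_i^{(m)}=B_i^m/[m]_{q_i}^!$. If $\tau i=i$, for $\overline p\in\mathbb Z_2=\{\bar0,\bar1\}$: $B_{i,\bar1}^{(m)}=\frac1{[m]_{q_i}^!}B_i\prod_{j=1}^k(B_i^2-q_i\varsigma_i[2j-1]_{q_i}^2)$ if $m=2k+1$, and $\frac1{[m]_{q_i}^!}\prod_{j=1}^k(B_i^2-q_i\varsigma_i[2j-1]_{q_i}^2)$ if $m=2k$; $B_{i,\bar0}^{(m)}=\frac1{[m]_{q_i}^!}B_i\prod_{j=1}^k(B_i^2-q_i\varsigma_i[2j]_{q_i}^2)$ if $m=2k+1$, and $\frac1{[m]_{q_i}^!}\prod_{j=1}^k(B_i^2-q_i\varsigma_i[2j-2]_{q_i}^2)$ if $m=2k$. For $k\in\mathbb Z$, $\overline k$ denotes its class in $\mathbb Z_2$. *)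

(* Defs.v *)
From HB Require Import structures.
From mathcomp Require Import all_boot all_order all_algebra.
From mathcomp Require Import boolp.
From mathcomp Require Import monalg.

Set Implicit Arguments.
Unset Strict Implicit.
Unset Printing Implicit Defensive.

Import Order.TTheory GRing.Theory Num.Theory.
Local Open Scope ring_scope.

Section Word.
Variable G : choiceType.

Definition word : Type := seq G.
HB.instance Definition _ := Choice.on word.

Lemma word_unit (x y : word) : x ++ y = [::] :> seq G -> x = [::] /\ y = [::].
Proof. by case: x => [|//]; case: y. Qed.

HB.instance Definition _ := Choice_isMonomialDef.Build word
  (@catA G) (@cat0s G) (@cats0 G) word_unit.

End Word.

Section FreeAlgebra.
Variables (F : fieldType) (G : choiceType).

Definition freealg : Type := {malg F[word G]}.
HB.instance Definition _ := GRing.Lalgebra.on freealg.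

Lemma freealg_scaleAr (c : F) (x y : freealg) : c *: (x * y) = x * (c *: y).
Proof.
have cC (z : {malg F[word G]}) : malgC c * z = z * malgC c.
  rewrite [LHS]malgM_def [RHS]malgM_def fgmulUg fgmulgU.
  by apply: eq_bigr => k _; rewrite mul1m mulm1 mulrC.
rewrite -[LHS](@mul_malgC (word G) F) -[c *: y](@mul_malgC (word G) F).
by rewrite mulrA cC -mulrA.
Qed.

HB.instance Definition _ :=
  GRing.Lalgebra_isAlgebra.Build F freealg freealg_scaleAr.

End FreeAlgebra.

(* Locked, since unification would otherwise unfold the free algebra down to
   finitely supported functions whenever two generators differ. *)
HB.lock Definition freegen (F : fieldType) (G : choiceType) (x : G) :
  freealg F G := << ([:: x] : word G) >>.

Definition word_eval (F : fieldType) (G : choiceType) (A : algType F)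
  (g : G -> A) (w : word G) : A := \prod_(x <- (w : seq G)) g x.

HB.lock Definition freealg_eval (F : fieldType) (G : choiceType)
  (A : algType F) (g : G -> A) (x : freealg F G) : A :=
  mmap (GRing.in_alg A) (word_eval g) x.

Section FreeAlgebraEval.
Variables (F : fieldType) (G : choiceType) (A : algType F) (g : G -> A).
Local Notation freealg := (freealg F G).
Local Notation word_eval := (word_eval g).
Local Notation freealg_eval := (freealg_eval g).

Lemma word_eval_mmorphism : mmorphism word_eval.
Proof. by split=> [x y|]; rewrite /word_eval ?big_nil // big_cat. Qed.

HB.instance Definition _ :=
  isMultiplicative.Build (word G) A word_eval word_eval_mmorphism.

Lemma freealg_eval_zmod : zmod_morphism freealg_eval.
Proof.
rewrite freealg_eval.unlock.
exact: (@mmap_is_additive (word G) F A (GRing.in_alg A) word_eval).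
Qed.

HB.instance Definition _ :=
  GRing.isZmodMorphism.Build freealg A freealg_eval freealg_eval_zmod.

Lemma freealg_eval_monoid : monoid_morphism freealg_eval.
Proof.
rewrite freealg_eval.unlock.
have [] := @commr_mmap_is_multiplicative (word G) F A (GRing.in_alg A) word_eval.
  move=> z m m'; rewrite /GRing.comm /= -scalerAl mul1r.
  by rewrite -scalerAr mulr1.
by split.
Qed.

HB.instance Definition _ :=
  GRing.isMonoidMorphism.Build freealg A freealg_eval freealg_eval_monoid.

Lemma freealg_eval_scalable : scalable freealg_eval.
Proof.
move=> c x; rewrite freealg_eval.unlock.
rewrite (@mmapZ (word G) F A (GRing.in_alg A) word_eval).
by rewrite /= -scalerAl mul1r.
Qed.

HB.instance Definition _ :=
  GRing.isScalable.Build F freealg A *:%R freealg_eval freealg_eval_scalable.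

Lemma freealg_evalE (x : G) : freealg_eval (freegen F x) = g x.
Proof.
rewrite freealg_eval.unlock freegen.unlock.
rewrite (@mmapU (word G) F A (GRing.in_alg A) word_eval).
by rewrite /= scale1r mul1r /word_eval big_seq1.
Qed.

End FreeAlgebraEval.

Section Ideal.
Variables (F : fieldType) (A : algType F) (S : A -> Prop).

Inductive ideal_gen : A -> Prop :=
| ideal_gen_in x : S x -> ideal_gen x
| ideal_gen0 : ideal_gen 0
| ideal_genD x y : ideal_gen x -> ideal_gen y -> ideal_gen (x + y)
| ideal_genMl a x : ideal_gen x -> ideal_gen (a * x)
| ideal_genMr x a : ideal_gen x -> ideal_gen (x * a).

Inductive subalg_gen : A -> Prop :=
| subalg_gen_in x : S x -> subalg_gen x
| subalg_gen1 : subalg_gen 1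
| subalg_genD x y : subalg_gen x -> subalg_gen y -> subalg_gen (x + y)
| subalg_genZ c x : subalg_gen x -> subalg_gen (c *: x)
| subalg_genM x y : subalg_gen x -> subalg_gen y -> subalg_gen (x * y).

Definition ideal_pred : {pred A} := fun x => `[< ideal_gen x >].

Lemma ideal_predP x : reflect (ideal_gen x) (x \in ideal_pred).
Proof. exact: asboolP. Qed.

Lemma ideal_zmod_closed : zmod_closed ideal_pred.
Proof.
split=> [|x y /ideal_predP hx /ideal_predP hy]; apply/ideal_predP.
  exact: ideal_gen0.
by apply: ideal_genD => //; rewrite -mulN1r; apply: ideal_genMl.
Qed.

HB.instance Definition _ := GRing.isZmodClosed.Build A ideal_pred
  ideal_zmod_closed.

(* Library algebras are nontrivial, so that the quotient by the two-sided
   ideal generated by [S] carries an [algType] structure only if the ideal is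
   proper. *)
Definition quotalg (proper : ~ ideal_gen 1) : Type := Quotient.quot ideal_pred.

Variable proper : ~ ideal_gen 1.
Local Notation Q := (quotalg proper).

HB.instance Definition _ := GRing.Zmodule.on Q.

Definition quot_pi (x : A) : Q := \pi_(Quotient.quot ideal_pred)%qT x.

Lemma quot_piP x y : quot_pi x = quot_pi y <-> ideal_gen (x - y).
Proof.
rewrite /quot_pi; split.
  by move/eqP; rewrite -Quotient.idealrBE => /ideal_predP.
by move=> h; apply/eqP; rewrite -Quotient.idealrBE; apply/ideal_predP.
Qed.

Lemma quot_pi_surj (u : Q) : exists x, u = quot_pi x.
Proof. by exists (repr (u : Quotient.quot ideal_pred)); rewrite /quot_pi reprK. Qed.

Lemma quot_pi_zmod : zmod_morphism quot_pi.
Proof. exact: (raddfB (\pi_(Quotient.quot ideal_pred)%qT)). Qed.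

HB.instance Definition _ := GRing.isZmodMorphism.Build A Q quot_pi quot_pi_zmod.

Definition quot_repr (u : Q) : A := repr (u : Quotient.quot ideal_pred).

Lemma quot_reprK u : quot_pi (quot_repr u) = u.
Proof. exact: reprK. Qed.

Definition quot_mul (u v : Q) : Q := quot_pi (quot_repr u * quot_repr v).
Definition quot_scale (c : F) (u : Q) : Q := quot_pi (c *: quot_repr u).

Lemma quot_reprP x : ideal_gen (quot_repr (quot_pi x) - x).
Proof. by apply/quot_piP; rewrite quot_reprK. Qed.

Lemma quot_mulE x y : quot_mul (quot_pi x) (quot_pi y) = quot_pi (x * y).
Proof.
apply/quot_piP; set x' := quot_repr _; set y' := quot_repr _.
have -> : x' * y' - x * y = (x' - x) * y' + x * (y' - y).
  by rewrite mulrBl mulrBr addrA subrK.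
by apply: ideal_genD; [apply: ideal_genMr|apply: ideal_genMl]; apply: quot_reprP.
Qed.

Lemma quot_scaleE c x : quot_scale c (quot_pi x) = quot_pi (c *: x).
Proof.
apply/quot_piP; rewrite -scalerBr -[_ - x]mul1r scalerAl.
by apply: ideal_genMl; apply: quot_reprP.
Qed.

Let mulA : associative quot_mul.
Proof.
move=> u v w; have [[x ->] [[y ->] [z ->]]] :=
  (quot_pi_surj u, (quot_pi_surj v, quot_pi_surj w)).
by rewrite !quot_mulE mulrA.
Qed.

Let mul1 : left_id (quot_pi 1) quot_mul.
Proof. by move=> u; have [x ->] := quot_pi_surj u; rewrite quot_mulE mul1r. Qed.

Let mulx1 : right_id (quot_pi 1) quot_mul.
Proof. by move=> u; have [x ->] := quot_pi_surj u; rewrite quot_mulE mulr1. Qed.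

Let mulDl : left_distributive quot_mul +%R.
Proof.
move=> u v w; have [[x ->] [[y ->] [z ->]]] :=
  (quot_pi_surj u, (quot_pi_surj v, quot_pi_surj w)).
by rewrite -raddfD !quot_mulE -raddfD mulrDl.
Qed.

Let mulDr : right_distributive quot_mul +%R.
Proof.
move=> u v w; have [[x ->] [[y ->] [z ->]]] :=
  (quot_pi_surj u, (quot_pi_surj v, quot_pi_surj w)).
by rewrite -raddfD !quot_mulE -raddfD mulrDr.
Qed.

Let one_neq0 : quot_pi 1 != 0.
Proof.
apply/eqP => h; apply: proper; rewrite -[1]subr0.
by apply/quot_piP; rewrite raddf0.
Qed.

HB.instance Definition _ := GRing.Zmodule_isNzRing.Build Q
  mulA mul1 mulx1 mulDl mulDr one_neq0.

Let scaleA a b u : quot_scale a (quot_scale b u) = quot_scale (a * b) u.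
Proof. by have [x ->] := quot_pi_surj u; rewrite !quot_scaleE scalerA. Qed.

Let scale1 : left_id 1 quot_scale.
Proof. by move=> u; have [x ->] := quot_pi_surj u; rewrite quot_scaleE scale1r. Qed.

Let scaleDr : right_distributive quot_scale +%R.
Proof.
move=> c u v; have [[x ->] [y ->]] := (quot_pi_surj u, quot_pi_surj v).
by rewrite -raddfD !quot_scaleE -raddfD scalerDr.
Qed.

Let scaleDl u : {morph quot_scale^~ u : a b / a + b}.
Proof.
move=> a b; have [x ->] := quot_pi_surj u.
by rewrite !quot_scaleE -raddfD scalerDl.
Qed.

HB.instance Definition _ := GRing.Zmodule_isLmodule.Build F Q
  scaleA scale1 scaleDr scaleDl.

Let scaleAl (c : F) (u v : Q) : c *: (u * v) = c *: u * v.
Proof.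
have [[x ->] [y ->]] := (quot_pi_surj u, quot_pi_surj v).
change (quot_scale c (quot_mul (quot_pi x) (quot_pi y))
        = quot_mul (quot_scale c (quot_pi x)) (quot_pi y)).
by rewrite quot_mulE !quot_scaleE quot_mulE scalerAl.
Qed.

HB.instance Definition _ := GRing.Lmodule_isLalgebra.Build F Q scaleAl.

Let scaleAr (c : F) (u v : Q) : c *: (u * v) = u * (c *: v).
Proof.
have [[x ->] [y ->]] := (quot_pi_surj u, quot_pi_surj v).
change (quot_scale c (quot_mul (quot_pi x) (quot_pi y))
        = quot_mul (quot_pi x) (quot_scale c (quot_pi y))).
by rewrite quot_mulE !quot_scaleE quot_mulE scalerAr.
Qed.

HB.instance Definition _ := GRing.Lalgebra_isAlgebra.Build F Q scaleAr.

Lemma quot_pi_monoid : monoid_morphism quot_pi.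
Proof. by split=> // x y; rewrite -quot_mulE. Qed.

HB.instance Definition _ :=
  GRing.isMonoidMorphism.Build A Q quot_pi quot_pi_monoid.

Lemma quot_pi_scalable : scalable quot_pi.
Proof. by move=> c x; rewrite -quot_scaleE. Qed.

HB.instance Definition _ :=
  GRing.isScalable.Build F A Q *:%R quot_pi quot_pi_scalable.

End Ideal.

(* The subalgebra [B] of [A] is presented by the generators [g x] and the
   relators [rel]: the canonical morphism from the free algebra has image [B]
   and its kernel is the two-sided ideal generated by [rel]. *)
Definition presented_by (F : fieldType) (A : algType F) (B : A -> Prop)
    (G : choiceType) (g : G -> A) (rel : freealg F G -> Prop) : Prop :=
  (forall a, B a <-> exists x, freealg_eval g x = a) /\
  (forall x, freealg_eval g x = 0 <-> ideal_gen rel x).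

(* The bilinear form on Z[I] is given by its values on the basis I. *)
Record cartan_datum (I : finType) := CartanDatum {
  cdot :> I -> I -> int;
  cdotC : forall i j, cdot i j = cdot j i;
  cdot_gt0 : forall i, 0 < cdot i i;
  cdot_even : forall i, (2 %| cdot i i)%Z;
  cdot_le0 : forall i j, i != j -> cdot i j <= 0;
  cdot_dvd : forall i j, i != j -> (cdot i i %| 2 * cdot i j)%Z }.

Definition fg_free (V : zmodType) : Prop :=
  exists (n : nat) (b : 'I_n -> V),
    forall v, exists! c : {ffun 'I_n -> int}, v = \sum_(k < n) b k *~ c k.

Definition Z_lin_indep (I : finType) (V : zmodType) (v : I -> V) : Prop :=
  forall c : I -> int, \sum_i v i *~ c i = 0 -> forall i, c i = 0.

Record root_datum (I : finType) (C : cartan_datum I) := RootDatum {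
  rdY : zmodType;
  rdX : zmodType;
  rdY_fg_free : fg_free rdY;
  rdX_fg_free : fg_free rdX;
  pairing : rdY -> rdX -> int;
  pairingDl : forall h h' x, pairing (h + h') x = pairing h x + pairing h' x;
  pairingDr : forall h x x', pairing h (x + x') = pairing h x + pairing h x';
  pairing_perfectl : forall f : {additive rdY -> int},
    exists! x, forall h, pairing h x = f h;
  pairing_perfectr : forall f : {additive rdX -> int},
    exists! h, forall x, pairing h x = f x;
  simple_root : I -> rdX;
  simple_coroot : I -> rdY;
  simple_root_inj : injective simple_root;
  simple_coroot_inj : injective simple_coroot;
  pairing_simple : forall i j,
    pairing (simple_coroot i) (simple_root j) * C i i = 2 * C i j;
  simple_root_indep : Z_lin_indep simple_root;
  simple_coroot_indep : Z_lin_indep simple_coroot }.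

Record diagram_involution (I : finType) (C : cartan_datum I)
    (D : root_datum C) := DiagramInvolution {
  tau :> I -> I;
  tauK : involutive tau;
  tau_cdot : forall i j, C (tau i) (tau j) = C i j;
  tauY : {additive rdY D -> rdY D};
  tauX : {additive rdX D -> rdX D};
  tauYK : involutive tauY;
  tauXK : involutive tauX;
  tauY_coroot : forall i, tauY (simple_coroot D i) = simple_coroot D (tau i);
  tauX_root : forall i, tauX (simple_root D i) = simple_root D (tau i);
  tau_pairing : forall h x, pairing (tauY h) (tauX x) = pairing h x }.

Section QuantumNumbers.
Variable F : fieldType.

Definition qint (v : F) (n : int) : F := (v ^ n - v ^ (- n)) / (v - v^-1).

Definition qfact (v : F) (m : nat) : F := \prod_(1 <= k < m.+1) qint v k%:Z.

Definition qbinom (v : F) (n : int) (d : nat) : F :=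
  (\prod_(0 <= k < d) qint v (n - k%:Z)) / qfact v d.

Definition qpoch (a x : F) (n : nat) : F := \prod_(0 <= k < n) (1 - a * x ^+ k).

Definition divpow (A : algType F) (v : F) (b : A) (m : nat) : A :=
  (qfact v m)^-1 *: b ^+ m.

(* [idivpow v s b p m] is the m-th idivided power of parity p of the element b,
   at quantum parameter v = q_i and with s = varsigma_i. *)
Definition idivpow (A : algType F) (v s : F) (b : A) (p : 'Z_2) (m : nat) : A :=
  let k := m./2 in
  let c (j : nat) : int :=
    if p == 1 then 2 * j%:Z - 1
    else if odd m then 2 * j%:Z else 2 * j%:Z - 2 in
  (qfact v m)^-1 *:
    (b ^+ odd m * \prod_(1 <= j < k.+1) (b ^+ 2 - (v * s * qint v (c j) ^+ 2)%:A)).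

End QuantumNumbers.

Section QuantumGroup.
Variables (I : finType) (C : cartan_datum I) (D : root_datum C).
Variables (F : fieldType) (q : F).

Local Notation Y := (rdY D).

Definition cartan (i j : I) : int :=
  pairing (simple_coroot D i) (simple_root D j).
Local Notation a := cartan.

Definition eps (i : I) : nat := `|(C i i %/ 2)%Z|%N.

Definition qi (i : I) : F := q ^+ eps i.

Inductive Ugen := UgenE of I | UgenF of I | UgenK of Y.

Definition Ugen_code (x : Ugen) : I + I + Y :=
  match x with
  | UgenE i => inl (inl i)
  | UgenF i => inl (inr i)
  | UgenK h => inr h
  end.

Definition Ugen_decode (x : I + I + Y) : Ugen :=
  match x with
  | inl (inl i) => UgenE i
  | inl (inr i) => UgenF i
  | inr h => UgenK h
  end.

Lemma Ugen_codeK : cancel Ugen_code Ugen_decode.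
Proof. by case. Qed.

HB.instance Definition _ := Choice.copy Ugen (can_type Ugen_codeK).

Local Notation Ufree := (freealg F Defs_Ugen__canonical__choice_Choice).
Local Notation fE i := (freegen F (UgenE i)).
Local Notation fF i := (freegen F (UgenF i)).
Local Notation fK h := (freegen F (UgenK h)).

(* Ktilde_i and its inverse. *)
Definition fKt (i : I) : Ufree := fK (simple_coroot D i) ^+ eps i.
Definition fKtV (i : I) : Ufree := fK (- simple_coroot D i) ^+ eps i.

(* For i <> j the entry a_ij is nonpositive, so that 1 - a_ij is the natural
   number used below. *)
Definition one_sub_a (i j : I) : nat := `|1 - a i j|%N.

Definition serre (A : algType F) (i j : I) (x y : A) : A :=
  \sum_(0 <= n < (one_sub_a i j).+1)
    ((-1) ^+ n * qbinom (qi i) (1 - a i j) n) *: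
      (x ^+ n * y * x ^+ (one_sub_a i j - n)).

Inductive Urel : Ufree -> Prop :=
| Urel_K0 : Urel (fK 0 - 1)
| Urel_KK h h' : Urel (fK h * fK h' - fK (h + h'))
| Urel_KE h i : Urel (fK h * fE i
    - q ^ pairing h (simple_root D i) *: (fE i * fK h))
| Urel_KF h i : Urel (fK h * fF i
    - q ^ (- pairing h (simple_root D i)) *: (fF i * fK h))
| Urel_EF i j : Urel (fE i * fF j - fF j * fE i
    - ((i == j)%:R / (qi i - (qi i)^-1)) *: (fKt i - fKtV i))
| Urel_SE i j : i != j -> Urel (serre i j (fE i) (fE j))
| Urel_SF i j : i != j -> Urel (serre i j (fF i) (fF j)).

Section Counit.

Definition counit_gen (x : Ugen) : F^o := if x is UgenK _ then 1 else 0.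

Local Notation counit := (freealg_eval counit_gen).

Lemma counit_serre i j (x y : Ufree) : counit y = 0 -> counit (serre i j x y) = 0.
Proof.
move=> y0; rewrite /serre raddf_sum big1 // => n _.
by rewrite /= freealg_eval_scalable !rmorphM /= y0 mulr0 mul0r scaler0.
Qed.

Lemma counit_rel x : ideal_gen Urel x -> counit x = 0.
Proof.
elim=> {x} [x [|h h'|h i|h i|i j|i j _|i j _]||x y _ xK _ yK|a' x _ xK|x a' _ xK].
- by rewrite rmorphB rmorph1 /= freealg_evalE subrr.
- by rewrite rmorphB rmorphM /= !freealg_evalE mul1r subrr.
- rewrite rmorphB /= freealg_eval_scalable !rmorphM /= !freealg_evalE /=.
  by rewrite mulr0 mul0r scaler0 subrr.
- rewrite rmorphB /= freealg_eval_scalable !rmorphM /= !freealg_evalE /=.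
  by rewrite mulr0 mul0r scaler0 subrr.
- rewrite !rmorphB /= freealg_eval_scalable !rmorphM rmorphB !rmorphXn /= !freealg_evalE /=.
  by rewrite mulr0 !expr1n !subrr scaler0 subrr.
- by apply: counit_serre; rewrite freealg_evalE.
- by apply: counit_serre; rewrite freealg_evalE.
- by rewrite rmorph0.
- by rewrite rmorphD /= xK yK addr0.
- by rewrite rmorphM /= xK mulr0.
- by rewrite rmorphM /= xK mul0r.
Qed.

Lemma Urel_proper : ~ ideal_gen Urel 1.
Proof. by move=> /counit_rel; rewrite rmorph1 => /eqP; rewrite oner_eq0. Qed.

End Counit.

Definition U : Type := quotalg Urel_proper.
HB.instance Definition _ := GRing.Algebra.on U.

Definition uE (i : I) : U := quot_pi Urel_proper (fE i).
Definition uF (i : I) : U := quot_pi Urel_proper (fF i).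
Definition uK (h : Y) : U := quot_pi Urel_proper (fK h).

Definition uKtV (i : I) : U := uK (- simple_coroot D i) ^+ eps i.

Variable T : diagram_involution D.

Definition Yi_pred : {pred Y} := fun h => tauY T h == - h.

Lemma Yi_zmod_closed : zmod_closed Yi_pred.
Proof.
split=> [|x y /eqP hx /eqP hy]; rewrite /in_mem /= /Yi_pred.
  by rewrite raddf0 oppr0.
by rewrite raddfB /= hx hy opprB opprK addrC.
Qed.

HB.instance Definition _ := GRing.isZmodClosed.Build Y Yi_pred Yi_zmod_closed.

Record Yi := MkYi { Yi_val :> Y; Yi_valP : Yi_val \in Yi_pred }.
HB.instance Definition _ := [isSub for Yi_val].
HB.instance Definition _ := [Choice of Yi by <:].
HB.instance Definition _ := [SubChoice_isSubZmodule of Yi by <:].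

Variables (varsigma kappa : I -> F).

Definition uB (i : I) : U :=
  uF i + varsigma i *: (uE (T i) * uKtV i) + kappa i *: uKtV i.

(* [Ui] is the subalgebra U^i of U, as a predicate on U. *)
Definition Ui : U -> Prop :=
  subalg_gen (fun u => (exists i, u = uB i) \/ (exists mu : Yi, u = uK mu)).

Inductive Uigen := UigenB of I | UigenK of Yi.

Definition Uigen_code (x : Uigen) : I + Yi :=
  match x with UigenB i => inl i | UigenK mu => inr mu end.

Definition Uigen_decode (x : I + Yi) : Uigen :=
  match x with inl i => UigenB i | inr mu => UigenK mu end.

Lemma Uigen_codeK : cancel Uigen_code Uigen_decode.
Proof. by case. Qed.

HB.instance Definition _ := Choice.copy Uigen (can_type Uigen_codeK).

Definition Uigen_val (x : Uigen) : U :=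
  match x with UigenB i => uB i | UigenK mu => uK mu end.

Local Notation Uifree := (freealg F Defs_Uigen__canonical__choice_Choice).
Local Notation B i := (freegen F (UigenB i)).
Local Notation K mu := (freegen F (UigenK mu)).

Lemma Yi_coroot_subproof i :
  (simple_coroot D i - simple_coroot D (T i)) *+ eps i \in Yi_pred.
Proof.
apply: rpredMn; rewrite /in_mem /= /Yi_pred raddfB /= !tauY_coroot tauK.
by rewrite opprB.
Qed.

(* The weight of the product of Ktilde_i and the inverse of Ktilde_(tau i). *)
Definition Yi_coroot (i : I) : Yi := MkYi (Yi_coroot_subproof i).

Definition serre_div (i j : I) : Uifree :=
  \sum_(0 <= n < (one_sub_a i j).+1)
    (-1) ^+ n *: (divpow (qi i) (B i) n * B j
                  * divpow (qi i) (B i) (one_sub_a i j - n)).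

Definition serre_tau_lhs (i : I) : Uifree :=
  \sum_(0 <= n < (one_sub_a i (T i)).+1)
    (-1) ^ (n%:Z + a i (T i)) *:
      (divpow (qi i) (B i) n * B (T i)
       * divpow (qi i) (B i) (one_sub_a i (T i) - n)).

Definition serre_tau_rhs (i : I) : Uifree :=
  let m := `|a i (T i)|%N in
  (qi i - (qi i)^-1)^-1 *:
    ((qi i ^ a i (T i) * qpoch (qi i ^- 2) (qi i ^- 2) m * varsigma (T i)) *:
       (divpow (qi i) (B i) m * K (Yi_coroot i))
     - (qpoch (qi i ^+ 2) (qi i ^+ 2) m * varsigma i) *:
       (divpow (qi i) (B i) m * K (- Yi_coroot i))).

Definition serre_idiv (p : I -> 'Z_2) (i j : I) : Uifree :=
  \sum_(0 <= n < (one_sub_a i j).+1)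
    (-1) ^+ n *: (idivpow (qi i) (varsigma i) (B i) ((a i j)%:~R + p i) n * B j
                  * idivpow (qi i) (varsigma i) (B i) (p i) (one_sub_a i j - n)).

Inductive Uirel (p : I -> 'Z_2) : Uifree -> Prop :=
| Uirel_KV mu : Uirel p (K mu * K (- mu) - 1)
| Uirel_KK mu mu' : Uirel p (K mu * K mu' - K (mu + mu'))
| Uirel_KB mu i : Uirel p (K mu * B i
    - q ^ (- pairing (mu : Y) (simple_root D i)) *: (B i * K mu))
| Uirel_BB i j : i != j -> a i j = 0 -> T i != j ->
    Uirel p (B i * B j - B j * B i)
| Uirel_serre i j : i != j -> j != T i -> T i != i -> Uirel p (serre_div i j)
| Uirel_tau i : T i != i -> Uirel p (serre_tau_lhs i - serre_tau_rhs i)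
| Uirel_idiv i j : i != j -> T i = i -> Uirel p (serre_idiv p i j).

End QuantumGroup.

Arguments Ui {I C D F} q T varsigma kappa _.
Arguments Uigen_val {I C D F} q T varsigma kappa _.
Arguments Uirel {I C D F} q T varsigma p _.

(* Main.v *)
(**
Let [L] and [R] be the left and right multiplications by an element [b], and
let [v] be the quantum parameter.  Up to a scalar, the Serre polynomial of
order [N] in [b], as well as its version with idivided powers, is the product of
the factors [L^2 - (v^k + v^-k) L R + R^2 - v s [k]^2] over [k = N-1, N-3, ... > 0],
times [L - R] if [N] is odd (with [s = 0] for ordinary powers).  This product is
also the [N]-th term of a three-term recurrence, linear in [L] and [R].
If [b = x + z + c m] is a generator of the coideal subalgebra, with [x = F_i], the
same recurrence is satisfied by the iterated twisted commutators of [x] with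
[y = F_j], the [z]-part of [b] accounting for the middle term; the [N]-th
commutator is the Serre element of [x] and [y], hence zero.  The summands
[E_(tau j)] and the torus part of [B_j] are treated in the same way, and for
[j = tau i] the Cartan term of [E_i F_i - F_i E_i] produces the inhomogeneous
relation.

Conversely, the relations allow one to write every element as a sum of words in
the [B_i] times elements [K_mu].  Suppose that such a sum vanishes in the quantum
group, and let it act on the highest weight vectors of all Verma modules, realised
on the free algebra in the [F_i] modulo the Serre ideal.  There [B_i] acts as
left multiplication by [F_i] plus terms of lower degree, and the weights separate
the [K_mu]; hence the coefficient of each [K_mu] has its top component in the Serre
ideal.  By the relations, Serre elements in the [B_i] have lower degree, and
one concludes by induction on the degree.
*)

From HB Require Import structures.
Require Import Defs.
From mathcomp Require Import all_boot all_order all_algebra.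
From mathcomp Require Import boolp monalg ring zify.

Set Implicit Arguments.
Unset Strict Implicit.
Unset Printing Implicit Defensive.

Import GRing.Theory.
Local Open Scope ring_scope.

(** * Normalisation in noncommutative algebras *)

(** Three obstacles shape the proof. At a fixed node [i], a torus summand of [B_j] with [kp j]
    nonzero does not start a chain of commutators. It is killed because [a_ij] is even, by induction
    on the Serre order, where the Casimir element of the rank one subalgebra at [i] absorbs the
    products [F_i E_i]; one of the denominators is twice a power of [v], whence the assumption on 2.
    The summand [E_(tau j)] sees [F_i] and the [E]-part of [B_i] in exchanged roles and with [v]
    inverted, so the Serre polynomial has to be invariant under this inversion. Finally, no PBW
    basis or triangular decomposition is used: the Verma operators act on the whole free algebra in
    the [F_i], preserve the Serre ideal, and satisfy the relations of the quantum group modulo it.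
    Such congruences are all that completeness needs, since the relations of the presentation
    rewrite every element of the ideal by shorter words. Noncommutative identities are proved by
    certificates: the goal is written as a two-sided combination of the hypotheses and compared word
    by word. *)

Section NCNormal.
Variables (F : fieldType) (A : algType F).

Inductive ncexp : Type :=
| NCvar of nat
| NCone
| NCzero
| NCadd of ncexp & ncexp
| NCopp of ncexp
| NCmul of ncexp & ncexp
| NCscale of F & ncexp.

Fixpoint nc_eval (env : seq A) (t : ncexp) : A :=
  match t with
  | NCvar i => nth 0 env i
  | NCone => 1
  | NCzero => 0
  | NCadd t u => nc_eval env t + nc_eval env u
  | NCopp t => - nc_eval env t
  | NCmul t u => nc_eval env t * nc_eval env u
  | NCscale c t => c *: nc_eval env t
  end.

Fixpoint ncw_eq (w w' : seq nat) : bool :=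
  match w, w' with
  | [::], [::] => true
  | i :: w, j :: w' => if Nat.eqb i j then ncw_eq w w' else false
  | _, _ => false
  end.

(** Coefficients are symbolic and cannot be tested for zero, so like words are merged and no word is
    discarded; the vanishing of each coefficient is left as a goal by [ncp_zero]. *)
Fixpoint ncp_ins (c : F) (w : seq nat) (p : seq (F * seq nat)) :=
  match p with
  | [::] => [:: (c, w)]
  | t :: p => if ncw_eq w t.2 then (c + t.1, w) :: p else t :: ncp_ins c w p
  end.

Fixpoint ncp_add (p p' : seq (F * seq nat)) :=
  match p with
  | [::] => p'
  | t :: p => ncp_ins t.1 t.2 (ncp_add p p')
  end.

Fixpoint ncp_mon (c : F) (w : seq nat) (p : seq (F * seq nat)) :=
  match p with
  | [::] => [::]
  | t :: p => (c * t.1, w ++ t.2) :: ncp_mon c w p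
  end.

Fixpoint ncp_mul (p p' : seq (F * seq nat)) :=
  match p with
  | [::] => [::]
  | t :: p => ncp_add (ncp_mon t.1 t.2 p') (ncp_mul p p')
  end.

Fixpoint nc_norm (t : ncexp) : seq (F * seq nat) :=
  match t with
  | NCvar i => [:: (1, [:: i])]
  | NCone => [:: (1, [::])]
  | NCzero => [::]
  | NCadd t u => ncp_add (nc_norm t) (nc_norm u)
  | NCopp t => ncp_mon (-1) [::] (nc_norm t)
  | NCmul t u => ncp_mul (nc_norm t) (nc_norm u)
  | NCscale c t => ncp_mon c [::] (nc_norm t)
  end.

Fixpoint ncp_zero (p : seq (F * seq nat)) : Prop :=
  match p with
  | [::] => True
  | t :: p => t.1 = 0 /\ ncp_zero p
  end.

Definition ncw_eval (env : seq A) (w : seq nat) : A :=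
  \prod_(i <- w) nth 0 env i.

Definition ncp_eval (env : seq A) (p : seq (F * seq nat)) : A :=
  \sum_(t <- p) t.1 *: ncw_eval env t.2.

Lemma ncw_eqP w w' : ncw_eq w w' -> w = w'.
Proof.
elim: w w' => [|i w IH] [|j w'] //=.
by case: PeanoNat.Nat.eqb_spec => // -> /IH ->.
Qed.

Lemma ncp_ins_eval env c w p :
  ncp_eval env (ncp_ins c w p) = c *: ncw_eval env w + ncp_eval env p.
Proof.
rewrite /ncp_eval; elim: p => [|[d w'] p IH] /=; first by rewrite big_seq1 big_nil addr0.
case: ifP => [/ncw_eqP -> |_]; rewrite !big_cons /=.
  by rewrite scalerDl addrA.
by rewrite IH addrCA.
Qed.

Lemma ncp_add_eval env p p' :
  ncp_eval env (ncp_add p p') = ncp_eval env p + ncp_eval env p'.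
Proof.
elim: p => [|t p IH] /=; first by rewrite /ncp_eval big_nil add0r.
by rewrite ncp_ins_eval IH [in RHS]/ncp_eval big_cons addrA.
Qed.

Lemma ncp_mon_eval env c w p :
  ncp_eval env (ncp_mon c w p) = c *: (ncw_eval env w * ncp_eval env p).
Proof.
rewrite /ncp_eval; elim: p => [|t p IH] /=; first by rewrite !big_nil mulr0 scaler0.
rewrite !big_cons IH /= mulrDr scalerDr; congr (_ + _).
by rewrite -scalerAr scalerA /ncw_eval big_cat.
Qed.

Lemma ncp_mul_eval env p p' :
  ncp_eval env (ncp_mul p p') = ncp_eval env p * ncp_eval env p'.
Proof.
elim: p => [|t p IH] /=; first by rewrite /ncp_eval big_nil mul0r.
by rewrite ncp_add_eval ncp_mon_eval IH [X in _ = X * _]/ncp_eval big_cons mulrDl scalerAl.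
Qed.

Lemma nc_norm_eval env t : ncp_eval env (nc_norm t) = nc_eval env t.
Proof.
elim: t => [i|||t IHt u IHu|t IHt|t IHt u IHu|c t IHt] /=.
- by rewrite /ncp_eval big_seq1 scale1r /ncw_eval big_seq1.
- by rewrite /ncp_eval big_seq1 scale1r /ncw_eval big_nil.
- by rewrite /ncp_eval big_nil.
- by rewrite ncp_add_eval IHt IHu.
- by rewrite ncp_mon_eval /ncw_eval big_nil mul1r IHt scaleN1r.
- by rewrite ncp_mul_eval IHt IHu.
- by rewrite ncp_mon_eval /ncw_eval big_nil mul1r IHt.
Qed.

Lemma nc_normP env t u :
  ncp_zero (nc_norm (NCadd t (NCopp u))) -> nc_eval env t = nc_eval env u.
Proof.
move=> h; apply/eqP; rewrite -subr_eq0.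
have -> : nc_eval env t - nc_eval env u = nc_eval env (NCadd t (NCopp u)) by [].
rewrite -nc_norm_eval /ncp_eval.
elim: (nc_norm _) h => [|c p IH] /=; first by rewrite big_nil.
by case=> c0 /IH /eqP; rewrite big_cons c0 scale0r add0r => ->.
Qed.

End NCNormal.

Ltac nc_mem x l :=
  lazymatch l with
  | [::] => constr:(false)
  | x :: _ => constr:(true)
  | _ :: ?l => nc_mem x l
  end.
Ltac nc_pos x l :=
  lazymatch l with
  | x :: _ => constr:(0%N)
  | _ :: ?l => let n := nc_pos x l in constr:(S n)
  end.
Ltac nc_atoms t l :=
  lazymatch t with
  | (?a + ?b)%R => let l := nc_atoms a l in nc_atoms b l
  | (?a * ?b)%R => let l := nc_atoms a l in nc_atoms b l
  | (- ?a)%R => nc_atoms a l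
  | (_ *: ?a)%R => nc_atoms a l
  | 1%R => l
  | 0%R => l
  | _ => lazymatch nc_mem t l with true => l | false => constr:(t :: l) end
  end.
Ltac nc_reify F t l :=
  lazymatch t with
  | (?a + ?b)%R => let a := nc_reify F a l in let b := nc_reify F b l in
      constr:(NCadd a b)
  | (?a * ?b)%R => let a := nc_reify F a l in let b := nc_reify F b l in
      constr:(NCmul a b)
  | (- ?a)%R => let a := nc_reify F a l in constr:(NCopp a)
  | (?c *: ?a)%R => let a := nc_reify F a l in constr:(NCscale (F := F) c a)
  | 1%R => constr:(NCone F)
  | 0%R => constr:(NCzero F)
  | _ => let i := nc_pos t l in constr:(NCvar F i)
  end.
(* Leaves one scalar equation per word. *)
Ltac nc_ring A :=
  lazymatch type of A with algType ?F =>
  lazymatch goal with |- ?t = ?u =>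
    let T := type of t in
    let l := nc_atoms t (@nil T) in
    let l := nc_atoms u l in
    let rt := nc_reify F t l in
    let ru := nc_reify F u l in
    refine (@nc_normP F A l rt ru _);
    cbv [nc_norm ncp_zero ncp_add ncp_mul ncp_mon ncp_ins ncw_eq Nat.eqb
         cat fst snd]; repeat split
  end end.

(** * Serre polynomials in two commuting variables *)

Section ThreeTerm.
Variables (R : comNzRingType) (v e l r : R).

(** For [A = v ^- k] the last factor vanishes; this is what ends a chain of commutators at the Serre
    order. *)
Definition ttc (A : R) (k : nat) : R :=
  - e * (1 - v ^+ (2 * k).+2) * (1 - A ^+ 2 * v ^+ (2 * k)).

(* For [A = v ^ (1 - N)] the polynomial [ttQ A N] is the product of the
   [ttD (v ^ k) (v ^ - k)] over [k = N - 1, N - 3, ... > 0], times [l - r] if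
   [N] is odd. *)
Fixpoint ttQ (A : R) (k : nat) : R :=
  if k is k'.+1 then
    (l - A * v ^+ (2 * k') * r) * ttQ A k'
    - (if k' is k''.+1 then ttc A k'' * ttQ A k'' else 0)
  else 1.

Definition ttD (A A' : R) : R :=
  l ^+ 2 - (A + A') * (l * r) + r ^+ 2 - e * (A - A') ^+ 2.

Lemma exp2S (k : nat) : v ^+ (2 * k.+1) = v ^+ 2 * v ^+ (2 * k).
Proof. by rewrite mulnS exprD. Qed.

Lemma ttQSS A k : ttQ A k.+2 =
  (l - A * v ^+ (2 * k.+1) * r) * ttQ A k.+1 - ttc A k * ttQ A k.
Proof. by []. Qed.

(** Both correction terms vanish when [A ^ 2 * v ^ (2k + 2) = 1], which lets [ttQ_step] split off a
    quadratic factor. That value of [A] depends on [k], whereas the induction keeps [A] fixed, so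
    the relation is needed for general [A]. The recurrence has two steps, hence the statements for
    [k] and [k + 1] are carried together. *)
Lemma ttQ_contiguous A A' k : A * A' = 1 ->
  ttD A A' * ttQ (A * v ^+ 2) k =
  ttQ A k.+2 + A' * (A ^+ 2 * v ^+ (2 * k).+2 - 1) * r * ttQ A k.+1
  + e * (v ^+ (2 * k).+2 - A' ^+ 2) * (1 - A ^+ 2 * v ^+ (2 * k)) * ttQ A k.
Proof.
move=> AA'.
have [] // : (ttD A A' * ttQ (A * v ^+ 2) k =
  ttQ A k.+2 + A' * (A ^+ 2 * v ^+ (2 * k).+2 - 1) * r * ttQ A k.+1
  + e * (v ^+ (2 * k).+2 - A' ^+ 2) * (1 - A ^+ 2 * v ^+ (2 * k)) * ttQ A k) /\
  (ttD A A' * ttQ (A * v ^+ 2) k.+1 =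
  ttQ A k.+3 + A' * (A ^+ 2 * v ^+ (2 * k.+1).+2 - 1) * r * ttQ A k.+2
  + e * (v ^+ (2 * k.+1).+2 - A' ^+ 2) * (1 - A ^+ 2 * v ^+ (2 * k.+1))
    * ttQ A k.+1).
elim: k => [|k [IH1 IH2]].
  rewrite !ttQSS /= /ttD /ttc /= !muln0 !muln1 !expr0 !exprS; split; ring: AA'.
split=> //.
rewrite (ttQSS (A * v ^+ 2) k).
rewrite mulrBr mulrCA IH2 [ttD A A' * (_ * _)]mulrCA IH1.
rewrite (ttQSS A k.+2) (ttQSS A k.+1) (ttQSS A k) /ttc.
rewrite !mulnS !add2n !exprS.
move: (ttQ A k) (ttQ A k.+1) (v ^+ (2 * k)) => Q0 Q1 t.
ring: AA'.
Qed.

Lemma ttQ_step A A' N : A * A' = 1 -> A ^+ 2 * v ^+ (2 * N).+2 = 1 ->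
  ttQ A N.+2 = ttD A A' * ttQ (A * v ^+ 2) N.
Proof.
move=> AA' AN; rewrite (ttQ_contiguous _ AA') AN subrr mulr0 !mul0r addr0.
have -> : e * (v ^+ (2 * N).+2 - A' ^+ 2) = 0.
  have -> : v ^+ (2 * N).+2 = A' ^+ 2.
    rewrite -[LHS]mul1r -[1](expr1n _ 2) -AA' exprMn -mulrA [A' ^+ 2 * _]mulrC.
    by rewrite mulrA AN mul1r.
  by rewrite subrr mulr0.
by rewrite !mul0r addr0.
Qed.

End ThreeTerm.

Lemma ttc_rmorph (R S : comNzRingType) (f : {rmorphism R -> S}) v e a k :
  ttc (f v) (f e) (f a) k = f (ttc v e a k).
Proof.
rewrite /ttc (rmorphM f) (rmorphM f) (rmorphN f) !(rmorphB f) !(rmorph1 f).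
by rewrite (rmorphXn f) (rmorphM f (a ^+ 2)) !(rmorphXn f).
Qed.

(** * Quantum integers *)

Section QuantumIntegers.
Variables (F : fieldType) (v : F).

Lemma qintE (n : nat) : qint v n = (v ^+ n - v ^- n) / (v - v^-1).
Proof. by rewrite /qint -exprnN. Qed.

Lemma qint0 : qint v 0%N = 0.
Proof. by rewrite /qint oppr0 subrr mul0r. Qed.

Lemma qint_inv n : qint v^-1 n = qint v n.
Proof.
by rewrite /qint invrK !exprz_inv opprK -[v^-1 - v]opprB invrN mulrN -mulNr opprB.
Qed.

Hypotheses (v0 : v != 0) (v1 : forall n, (0 < n)%N -> v ^+ n != 1).

Lemma sub_inv_neq0 : v - v^-1 != 0.
Proof.
rewrite subr_eq0; apply: contra (v1 (isT : 0 < 2)%N) => /eqP vV.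
by rewrite expr2 {1}vV mulVf.
Qed.

Lemma qint_neq0 (n : nat) : (0 < n)%N -> qint v n != 0.
Proof.
move=> n0; rewrite qintE mulf_neq0 ?invr_eq0 ?sub_inv_neq0 // subr_eq0.
have /v1: (0 < n + n)%N by rewrite addn_gt0 n0.
by apply: contra => /eqP vV; rewrite exprD {1}vV mulVf // expf_neq0.
Qed.

Lemma sqr_sub1_neq0 : v * v - 1 != 0.
Proof. by rewrite subr_eq0 -expr2 v1. Qed.

(** A law of cosines. In [qconv_step] it cancels the terms of degree [N], while [qint_consecutive]
    collects those of degree [N + 2]. *)
Lemma qint_add_sqr (x y : nat) :
  qint v x ^+ 2 + qint v y ^+ 2
  + (v ^+ (x + y) + v ^- (x + y)) * (qint v x * qint v y)
  = qint v (x + y)%N ^+ 2.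
Proof.
rewrite !qintE exprD.
have := expf_neq0 x v0; have := expf_neq0 y v0.
move: (v ^+ x) (v ^+ y) => a b b0 a0; field.
by rewrite v0 a0 b0 sqr_sub1_neq0.
Qed.

Lemma qint_consecutive (x y : nat) :
  qint v x * qint v x.-1
  + (v ^+ (x + y).-1 + v ^- (x + y).-1) * (qint v x * qint v y)
  + qint v y * qint v y.-1
  = qint v (x + y)%N * qint v (x + y).-1.
Proof.
case: x => [|x]; first by rewrite qint0 !mul0r !mulr0 !add0r add0n.
case: y => [|y]; first by rewrite qint0 !mul0r !mulr0 !addr0 addn0.
rewrite addSn addnS /= !qintE !exprS exprD.
have := expf_neq0 x v0; have := expf_neq0 y v0.
move: (v ^+ x) (v ^+ y) => a b b0 a0; field.
by rewrite v0 a0 b0 sqr_sub1_neq0.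
Qed.

Lemma qfact_neq0 n : qfact v n != 0.
Proof.
rewrite /qfact; elim: n => [|n IH]; first by rewrite big_nil oner_eq0.
by rewrite big_nat_recr //= mulf_neq0 // qint_neq0.
Qed.

Lemma qfactS n : qfact v n.+1 = qint v n.+1 * qfact v n.
Proof. by rewrite /qfact big_nat_recr //= mulrC. Qed.

Lemma qbinomE N n : (n <= N)%N ->
  qbinom v N n = qfact v N / (qfact v n * qfact v (N - n)).
Proof.
move=> nN; rewrite /qbinom invfM mulrA -[RHS]mulrAC; congr (_ / _).
elim: n nN => [|n IH] nN.
  by rewrite big_nil subn0 divff // qfact_neq0.
rewrite big_nat_recr //= IH; last exact: ltnW.
rewrite subzn; last exact: ltnW.
rewrite -(subnSK nN) qfactS; have := qfact_neq0 (N - n.+1).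
have : qint v (N - n.+1).+1 != 0 by rewrite qint_neq0.
by move: (qfact v _) (qint v _) (qfact v _) => x y z y0 z0; field; rewrite y0 z0.
Qed.

End QuantumIntegers.

Section BigShift.
Variable (V : zmodType).
Implicit Type f : nat -> V.

Lemma big_shift_lo f n : f 0%N = 0 ->
  \sum_(0 <= i < n) f i.+1 = \sum_(0 <= i < n.+1) f i.
Proof. by move=> f0; rewrite [RHS]big_nat_recl // f0 add0r. Qed.

Lemma big_shift_hi f n : f n = 0 ->
  \sum_(0 <= i < n) f i = \sum_(0 <= i < n.+1) f i.
Proof. by move=> f0; rewrite [RHS]big_nat_recr //= f0 addr0. Qed.

End BigShift.

(** * Alternating sums of products of two sequences with a three-term recurrence *)

Section IdividedConvolution.
Variables (F : fieldType) (v e : F).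
Hypotheses (v0 : v != 0) (v1 : forall n, (0 < n)%N -> v ^+ n != 1).
Variables (R : comNzRingType) (cst : {rmorphism F -> R}) (l r : R).
Variables (lq rq : nat -> R) (cl cr : nat -> bool).

Local Notation "[ n ]q" := (cst (qint v n%:Z)) (format "[ n ]q").

Hypothesis lqE : forall n, l * lq n =
  [n.+1]q * lq n.+1 + (if cl n then cst e * [n]q else 0) * lq n.-1.
Hypothesis rqE : forall n, r * rq n =
  [n.+1]q * rq n.+1 + (if cr n then cst e * [n]q else 0) * rq n.-1.
Hypothesis clS : forall n, cl n.+1 = ~~ cl n.
Hypothesis crS : forall n, cr n.+1 = ~~ cr n.

Definition qconv N := \sum_(0 <= n < N.+1) (-1) ^+ n * (lq n * rq (N - n)).

(** The hypothesis makes the two lowering flags complementary in each summand. They also alternate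
    along each sequence, so no term of degree [N - 2] arises from the quadratic factor; those of
    degree [N] cancel, and those of degree [N + 2] have a constant coefficient. *)
Lemma qconv_step N : cl N.+1 = cr 0 ->
  [N.+2]q * [N.+1]q * qconv N.+2 =
  (l ^+ 2 - cst (v ^+ N.+1 + v ^- N.+1) * (l * r) + r ^+ 2
   - cst (e * qint v N.+1 ^+ 2)) * qconv N.
Proof.
move=> clr.
have clcr n : (n <= N)%N -> cl n.+1 = cr (N - n).
  elim: {n}(N - n)%N {-2}n (erefl (N - n)%N) => [|k IH] n nN leN.
    have -> : n = N by apply/eqP; rewrite eqn_leq leN -subn_eq0 nN.
    by rewrite subnn.
  have nN' : (n < N)%N by rewrite -subn_gt0 nN.
  have kE : (N - n.+1)%N = k by rewrite subnS nN.
  by rewrite nN crS -kE -(IH n.+1 kE nN') (clS n.+1) negbK.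
set c := v ^+ N.+1 + v ^- N.+1.
rewrite (rmorphM cst e) (rmorphXn cst).
have lq2 n : l ^+ 2 * lq n = [n.+1]q * [n.+2]q * lq n.+2 +
    cst e * ((if cl n.+1 then [n.+1]q ^+ 2 else 0)
             + (if cl n then [n]q ^+ 2 else 0)) * lq n.
  rewrite expr2 -mulrA lqE mulrDr mulrCA lqE mulrCA lqE clS.
  case: n => [|n] /=; first by rewrite qint0 rmorph0; case: (cl 0) => /=; ring.
  by rewrite clS; case: (cl n) => /=; ring.
have rq2 n : r ^+ 2 * rq n = [n.+1]q * [n.+2]q * rq n.+2 +
    cst e * ((if cr n.+1 then [n.+1]q ^+ 2 else 0)
             + (if cr n then [n]q ^+ 2 else 0)) * rq n.
  rewrite expr2 -mulrA rqE mulrDr mulrCA rqE mulrCA rqE crS.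
  case: n => [|n] /=; first by rewrite qint0 rmorph0; case: (cr 0) => /=; ring.
  by rewrite crS; case: (cr n) => /=; ring.
pose t m n := (-1) ^+ n * (lq n * rq (m - n)%N).
(* [u1], [u2], [u3] are the raising parts of [l ^ 2], [r ^ 2] and [l * r]. The term [u4] keeps both
   indices; [u5] and [u6] come from [l * r] with one index raised and the other lowered. *)
pose u1 n := [n]q * [n.-1]q * t N.+2 n.
pose u2 n := [N.+2 - n]q * [(N.+2 - n).-1]q * t N.+2 n.
pose u3 n := cst c * ([n]q * [N.+2 - n]q) * t N.+2 n.
pose u4 n := cst e * ((if cl n.+1 then [n.+1]q ^+ 2 else 0)
   + (if cl n then [n]q ^+ 2 else 0)
   + (if cl n then [(N - n).+1]q ^+ 2 else 0)
   + (if cl n.+1 then [N - n]q ^+ 2 else 0) - [N.+1]q ^+ 2) * t N n.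
pose u5 n := cst c * cst e * (if cl n.+1 then [n.+1]q * [N - n]q else 0) * t N n.
pose u6 n := cst c * cst e * (if cl n then [n]q * [N.+1 - n]q else 0) * t N n.
have -> : (l ^+ 2 - cst c * (l * r) + r ^+ 2
   - cst e * [N.+1]q ^+ 2) * qconv N =
   \sum_(0 <= n < N.+1) (u1 n.+2 + u2 n + u3 n.+1 + u4 n
     + (if n is n'.+1 then u5 n' else 0) + u6 n.+1).
  rewrite /qconv big_distrr /=; apply: eq_big_nat => n /andP[_ nN].
  transitivity ((-1) ^+ n * ((l ^+ 2 * lq n) * rq (N - n)%N
     - cst c * ((l * lq n) * (r * rq (N - n)%N))
     + lq n * (r ^+ 2 * rq (N - n)%N)
     - cst e * [N.+1]q ^+ 2 * (lq n * rq (N - n)%N))).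
    by ring.
  rewrite lq2 rq2 lqE rqE -(clcr n) // crS -(clcr n) // clS negbK.
  have nN' : (n <= N)%N by [].
  have E0 : (N.+1 - n = (N - n).+1)%N by rewrite subSn.
  have E1 : (N.+2 - n = (N - n).+2)%N by rewrite !subSn // ltnW.
  have E2 : (N - n.+1 = (N - n).-1)%N by rewrite subnS.
  rewrite /u1 /u2 /u3 /u4 /u5 /u6 /t !subSS E0 E1 E2 /=.
  case: n nN nN' {E0 E1} E2 => [|n] nN nN' E2.
    rewrite clS qint0 rmorph0; case: (N - 0)%N => [|k] /=.
      by rewrite qint0 rmorph0; case: (cl 0) => /=; ring.
    by case: (cl 0) => /=; ring.
  have -> : (N - n = (N - n.+1).+1)%N by rewrite subnSK.
  rewrite !clS !exprS /=; case: (N - n.+1)%N => [|k] /=.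
    by rewrite qint0 rmorph0; case: (cl n) => /=; ring.
  by case: (cl n) => /=; ring.
have z0 k : k = 0%N -> [k]q = 0 by move=> ->; rewrite qint0 rmorph0.
rewrite !big_split /=.
rewrite (big_shift_lo (f := fun n => u1 n.+1)); last first.
  by rewrite /u1 [[1.-1]q]z0 // mulr0 mul0r.
rewrite (big_shift_lo (f := u1)); last by rewrite /u1 z0 // !mul0r.
rewrite (big_shift_hi (f := u2) (n := N.+1)); last first.
  by rewrite /u2 [[(N.+2 - N.+1).-1]q]z0 ?mulr0 ?mul0r // subSnn.
rewrite (big_shift_hi (f := u2)); last by rewrite /u2 [[N.+2 - _]q]z0 ?subnn ?mul0r.
rewrite (big_shift_lo (f := u3)); last by rewrite /u3 z0 // !(mul0r, mulr0).
rewrite (big_shift_hi (f := u3)); last first.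
  by rewrite /u3 [[N.+2 - _]q]z0 ?subnn // !(mulr0, mul0r).
rewrite [X in _ + X + _]big_nat_recl // add0r.
rewrite (big_shift_hi (f := u5)); last first.
  by rewrite /u5 [[N - N]q]z0 ?subnn // mulr0 if_same !(mulr0, mul0r).
rewrite (big_shift_lo (f := u6)); last by rewrite /u6 z0 // mul0r if_same mulr0 mul0r.
rewrite -(big_shift_hi (f := u6)); last first.
  by rewrite /u6 [[N.+1 - N.+1]q]z0 ?subnn // mulr0 if_same !(mulr0, mul0r).
rewrite -2!addrA -!big_split /= [X in _ + X]big1_seq => [|n].
  rewrite addr0 /qconv big_distrr; apply: eq_big_nat => n /andP[_ nN].
  have nN2 : (n + (N.+2 - n))%N = N.+2 by rewrite subnKC.
  have := qint_consecutive v0 v1 n (N.+2 - n); rewrite nN2 /= -/c => E.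
  by rewrite -rmorphM -E /u1 /u2 /u3 /t; ring.
rewrite mem_index_iota => /andP[_ nN]; rewrite /u4 /u5 /u6 !clS.
have E1 : (N.+1 - n = (N - n).+1)%N by rewrite subSn.
have nN1 : (n + (N - n))%N = N by rewrite subnKC.
rewrite E1; case: (cl n) => /=.
  have := qint_add_sqr v0 v1 n (N - n).+1.
  by rewrite addnS nN1 -/c -(rmorphXn cst 2 (qint v N.+1)) => <-; ring.
have := qint_add_sqr v0 v1 n.+1 (N - n).
by rewrite addSn nN1 -/c -(rmorphXn cst 2 (qint v N.+1)) => <-; ring.
Qed.
End IdividedConvolution.

(** * Idivided Serre sums as Serre polynomials *)

Section IdividedSerre.
Variables (F : fieldType) (v s : F).
Hypotheses (v0 : v != 0) (v1 : forall n, (0 < n)%N -> v ^+ n != 1).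

Local Notation "[ n ]q" := (qint v n%:Z) (format "[ n ]q").
Local Notation P p n := (idivpow v s ('X : {poly F}) p n).

(** The flag records whether multiplication by ['X] already gives the next polynomial or needs a
    correction. At [n = 0] the default value of [n.-1] is harmless because [[0] = 0]. *)
Lemma qfact_idivpow_rec (p : 'Z_2) n :
  'X * (qfact v n *: P p n) = qfact v n.+1 *: P p n.+1
    + (if odd n == (p == 1) then v * s * [n]q ^+ 2 else 0)
      *: (qfact v n.-1 *: P p n.-1).
Proof.
have AE (c : F) : c%:A = c%:P :> {poly F} by rewrite alg_polyC.
have gE m : qfact v m *: P p m = 'X ^+ odd m * \prod_(1 <= j < m./2.+1)
    ('X ^+ 2 - (v * s * qint v (if p == 1 then 2 * j%:Z - 1
       else if odd m then 2 * j%:Z else 2 * j%:Z - 2) ^+ 2)%:A).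
  by rewrite /idivpow scalerA mulfV ?scale1r ?qfact_neq0.
rewrite !{}gE.
rewrite -[n]odd_double_half; move: (odd n) n./2 => o k; case: o => /=.
  rewrite !add1n /= ?add0n uphalf_double half_double odd_double /=.
  case: (p == 1).
    rewrite (@big_nat_recr _ _ _ k.+1) //=.
     have -> : 2 * k.+1%:Z - 1 = k.*2.+1 by lia.
    move: (\prod_(1 <= j < k.+1) _) => m.
    by rewrite AE -mul_polyC; ring.
  rewrite (@big_nat_recl _ _ _ k.+1) //= scale0r addr0.
  have -> : 2 * 1%:Z - 2 = 0%N by [].
  rewrite qint0.
  under [in RHS]eq_bigr => j _ do
    (have -> : 2 * j.+1%:Z - 2 = 2 * j%:Z by lia).
  move: (\prod_(1 <= j < k.+1) _) => m.
  by rewrite expr0n /= mulr0 scale0r subr0; ring.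
rewrite !add0n uphalf_double /= half_double odd_double /=.
case: (p == 1) => /=; first by rewrite scale0r addr0 !expr0 !mul1r.
case: k => [|k].
  by rewrite !big_nil qint0 expr0n mulr0 scale0r addr0 !mul1r mulr1.
rewrite doubleS /= odd_double uphalf_double /=.
rewrite big_nat_recl //=.
have -> : 2 * 1%:Z - 2 = 0%N by [].
rewrite qint0.
rewrite (@big_nat_recr _ _ _ k.+1) //=.
under [in LHS]eq_bigr => j _ do
  (have -> : 2 * j.+1%:Z - 2 = 2 * j%:Z by lia).
have -> : 2 * k.+1%:Z = k.*2.+2 by lia.
move: (\prod_(1 <= j < k.+1) _) => m.
by rewrite expr0n /= mulr0 scale0r subr0 AE -mul_polyC; ring.
Qed.

Lemma idivpow_recX (p : 'Z_2) n :
  'X * P p n = [n.+1]q *: P p n.+1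
    + (if odd n == (p == 1) then v * s * [n]q else 0) *: P p n.-1.
Proof.
have q0 m : [m.+1]q != 0 by exact: qint_neq0.
have f0 m : qfact v m != 0 by exact: qfact_neq0.
have := congr1 (fun x => (qfact v n)^-1 *: x) (qfact_idivpow_rec p n).
rewrite -[in X in X = _]scalerAr [X in X = _]scalerA mulVf // scale1r => ->.
rewrite scalerDr !scalerA qfactS; congr (_ *: _ + _ *: _).
  by rewrite mulrCA mulVf ?mulr1.
case: ifP => _; last by rewrite !(mulr0, mul0r).
case: n => [|n] /=; first by rewrite qint0 expr2 !(mulr0, mul0r).
rewrite qfactS; move: (f0 n) (q0 n).
by move: (qfact v n) [n.+1]q => a b a0 b0; field; rewrite a0 b0.
Qed.

Definition cst : {rmorphism F -> {poly {poly F}}} := polyC \o polyC.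

(** The outer variable stands for left multiplication and the inner one for right multiplication;
    accordingly [p'] is the parity on the left and [p] the one on the right. *)
Definition isq (p p' : 'Z_2) N : {poly {poly F}} :=
  \sum_(0 <= n < N.+1) (-1) ^+ n * ((P p' n) ^:P * (P p (N - n))%:P).

Definition ttR (e' : F) N : {poly {poly F}} :=
  ttQ (cst v) (cst e') 'X ('X%:P) (cst (v ^- N.-1)) N.

Lemma ttR_step e' N : ttR e' N.+2 =
  ttD (cst e') 'X 'X%:P (cst (v ^- N.+1)) (cst (v ^+ N.+1)) * ttR e' N.
Proof.
rewrite /ttR -[N.+2.-1]/(N.+1) (@ttQ_step _ _ _ _ _ _ (cst (v ^+ N.+1))); last first.
- rewrite -rmorphXn -[cst v]/(cst v) -rmorphXn -rmorphM.
  by rewrite exprVn -exprM muln2 -addnn addSn addnS mul2n -addnn mulVf ?rmorph1 // expf_neq0.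
- by rewrite -rmorphM mulVf ?rmorph1 // expf_neq0.
congr (_ * _); case: N => [|N] //; congr (ttQ _ _ _ _ _ _).
rewrite -[N.+1.-1]/N.
rewrite -(rmorphXn cst) -(rmorphM cst); congr (cst _); rewrite !exprS; move: (expf_neq0 N v0).
by move: (v ^+ N) => a a0; field; rewrite v0 a0.
Qed.

(** Both sides gain the same quadratic factor when the order grows by two, and they agree for orders
    0 and 1. The constant comes from [v ^ k - v ^- k = (v - v^-1) [k]]. The right side does not
    involve the parities, which is why [p] may be chosen freely at each node. *)
Lemma isq_ttR (p p' : 'Z_2) N :
  (p' == 1) = (p == 1) (+) ~~ odd N ->
  cst (qfact v N) * isq p p' N = (-1) ^+ N * ttR (v * s / (v - v^-1) ^+ 2) N.
Proof.
have P0 x : P x 0%N = 1.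
  by rewrite /idivpow /qfact !big_nil invr1 scale1r mulr1.
have P1 x : P x 1%N = 'X.
  rewrite /idivpow /qfact /= big_nil big_nat1 qintE expr1 divff ?sub_inv_neq0 //.
  by rewrite invr1 scale1r mulr1.
set e' := _ / _; elim: N {-2}N (leqnn N) => [|N0 IH] N.
  case: N => // _ _; rewrite /isq big_nat1 /= !P0 /qfact big_nil.
  by rewrite !rmorph1 !mulr1.
case: N => [|[|N]] leN pp'; first exact: IH.
  rewrite /isq big_nat_recl // big_nat1 /= !P0 !P1 map_polyX.
  rewrite /qfact big_nat1 qintE expr1 divff ?sub_inv_neq0 //.
  by rewrite /ttR /= muln0 !expr0 invr1 !rmorph1; ring.
have lqE n : 'X * (P p' n) ^:P = cst (qint v n.+1) * (P p' n.+1) ^:P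
    + (if odd n == (p' == 1) then cst (v * s) * cst (qint v n) else 0)
      * (P p' n.-1) ^:P.
  have -> : 'X * (P p' n) ^:P = ('X * P p' n) ^:P by rewrite rmorphM /= map_polyX.
  rewrite idivpow_recX rmorphD -!mul_polyC !rmorphM /=.
  by rewrite !map_polyC /=; case: ifP => _; rewrite ?rmorph0 // -!rmorphM.
have rqE n : 'X%:P * (P p n)%:P = cst (qint v n.+1) * (P p n.+1)%:P
    + (if odd n == (p == 1) then cst (v * s) * cst (qint v n) else 0)
      * (P p n.-1)%:P.
  have -> : 'X%:P * (P p n)%:P = ('X * P p n)%:P by rewrite rmorphM.
  rewrite idivpow_recX rmorphD -!mul_polyC !rmorphM /=.
  by case: ifP => _; rewrite ?rmorph0 // -!rmorphM.
have cS n (b : bool) : (odd n.+1 == b) = ~~ (odd n == b).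
  by rewrite /=; case: (odd n) b => [] [].
have pN : (odd N.+1 == (p' == 1)) = (odd 0 == (p == 1)).
  by rewrite pp' /=; case: (p == 1) (odd N) => [] [].
have step : cst (qint v N.+2) * cst (qint v N.+1) * isq p p' N.+2 = _ * isq p p' N :=
  qconv_step v0 v1 lqE rqE (cS^~ _) (cS^~ _) pN.
have -> : cst (qfact v N.+2) * isq p p' N.+2 = cst (qfact v N)
    * (cst (qint v N.+2) * cst (qint v N.+1) * isq p p' N.+2).
  rewrite !qfactS; move: (qint v N.+2) (qint v N.+1) => x y.
  by rewrite (rmorphM cst) (rmorphM cst); ring.
rewrite step.
rewrite mulrCA IH ?pp' /= ?negbK //; last exact: ltnW.
rewrite ttR_step.
have DE : ttD (cst e') 'X 'X%:P (cst (v ^- N.+1)) (cst (v ^+ N.+1)) =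
    'X ^+ 2 - cst (v ^+ N.+1 + v ^- N.+1) * ('X * 'X%:P) + 'X%:P ^+ 2
    - cst (v * s * qint v N.+1 ^+ 2).
  rewrite /ttD -(rmorphB cst) -(rmorphXn cst) -(rmorphM cst) -(rmorphD cst).
  rewrite (addrC (v ^- _)); congr (_ - _ + _ - cst _).
  rewrite /e' qintE -[_ - v ^+ _]opprB sqrrN expr_div_n.
  by ring.
by rewrite DE !exprS; ring.
Qed.

End IdividedSerre.

(** * Linear endomorphisms of an algebra *)

Section LinearEndomorphisms.
Variables (F : fieldType) (V : algType F).

(* The carrier is an algebra only to ensure that it is not the zero space. *)
Record lend := Lend {
  lend_fun :> V -> V;
  lendP : forall c x y, lend_fun (c *: x + y) = c *: lend_fun x + lend_fun y }.

HB.instance Definition _ := gen_eqMixin lend.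
HB.instance Definition _ := gen_choiceMixin lend.

Lemma lend_ext (f g : lend) : f =1 g -> f = g.
Proof.
case: f g => [f fP] [g gP] /= /funext fg; subst g.
by congr Lend; apply: Prop_irrelevance.
Qed.

Lemma lendD (f : lend) x y : f (x + y) = f x + f y.
Proof. by rewrite -[x]scale1r lendP !scale1r. Qed.

Lemma lend0 (f : lend) : f 0 = 0.
Proof. by apply: (@addrI _ (f 0)); rewrite -lendD !addr0. Qed.

Lemma lendZ (f : lend) c x : f (c *: x) = c *: f x.
Proof. by rewrite -[c *: x]addr0 lendP lend0 addr0. Qed.

Lemma lendN (f : lend) x : f (- x) = - f x.
Proof. by rewrite -scaleN1r lendZ scaleN1r. Qed.

Lemma lendB (f : lend) x y : f (x - y) = f x - f y.
Proof. by rewrite lendD lendN. Qed.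

Lemma lend_sum (f : lend) (J : Type) (r : seq J) (G : J -> V) :
  f (\sum_(j <- r) G j) = \sum_(j <- r) f (G j).
Proof.
by elim: r => [|j r IH]; rewrite ?big_nil ?lend0 // !big_cons lendD IH.
Qed.

Definition lend_zero : lend.
Proof. by exists (fun=> 0) => c x y; rewrite scaler0 addr0. Defined.
Definition lend_add (f g : lend) : lend.
Proof.
by exists (fun x => f x + g x) => c x y; rewrite !lendP scalerDr addrACA.
Defined.
Definition lend_opp (f : lend) : lend.
Proof. by exists (fun x => - f x) => c x y; rewrite lendP scalerN opprD. Defined.
Definition lend_one : lend.
Proof. by exists id. Defined.
Definition lend_mul (f g : lend) : lend.
Proof. by exists (fun x => f (g x)) => c x y; rewrite !lendP. Defined.
Definition lend_scale (a : F) (f : lend) : lend.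
Proof.
by exists (fun x => a *: f x) => c x y; rewrite lendP scalerDr !scalerA mulrC.
Defined.

Let addA : associative lend_add.
Proof. by move=> f g h; apply: lend_ext => x /=; rewrite addrA. Qed.
Let addC : commutative lend_add.
Proof. by move=> f g; apply: lend_ext => x /=; rewrite addrC. Qed.
Let add0 : left_id lend_zero lend_add.
Proof. by move=> f; apply: lend_ext => x /=; rewrite add0r. Qed.
Let addN : left_inverse lend_zero lend_opp lend_add.
Proof. by move=> f; apply: lend_ext => x /=; rewrite addNr. Qed.

HB.instance Definition _ := GRing.isZmodule.Build lend addA addC add0 addN.

Let mulA : associative lend_mul.
Proof. by move=> f g h; apply: lend_ext. Qed.
Let mul1 : left_id lend_one lend_mul.
Proof. by move=> f; apply: lend_ext. Qed.
Let mulx1 : right_id lend_one lend_mul.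
Proof. by move=> f; apply: lend_ext. Qed.
Let mulDl : left_distributive lend_mul +%R.
Proof. by move=> f g h; apply: lend_ext. Qed.
Let mulDr : right_distributive lend_mul +%R.
Proof. by move=> f g h; apply: lend_ext => x /=; rewrite lendD. Qed.
Let one_neq0 : lend_one != 0.
Proof.
by apply/eqP => /(congr1 (fun f : lend => f 1)) /eqP /=; rewrite oner_eq0.
Qed.

HB.instance Definition _ := GRing.Zmodule_isNzRing.Build lend
  mulA mul1 mulx1 mulDl mulDr one_neq0.

Let scaleA a b f : lend_scale a (lend_scale b f) = lend_scale (a * b) f.
Proof. by apply: lend_ext => x /=; rewrite scalerA. Qed.
Let scale1 : left_id 1 lend_scale.
Proof. by move=> f; apply: lend_ext => x /=; rewrite scale1r. Qed.
Let scaleDr : right_distributive lend_scale +%R.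
Proof. by move=> c f g; apply: lend_ext => x /=; rewrite scalerDr. Qed.
Let scaleDl f : {morph lend_scale^~ f : a b / a + b}.
Proof. by move=> a b; apply: lend_ext => x /=; rewrite scalerDl. Qed.

HB.instance Definition _ := GRing.Zmodule_isLmodule.Build F lend
  scaleA scale1 scaleDr scaleDl.

Let scaleAl (c : F) (f g : lend) : c *: (f * g) = c *: f * g.
Proof. by apply: lend_ext. Qed.

HB.instance Definition _ := GRing.Lmodule_isLalgebra.Build F lend scaleAl.

Let scaleAr (c : F) (f g : lend) : c *: (f * g) = f * (c *: g).
Proof. by apply: lend_ext => x /=; rewrite lendZ. Qed.

HB.instance Definition _ := GRing.Lalgebra_isAlgebra.Build F lend scaleAr.

Lemma lend_addE (f g : lend) x : (f + g) x = f x + g x. Proof. by []. Qed.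
Lemma lend_oppE (f : lend) x : (- f) x = - f x. Proof. by []. Qed.
Lemma lend_subE (f g : lend) x : (f - g) x = f x - g x. Proof. by []. Qed.
Lemma lend_mulE (f g : lend) x : (f * g) x = f (g x). Proof. by []. Qed.
Lemma lend_scaleE c (f : lend) x : (c *: f) x = c *: f x. Proof. by []. Qed.
Lemma lend_zeroE x : (0 : lend) x = 0. Proof. by []. Qed.
Lemma lend_oneE x : (1 : lend) x = x. Proof. by []. Qed.

Lemma lend_sumE (J : Type) (r : seq J) (G : J -> lend) x :
  (\sum_(j <- r) G j) x = \sum_(j <- r) G j x.
Proof. by elim: r => [|j r IH]; rewrite ?big_nil // !big_cons lend_addE IH. Qed.

Definition lmul (b : V) : lend.
Proof. by exists (fun x => b * x) => c x y; rewrite mulrDr scalerAr. Defined.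
Definition rmul (b : V) : lend.
Proof. by exists (fun x => x * b) => c x y; rewrite mulrDl scalerAl. Defined.

Lemma lmulE b x : lmul b x = b * x. Proof. by []. Qed.

Lemma lrmulC b c : GRing.comm (lmul b) (rmul c).
Proof. by apply: lend_ext => x /=; rewrite !mulrA. Qed.

End LinearEndomorphisms.


(** * Polynomials acting through left and right multiplication *)

Section TwoSided.
Variables (F : fieldType) (A : algType F).
Implicit Types b y : A.

Lemma horner_alg_comm (B : algType F) (u w : B) (p : {poly F}) :
  GRing.comm u w -> GRing.comm u (horner_alg w p).
Proof.
move=> uw; elim/poly_ind: p => [|p c IH]; first by rewrite rmorph0; apply: commr0.
rewrite rmorphD rmorphM /= horner_algX horner_algC.
apply: commrD; first exact: commrM.
by rewrite /GRing.comm -scalerAl -scalerAr mul1r mulr1.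
Qed.

Lemma lr_commr b : commr_rmorph (horner_alg (rmul b)) (lmul b).
Proof. by move=> p; apply: horner_alg_comm; exact: lrmulC. Qed.

Definition lract b : {rmorphism {poly {poly F}} -> lend A} :=
  horner_morph (lr_commr b).

Lemma lract_l b y : lract b 'X y = b * y.
Proof. by rewrite /lract /= horner_morphX. Qed.

Lemma lract_r b y : lract b 'X%:P y = y * b.
Proof. by rewrite /lract /= horner_morphC /= horner_algX. Qed.

Lemma lract_cst b c y : lract b (cst F c) y = c *: y.
Proof. by rewrite /lract /= horner_morphC /= horner_algC. Qed.

Lemma horner_alg_rmul b p y : horner_alg (rmul b) p y = y * horner_alg b p.
Proof.
elim/poly_ind: p y => [|p c IH] y; first by rewrite !rmorph0 mulr0.
rewrite !rmorphD !rmorphM /= !horner_algX !horner_algC /= IH.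
have -> : horner_alg b p * b = b * horner_alg b p.
  by apply/esym/horner_alg_comm.
by rewrite mulrDr mulrA -scalerAr mulr1.
Qed.

Lemma lract_map b p y : lract b (p ^:P) y = horner_alg b p * y.
Proof.
elim/poly_ind: p y => [|p c IH] y; first by rewrite !rmorph0 mul0r.
rewrite !(rmorphD, rmorphM) /= map_polyX map_polyC /= IH lract_l.
rewrite horner_algX lract_cst mulrDl mulrA horner_algC.
by rewrite -scalerAl mul1r.
Qed.

Lemma lract_polyC b p y : lract b (p%:P) y = y * horner_alg b p.
Proof. by rewrite /lract /= horner_morphC /= horner_alg_rmul. Qed.

Lemma lract_comm b (f : lend A) P :
  GRing.comm f (lmul b) -> GRing.comm f (rmul b) -> GRing.comm f (lract b P).
Proof.
move=> fl fr; elim/poly_ind: P => [|P c IH]; first by rewrite rmorph0; apply: commr0.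
rewrite rmorphD rmorphM /= horner_morphX horner_morphC.
by apply: commrD; [exact: commrM|exact: horner_alg_comm].
Qed.

Lemma horner_alg_idivpow (v s : F) b p n :
  horner_alg b (idivpow v s 'X p n) = idivpow v s b p n.
Proof.
rewrite /idivpow -mul_polyC !rmorphM rmorphXn /= horner_algX horner_algC.
rewrite mulr_algl; congr (_ *: (_ * _)).
rewrite rmorph_prod; apply: eq_bigr => j _.
by rewrite rmorphB rmorphXn alg_polyC /= horner_algX horner_algC.
Qed.

Lemma lract_isq (v s : F) b y p p' N :
  lract b (isq v s p p' N) y = \sum_(0 <= n < N.+1)
    (-1) ^+ n *: (idivpow v s b p' n * y * idivpow v s b p (N - n)).
Proof.
rewrite /isq rmorph_sum lend_sumE; apply: eq_bigr => n _.
rewrite !rmorphM lend_mulE lend_mulE.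
rewrite lract_polyC lract_map !horner_alg_idivpow mulrA.
have -> : (-1) ^+ n = cst F ((-1) ^+ n) by rewrite rmorphXn rmorphN1.
by rewrite lract_cst.
Qed.

End TwoSided.

(** The form of a certificate: hypotheses are named as vanishing differences, [d] is a two-sided
    combination of them, and [a - b = d] then holds formally in the free algebra. *)
Lemma subr_cert (V : zmodType) (d a b : V) : d = 0 -> a - b = d -> a = b.
Proof. by move=> -> /eqP; rewrite subr_eq0 => /eqP. Qed.

Section SerreAction.
Variables (F : fieldType) (v : F).
Hypotheses (v0 : v != 0) (v1 : forall n, (0 < n)%N -> v ^+ n != 1).
Variable A : algType F.
Implicit Types b x y : A.

Lemma idiv_ttR (s : F) (p p' : 'Z_2) N b y :
  (p' == 1) = (p == 1) (+) ~~ odd N ->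
  qfact v N *: (\sum_(0 <= n < N.+1)
    (-1) ^+ n *: (idivpow v s b p' n * y * idivpow v s b p (N - n))) =
  (-1) ^+ N *: lract b (ttR v (v * s / (v - v^-1) ^+ 2) N) y.
Proof.
move=> pp'; rewrite -lract_isq -(lract_cst b) -lend_mulE -(rmorphM (lract b)).
rewrite isq_ttR // (rmorphM (lract b)) lend_mulE -(lract_cst b ((-1) ^+ N)).
by rewrite (rmorphXn (cst F)) (rmorphN1 (cst F)).
Qed.

Lemma idivpow_s0 b p n : idivpow v 0 b p n = divpow v b n.
Proof.
rewrite /idivpow /divpow; congr (_ *: _).
under eq_bigr do rewrite mulr0 mul0r scale0r subr0.
rewrite prodr_const_nat subn1 /= -exprM -exprD; congr (_ ^+ _).
by rewrite mul2n odd_double_half.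
Qed.

Lemma divpow_ttR N b y :
  qfact v N *: (\sum_(0 <= n < N.+1)
    (-1) ^+ n *: (divpow v b n * y * divpow v b (N - n))) =
  (-1) ^+ N *: lract b (ttR v 0 N) y.
Proof.
(* For [s = 0] idivided powers do not depend on the parity; these two values merely meet the side
   condition. *)
have := @idiv_ttR 0 0 (if odd N then 0 else 1) N b y.
rewrite mulr0 mul0r => <-; last by case: (odd N).
by under [in RHS]eq_bigr do rewrite !idivpow_s0.
Qed.

Lemma serre_ttR N b y :
  \sum_(0 <= n < N.+1)
    ((-1) ^+ n * qbinom v N n) *: (b ^+ n * y * b ^+ (N - n)) =
  (-1) ^+ N *: lract b (ttR v 0 N) y.
Proof.
rewrite -divpow_ttR scaler_sumr; apply: eq_big_nat => n /andP[_ nN].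
rewrite /divpow -!(scalerAl, scalerAr) !scalerA qbinomE // invfM.
by congr (_ *: _); ring.
Qed.

Lemma lract_scale b (c : F) P y : lract b P (c *: y) = c *: lract b P y.
Proof. exact: lendZ. Qed.

Lemma lract_factor b (a : F) k z :
  lract b ('X - cst F a * cst F v ^+ k * 'X%:P) z = b * z - (a * v ^+ k) *: (z * b).
Proof.
rewrite -rmorphXn -(rmorphM (cst F)) rmorphB (rmorphM (lract b)) lend_subE.
by rewrite lend_mulE lract_cst lract_l lract_r.
Qed.

(** The hypotheses repeat the recurrence of [ttQ]. Evaluating a Serre polynomial at a given element
    is thereby reduced to guessing a chain that starts there. *)
Lemma lract_chain b (e a : F) (y : nat -> A) :
  b * y 0%N - a *: (y 0%N * b) = y 1%N ->
  (forall k, b * y k.+1 - (a * v ^+ (2 * k.+1)) *: (y k.+1 * b) =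
     y k.+2 + ttc v e a k *: y k) ->
  forall k, lract b (ttQ (cst F v) (cst F e) 'X 'X%:P (cst F a) k) (y 0%N) = y k.
Proof.
move=> h0 hS; pose Q := ttQ (cst F v) (cst F e) 'X 'X%:P (cst F a); rewrite -/Q.
suff H k : lract b (Q k) (y 0%N) = y k /\ lract b (Q k.+1) (y 0%N) = y k.+1.
  by move=> k; have [] := H k.
elim: k => [|k [IH1 IH2]].
  have Q0 : lract b (Q 0%N) (y 0%N) = y 0%N by rewrite /Q /= rmorph1.
  split=> //; rewrite /Q /= subr0 mulr1 lract_factor muln0 expr0 mulr1.
  exact: h0.
have QSS : Q k.+2 = ('X - cst F a * cst F v ^+ (2 * k.+1) * 'X%:P) * Q k.+1
    - cst F (ttc v e a k) * Q k.
  by rewrite /Q ttQSS (ttc_rmorph (cst F)).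
split=> //; rewrite QSS (rmorphB (lract b)) !(rmorphM (lract b)) lend_subE !lend_mulE.
by rewrite IH1 IH2 lract_cst lract_factor hS addrK.
Qed.

End SerreAction.


Fixpoint ychain (F : fieldType) (v a : F) (A : algType F) (x y : A) k : A :=
  if k is k'.+1 then
    x * ychain v a x y k' - (a * v ^+ (2 * k')) *: (ychain v a x y k' * x)
  else y.

(** * Chains of twisted commutators *)

Section Chain.
Variables (F : fieldType) (v : F).
Variable A : algType F.
Implicit Types x y z m w : A.

(** The remainder [w] is left free because two kinds occur: a multiple of the preceding chain
    element in [chain_comm], and a torus term in the inhomogeneous case. *)
Lemma chain_step (a t s : F) x z m y w :
  z * x = v ^+ 2 *: (x * z) + s *: (1 - m * m) -> m * x = v ^+ 2 *: (x * m) ->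
  z * y = (a * t) *: (y * z) + w -> m * y = (a * t) *: (y * m) ->
  let y1 := x * y - (a * t) *: (y * x) in
  z * y1 = (a * (v ^+ 2 * t)) *: (y1 * z) +
    (v ^+ 2 *: (x * w) - (a * t) *: (w * x) + (s * (1 - a ^+ 2 * t ^+ 2)) *: y)
  /\ m * y1 = (a * (v ^+ 2 * t)) *: (y1 * m).
Proof.
move=> zx mx zy my y1.
have [d1 d1E d10] : exists2 d, d = z * x - (v ^+ 2 *: (x * z) + s *: (1 - m * m)) & d = 0.
  by exists 0; rewrite // zx subrr.
have [d2 d2E d20] : exists2 d, d = z * y - ((a * t) *: (y * z) + w) & d = 0.
  by exists 0; rewrite // zy subrr.
have [d3 d3E d30] : exists2 d, d = m * y - (a * t) *: (y * m) & d = 0.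
  by exists 0; rewrite // my subrr.
have [d4 d4E d40] : exists2 d, d = m * x - v ^+ 2 *: (x * m) & d = 0.
  by exists 0; rewrite // mx subrr.
split.
  apply: (subr_cert (d := d1 * y + v ^+ 2 *: (x * d2) - (a * t) *: (d2 * x)
    - (a ^+ 2 * t ^+ 2) *: (y * d1) - s *: (m * d3 + (a * t) *: (d3 * m)))).
    by rewrite d10 d20 d30 !(mulr0, mul0r, scaler0, addr0, subr0).
  by rewrite d1E d2E d3E /y1; nc_ring A; ring.
apply: (subr_cert (d := d4 * y + v ^+ 2 *: (x * d3) - (a * t) *: (d3 * x)
    - (a ^+ 2 * t ^+ 2) *: (y * d4))).
  by rewrite d40 d30 !(mulr0, mul0r, scaler0, addr0, subr0).
by rewrite d4E d3E /y1; nc_ring A; ring.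
Qed.

(** The element [y] plays the part of a highest weight vector for a twisted adjoint action: [ttc] is
    the coefficient with which the raising operator [z] undoes one lowering by [x]. *)
Lemma chain_comm (a e : F) x z m y :
  z * x = v ^+ 2 *: (x * z) + (e * (v ^+ 2 - 1)) *: (1 - m * m) ->
  m * x = v ^+ 2 *: (x * m) ->
  z * y = a *: (y * z) -> m * y = a *: (y * m) ->
  let yc := ychain v a x y in
  forall k, [/\ m * yc k = (a * v ^+ (2 * k)) *: (yc k * m),
    m * yc k.+1 = (a * v ^+ (2 * k.+1)) *: (yc k.+1 * m) &
    z * yc k.+1 = (a * v ^+ (2 * k.+1)) *: (yc k.+1 * z) + ttc v e a k *: yc k].
Proof.
move=> zx mx zy my yc; elim=> [|k [IH1 IH2 IH3]].
  have := @chain_step a 1 (e * (v ^+ 2 - 1)) x z m y 0 zx mx.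
  rewrite !mulr1 addr0 => /(_ zy my) [].
  rewrite mulr0 mul0r !scaler0 subrr add0r expr1n mulr1 => h1 h2.
  have yc1 : yc 1%N = x * y - a *: (y * x) by rewrite /yc /= muln0 expr0 mulr1.
  rewrite yc1 h1 h2; split=> //; congr (_ + _ *: _).
  by rewrite /ttc muln0 expr0 mulr1; ring.
have := @chain_step a (v ^+ (2 * k.+1)) (e * (v ^+ 2 - 1)) x z m _ _ zx mx IH3 IH2.
rewrite -exp2S; set t := v ^+ (2 * k.+1); set w := v ^+ 2 *: _ - _ + _.
have -> : w = ttc v e a k.+1 *: yc k.+1.
  have ycS : yc k.+1 = x * yc k - (a * v ^+ (2 * k)) *: (yc k * x) by [].
  rewrite /w ycS /ttc /t !mulnS !add2n !exprS.
  move: (yc k) (v ^+ (2 * k)) => y' t'.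
  by nc_ring A; ring.
by case.
Qed.

Lemma chain_lract (a e c : F) x z m y :
  z * x = v ^+ 2 *: (x * z) + (e * (v ^+ 2 - 1)) *: (1 - m * m) ->
  m * x = v ^+ 2 *: (x * m) ->
  z * y = a *: (y * z) -> m * y = a *: (y * m) ->
  forall k, lract (x + z + c *: m) (ttQ (cst F v) (cst F e) 'X 'X%:P (cst F a) k) y
    = ychain v a x y k.
Proof.
move=> zx mx zy my k.
apply: (lract_chain (y := ychain v a x y)) => [|{}k].
  rewrite /= muln0 expr0 mulr1 !mulrDl zy -scalerAl my.
  by nc_ring A; ring.
have [_ h2 h3] := chain_comm zx mx zy my k.
have -> : ychain v a x y k.+2 = x * ychain v a x y k.+1
  - (a * v ^+ (2 * k.+1)) *: (ychain v a x y k.+1 * x) by [].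
move: (ychain v a x y k) (ychain v a x y k.+1) h2 h3 => y0 y1 h2 h3.
rewrite !mulrDl -scalerAl h2 h3.
by nc_ring A; ring.
Qed.

Lemma chain_serre (a : F) x y k :
  lract x (ttQ (cst F v) (cst F 0) 'X 'X%:P (cst F a) k) y = ychain v a x y k.
Proof.
have h := @chain_lract a 0 0 x 0 0 y.
rewrite scale0r !addr0 in h; apply: h; by rewrite ?(mul0r, mulr0, scaler0, scale0r, addr0).
Qed.

End Chain.

(** * Inversion of the quantum parameter *)

Section Inverse.
Variables (F : fieldType) (v : F).
Hypotheses (v0 : v != 0) (v1 : forall n, (0 < n)%N -> v ^+ n != 1).

Lemma inv_not_root n : (0 < n)%N -> v^-1 ^+ n != 1.
Proof. by move=> n0; rewrite exprVn -(inj_eq invr_inj) invrK invr1 v1. Qed.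

Lemma qfact_inv n : qfact v^-1 n = qfact v n.
Proof. by apply: eq_bigr => k _; rewrite qint_inv. Qed.

Lemma idivpow_inv (A : algType F) s (b : A) p n :
  idivpow v^-1 (v ^+ 2 * s) b p n = idivpow v s b p n.
Proof.
rewrite /idivpow qfact_inv; congr (_ *: (_ * _)); apply: eq_bigr => j _.
by rewrite qint_inv mulrA expr2 mulKf.
Qed.

(** Idivided Serre sums involve only quantum integers and the product [v * s], so they do not change
    when [v] becomes [v^-1] and [s] becomes [v ^ 2 * s]; by [isq_ttR] the same holds for the
    polynomial. *)
Lemma ttR_inv e N : ttR v^-1 e N = ttR v e N.
Proof.
(* Chosen so that the constant in [isq_ttR] is [e]. *)
pose s := e * (v - v^-1) ^+ 2 / v.
have d0 := sub_inv_neq0 v0 v1.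
have eE : v * s / (v - v^-1) ^+ 2 = e.
  by rewrite /s; field; rewrite v0 sqr_sub1_neq0.
have eE' : v^-1 * (v ^+ 2 * s) / (v^-1 - v^-1^-1) ^+ 2 = e.
  rewrite /s invrK; field.
  by rewrite v0 mulNr subr_eq0 eq_sym -subr_eq0 sqr_sub1_neq0. 
pose p' : 'Z_2 := if odd N then 0 else 1.
have pp' : (p' == 1) = ((0 : 'Z_2) == 1) (+) ~~ odd N by rewrite /p'; case: (odd N).
have h1 := isq_ttR s v0 v1 pp'.
have := isq_ttR (v ^+ 2 * s) (invr_neq0 v0) inv_not_root pp'.
rewrite eE' (_ : isq _ _ _ _ _ = isq v s 0 p' N); last first.
  by apply: eq_bigr => n _; rewrite !idivpow_inv.
rewrite qfact_inv h1 eE => /(mulrI _) -> //.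
by apply: unitrX; rewrite unitrN unitr1.
Qed.

End Inverse.

(** * Torus factors and scalars in a chain *)

Section Twist.
Variables (F : fieldType) (v a : F) (A : algType F) (x m y n : A) (bt bt' : F).
Hypotheses (mx : m * x = bt *: (x * m)) (my : m * y = bt' *: (y * m)).
Hypotheses (nx : n * x = bt' *: (x * n)) (mn : m * n = n * m).

(** The scalar [bt'] occurs in both [my] and [nx]; this gives the two products in each twisted
    commutator the same factor once the torus elements have been moved to the right. *)
Lemma ychain_twist k : exists c : F,
  ychain v a (x * m) (y * n) k = c *: (ychain v a x y k * (m ^+ k * n)).
Proof.
have my' : forall k, m * ychain v a x y k = (bt ^+ k * bt') *: (ychain v a x y k * m).
  elim=> [|k' IH] /=; first by rewrite expr0 mul1r.
  move: (ychain v a x y k') (a * v ^+ (2 * k')) IH => z t IH.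
  rewrite mulrBr -scalerAr !mulrA mx IH -!scalerAl -!mulrA mx IH exprS.
  by nc_ring A; ring.
have mnx : forall k, m ^+ k * n * x = (bt ^+ k * bt') *: (x * (m ^+ k * n)).
  elim=> [|k' IH]; first by rewrite !expr0 !mul1r.
  rewrite exprS -!mulrA [_ * (n * x)]mulrA IH -scalerAr [m * (x * _)]mulrA mx.
  by rewrite -scalerAl scalerA -!mulrA exprS; congr (_ *: _); ring.
have mnm : forall k, m ^+ k * n * m = m ^+ k.+1 * n.
  by move=> k'; rewrite -mulrA -mn mulrA -exprSr.
elim: k => [|k [c IH]] /=; first by exists 1; rewrite expr0 mul1r scale1r.
exists (c * (bt ^+ k * bt')); rewrite IH.
have -> : x * m * (c *: (ychain v a x y k * (m ^+ k * n))) =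
    (c * (bt ^+ k * bt')) *: (x * ychain v a x y k * (m ^+ k.+1 * n)).
  rewrite -scalerAr -!mulrA [m * (ychain _ _ _ _ _ * _)]mulrA my' -!scalerAl.
  by rewrite -scalerAr scalerA exprS !mulrA.
have -> : c *: (ychain v a x y k * (m ^+ k * n)) * (x * m) =
    (c * (bt ^+ k * bt')) *: (ychain v a x y k * x * (m ^+ k.+1 * n)).
  have E : m ^+ k * n * (x * m) = (bt ^+ k * bt') *: (x * (m ^+ k.+1 * n)).
    by rewrite mulrA mnx -scalerAl -mulrA mnm.
  by rewrite -scalerAl -[_ * _ * (x * m)]mulrA E -scalerAr scalerA (mulrA (ychain _ _ _ _ _)).
by nc_ring A; ring.
Qed.

End Twist.

Section ChainScale.
Variables (F : fieldType) (v a : F) (A : algType F).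

Lemma ychain_scale (c d : F) (x y : A) k :
  ychain v a (c *: x) (d *: y) k = (c ^+ k * d) *: ychain v a x y k.
Proof.
elim: k => [|k IH] /=; first by rewrite expr0 mul1r.
by rewrite IH exprS; nc_ring A; ring.
Qed.

End ChainScale.

Section SerreCommutation.
Variables (F : fieldType) (v : F).
Hypotheses (v0 : v != 0) (v1 : forall n, (0 < n)%N -> v ^+ n != 1).
Variable A : algType F.

(** The elements [E * K'] and [K'] satisfy the hypotheses of [chain_comm], and [ttc] vanishes at the
    Serre order. So both commute with the last chain element up to the same scalar, which leaves
    plain commutation for [E]. *)
Lemma serre_commute (E X K K' y : A) N : (0 < N)%N ->
  K * K' = 1 -> K' * K = 1 -> K' * X = v ^+ 2 *: (X * K') ->
  E * X - X * E = (v - v^-1)^-1 *: (K - K') ->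
  E * y = y * E -> K' * y = v ^- N.-1 *: (y * K') ->
  E * ychain v (v ^- N.-1) X y N = ychain v (v ^- N.-1) X y N * E.
Proof.
case: N => // N _ KV VK VX EX Ey Vy; rewrite -[N.+1.-1]/N in Vy *.
have d0 := sub_inv_neq0 v0 v1.
pose e := v / (v - v^-1) ^+ 2.
have zx : E * K' * X = v ^+ 2 *: (X * (E * K'))
    + (e * (v ^+ 2 - 1)) *: (1 - K' * K').
  have ev : e * (v ^+ 2 - 1) = v ^+ 2 / (v - v^-1).
    by rewrite /e; field; rewrite v0 sqr_sub1_neq0.
  have EXE : E * X = X * E + (v - v^-1)^-1 *: (K - K') by rewrite -EX addrC subrK.
  transitivity (v ^+ 2 *: (E * X * K')); first by rewrite -!mulrA VX -scalerAr.
  rewrite EXE ev -KV; move: (v - v^-1)^-1 => d.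
  by nc_ring A; ring.
have zy : E * K' * y = v ^- N *: (y * (E * K')).
  by rewrite -mulrA Vy -scalerAr (mulrA E) Ey -mulrA.
have [_ h2 h3] := chain_comm zx VX zy Vy N.
have c0 : ttc v e (v ^- N) N = 0.
  have -> : ttc v e (v ^- N) N = - e * (1 - v ^+ (2 * N).+2) * 0.
    rewrite /ttc; congr (_ * _); rewrite exprVn -exprM muln2 -mul2n.
    by rewrite mulVf ?subrr // expf_neq0.
  by rewrite mulr0.
move: h3; rewrite c0 scale0r addr0 => h3.
rewrite -[LHS]mulr1 -VK -[RHS]mulr1 -VK !mulrA; congr (_ * K).
move: h2 h3; set t := _ * _ ^+ _; set Y := ychain _ _ _ _ _ => h2 h3.
have t0 : t != 0 by rewrite mulf_neq0 ?invr_eq0 ?expf_neq0.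
have : t *: (E * Y * K') = t *: (Y * E * K').
  by rewrite -mulrA scalerAr -h2 mulrA h3 mulrA.
exact: scalerI.
Qed.
End SerreCommutation.

(** * The torus part of [B_j] and the Cartan term *)

Section CartanTerm.
Variables (F : fieldType) (v : F).
Hypotheses (v0 : v != 0) (v1 : forall n, (0 < n)%N -> v ^+ n != 1).
Variable A : algType F.
Implicit Types b x y z m V : A.

(** With [v] inverted, [x] has exactly the twist that removes it from the commutators, so the chain
    consists of multiples of [z ^ k * V]. At the Serre order the last factor of the multiple is
    zero. *)
Lemma lract_vchain x z V N : (0 < N)%N ->
  z * x = v ^+ 2 *: (x * z) -> V * x = v ^- N.-1 *: (x * V) ->
  V * z = v ^+ N.-1 *: (z * V) ->
  lract (x + z) (ttR v 0 N) V = 0.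
Proof.
case: N => // N _ zx Vx Vz; rewrite -[N.+1.-1]/N in Vx Vz *.
pose a := v^-1 ^- N.
have aE : a = v ^+ N by rewrite /a exprVn invrK.
pose cf k := \prod_(0 <= j < k) (1 - a * v^-1 ^+ (2 * j) * a).
have xz k : x * z ^+ k = v^-1 ^+ (2 * k) *: (z ^+ k * x).
  elim: k => [|k IH]; first by rewrite muln0 !expr0 scale1r mulr1 mul1r.
  have xz1 : x * z = v^-1 ^+ 2 *: (z * x).
    by rewrite zx scalerA exprVn mulVf ?scale1r // expf_neq0.
  rewrite exprSr mulrA IH -scalerAl -(mulrA _ x) xz1 -scalerAr scalerA.
  by rewrite exp2S mulrC -!mulrA.
have xV : x * V = a *: (V * x).
  by rewrite Vx scalerA aE mulfV ?scale1r // expf_neq0.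
have step k : (x + z) * (cf k *: (z ^+ k * V))
    - (a * v^-1 ^+ (2 * k)) *: (cf k *: (z ^+ k * V) * (x + z))
    = cf k.+1 *: (z ^+ k.+1 * V).
  rewrite /cf big_nat_recr //= -/(cf k) !mulrDl !mulrDr -!scalerAr -!scalerAl.
  rewrite !(mulrA x) !(mulrA z) xz -!mulrA Vz -aE exprS -scalerAl -!mulrA xV.
  rewrite (_ : z ^+ k * (a *: (z * V)) = a *: (z * (z ^+ k * V))); last first.
    by rewrite -scalerAr !mulrA -exprSr -exprS.
  move: (v^-1 ^+ _) (z ^+ k) (cf k) => t w c.
  by nc_ring A; ring.
have y0 : V = cf 0%N *: (z ^+ 0 * V).
  by rewrite /cf big_nil scale1r expr0 mul1r.
rewrite -(ttR_inv v0 v1) /ttR -/a [X in lract _ _ X]y0.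
rewrite (@lract_chain F v^-1 A (x + z) 0 a (fun k => cf k *: (z ^+ k * V))).
- have -> : cf N.+1 = 0; last by rewrite scale0r.
  have vN : v ^+ N * v^-1 ^+ (2 * N) * v ^+ N = 1.
    rewrite mul2n -addnn exprD !exprVn; move: (expf_neq0 N v0).
    by move: (v ^+ N) => w w0; field.
  by rewrite /cf big_nat_recr //= aE vN subrr mulr0.
- by rewrite -step muln0 expr0 mulr1.
move=> k; rewrite step -[LHS]addr0; congr (_ + _).
by rewrite /ttc oppr0 !mul0r scale0r.
Qed.

(** The twist of [G] is the same with [x] and with [z], so [G] is multiplied by powers of [x + z].
    The twists of [H] are inverse to each other; [H] only meets powers of [x], with a coefficient
    that [tau_coef] evaluates at the Serre order. *)
Lemma lract_tau_chain (a c : F) x z y G H : a != 0 ->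
  z * x = v ^+ 2 *: (x * z) -> z * y = a *: (y * z) + c *: (G - H) ->
  a *: (G * x) = v ^+ 2 *: (x * G) -> a *: (G * z) = v ^+ 2 *: (z * G) ->
  H * x = (v ^+ 2 * a) *: (x * H) -> z * H = (v ^+ 2 * a) *: (H * z) ->
  forall k, lract (x + z) (ttQ (cst F v) (cst F 0) 'X 'X%:P (cst F a) k.+1) y =
    ychain v a x y k.+1
    + (c * \prod_(0 <= l < k) (1 - v ^+ (2 * l.+2))) *: ((x + z) ^+ k * G)
    - (c * ((1 - v ^+ (2 * k.+1)) / (1 - v ^+ 2)
         * \prod_(0 <= l < k) (1 - a ^+ 2 * v ^+ (2 * l.+1)))) *: (x ^+ k * H).
Proof.
move=> a0 zx zy Gx Gz Hx Hz.
pose Y := ychain v a x y.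
pose Pi k := \prod_(0 <= l < k) (1 - a ^+ 2 * v ^+ (2 * l.+1)).
pose g k := \prod_(0 <= l < k) (1 - v ^+ (2 * l.+2)).
pose f k := (1 - v ^+ (2 * k.+1)) / (1 - v ^+ 2) * Pi k.
have zstep k w : z * Y k = (a * v ^+ (2 * k)) *: (Y k * z) + w ->
    z * Y k.+1 = (a * v ^+ (2 * k.+1)) *: (Y k.+1 * z)
      + (v ^+ 2 *: (x * w) - (a * v ^+ (2 * k)) *: (w * x)).
  move=> h; have zx0 : z * x = v ^+ 2 *: (x * z) + 0 *: (1 - 0 * 0).
    by rewrite scale0r addr0.
  have [||-> _] := chain_step zx0 _ h; rewrite ?(mul0r, mulr0, scaler0) //.
  by rewrite -exp2S scale0r addr0.
have xHx k : x ^+ k * H * x = (v ^+ 2 * a) *: (x ^+ k.+1 * H).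
  by rewrite -mulrA Hx -scalerAr mulrA -exprSr.
have zY k : z * Y k.+1 = (a * v ^+ (2 * k.+1)) *: (Y k.+1 * z)
    - (c * (v ^+ (2 * k.+1) * (1 - a ^+ 2) * Pi k)) *: (x ^+ k.+1 * H).
  elim: k => [|k IH].
    rewrite (zstep 0%N (c *: (G - H))) => [|]; last by rewrite muln0 expr0 mulr1.
    congr (_ + _); rewrite muln0 expr0 mulr1 /Pi big_nil muln1 expr1.
    have [d1 d1E d10] : exists2 d, d = a *: (G * x) - v ^+ 2 *: (x * G) & d = 0.
      by exists 0; rewrite // Gx subrr.
    have [d2 d2E d20] : exists2 d, d = H * x - (v ^+ 2 * a) *: (x * H) & d = 0.
      by exists 0; rewrite // Hx subrr.
    apply: (subr_cert (d := (- c) *: d1 + (a * c) *: d2)).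
      by rewrite d10 d20 !scaler0 addr0.
    by rewrite d1E d2E; nc_ring A; ring.
  have IH' : z * Y k.+1 = (a * v ^+ (2 * k.+1)) *: (Y k.+1 * z) +
     (- (c * (v ^+ (2 * k.+1) * (1 - a ^+ 2) * Pi k))) *: (x ^+ k.+1 * H).
    by rewrite scaleNr.
  rewrite (zstep _ _ IH'); congr (_ + _).
  rewrite -!(scalerAr, scalerAl) xHx (mulrA x) -(exprS x).
  rewrite /Pi [in RHS]big_nat_recr //= -/(Pi k) (exp2S v k.+1).
  move: (Pi k) (v ^+ (2 * k.+1)) => p t.
  by nc_ring A; ring.
have zxk k : z * x ^+ k = v ^+ (2 * k) *: (x ^+ k * z).
  elim: k => [|k IH]; first by rewrite muln0 !expr0 scale1r mulr1 mul1r.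
  by rewrite exprSr mulrA IH -scalerAl -(mulrA _ z) zx -scalerAr scalerA exp2S mulrC -!mulrA.
have v21 : 1 - v ^+ 2 != 0 by rewrite subr_eq0 eq_sym v1.
elim=> [|k IH].
  have -> : ttQ (cst F v) (cst F 0) 'X 'X%:P (cst F a) 1 = 'X - cst F a * 'X%:P.
    by rewrite /= muln0 expr0 mulr1 mulr1 subr0.
  rewrite (rmorphB (lract _)) (rmorphM (lract _)) lend_subE lend_mulE.
  rewrite lract_cst lract_l lract_r !big_nil muln1 divff // !expr0 !mul1r !mulr1.
  rewrite /= muln0 expr0 mulr1 mulrDl zy.
  by nc_ring A; ring.
have c0 : ttc v 0 a k = 0 by rewrite /ttc oppr0 !mul0r.
rewrite ttQSS (ttc_rmorph (cst F)) c0 (rmorph0 (cst F)) mul0r subr0.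
rewrite (rmorphM (lract _)) lend_mulE {}IH lract_factor.
rewrite big_nat_recr //= big_nat_recr //=.
have [d1 d1E d10] : exists2 d, d = z * Y k.+1 - ((a * v ^+ (2 * k.+1)) *: (Y k.+1 * z)
    - (c * (v ^+ (2 * k.+1) * (1 - a ^+ 2) * Pi k)) *: (x ^+ k.+1 * H)) & d = 0.
  by exists 0; rewrite // zY subrr.
have [d2 d2E d20] : exists2 d, d = (x + z) * ((x + z) ^+ k * G) - (x + z) ^+ k.+1 * G & d = 0.
  by exists 0; rewrite // mulrA -exprS subrr.
have [d3 d3E d30] : exists2 d, d = a *: (((x + z) ^+ k * G) * (x + z))
    - v ^+ 2 *: ((x + z) ^+ k.+1 * G) & d = 0.
  exists 0 => //; rewrite -mulrA scalerAr mulrDr scalerDr Gx Gz -scalerDr -mulrDl.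
  by rewrite -scalerAr mulrA -exprSr subrr.
have [d4 d4E d40] : exists2 d, d = x * (x ^+ k * H) - x ^+ k.+1 * H & d = 0.
  by exists 0; rewrite // mulrA -exprS subrr.
have [d5 d5E d50] : exists2 d, d = z * (x ^+ k * H)
    - (a * v ^+ (2 * k.+1)) *: (x ^+ k * H * z) & d = 0.
  exists 0 => //; rewrite mulrA zxk -scalerAl -(mulrA _ z) Hz -scalerAr scalerA.
  rewrite exp2S (mulrA _ H); apply/eqP; rewrite eq_sym subr_eq0; apply/eqP.
  by congr (_ *: _); ring.
have [d6 d6E d60] : exists2 d, d = x ^+ k * H * x - (v ^+ 2 * a) *: (x ^+ k.+1 * H) & d = 0.
  by exists 0; rewrite // xHx subrr.
rewrite -/(Pi k) -/(g k) (exp2S v k.+1).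
move: d1E d2E d3E d4E d5E d6E.
rewrite -/(ychain v a x y k.+1) -/(Y k.+1).
move: (Y k.+1) (v ^+ (2 * k.+1)) (Pi k) (g k) => y1 t p gk.
move: ((x + z) ^+ k * G) ((x + z) ^+ k.+1 * G) (x ^+ k * H) (x ^+ k.+1 * H).
move=> u u1 w w1 d1E d2E d3E d4E d5E d6E.
apply: (subr_cert (d := (c * gk) *: d2 - (c * gk * t) *: d3
  - (c * ((1 - t) / (1 - v ^+ 2) * p)) *: (d4 + d5)
  + (c * ((1 - t) / (1 - v ^+ 2) * p) * a * t) *: d6 + d1)).
  by rewrite d10 d20 d30 d40 d50 d60 !(scaler0, addr0, subr0).
rewrite d1E d2E d3E d4E d5E d6E.
nc_ring A; field; rewrite -?expr2 ?v21 //.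
Qed.

Lemma cartan_step (e t kp : F) x z m C : t != 0 -> v ^+ 2 + t != 0 ->
  x * z = C * m - e *: (1 + v ^- 2 *: (m * m)) ->
  z * x = v ^+ 2 *: (x * z) + (e * (v ^+ 2 - 1)) *: (1 - m * m) ->
  m * x = v ^+ 2 *: (x * m) -> m * z = v ^- 2 *: (z * m) ->
  let b := x + z + kp *: m in
  let b1 := t^-1 *: x + t *: z + kp *: m in
  let c2 := kp * (1 - t) * (t ^+ 2 - v ^+ 2) / (t * (v ^+ 2 + t)) in
  let c1 := kp * (1 - t) * (1 - v ^+ 2 / t ^+ 2) - c2 * v ^+ 2 / t in
  b * b - (t + t^-1) *: (b * b1) + b1 * b1 - (e * (t - t^-1) ^+ 2) *: 1 =
  ((1 - t ^+ 2) + (1 - t ^- 2) * v ^+ 2) *: (C * m) + c1 *: (b * m) + c2 *: (m * b1)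
  + (- e * ((1 - t ^+ 2) / v ^+ 2 + (1 - t ^- 2) * v ^+ 2)
     + kp ^+ 2 * (2 - t - t^-1) - kp * (c1 + c2)) *: (m * m).
Proof.
move=> t0 vt xz zx mx mz b b1 c2 c1.
have [d1 d1E d10] : exists2 d, d = x * z - (C * m - e *: (1 + v ^- 2 *: (m * m))) & d = 0.
  by exists 0; rewrite // xz subrr.
have [d2 d2E d20] : exists2 d, d = z * x - (v ^+ 2 *: (x * z)
    + (e * (v ^+ 2 - 1)) *: (1 - m * m)) & d = 0.
  by exists 0; rewrite // zx subrr.
have [d3 d3E d30] : exists2 d, d = m * x - v ^+ 2 *: (x * m) & d = 0.
  by exists 0; rewrite // mx subrr.
have [d4 d4E d40] : exists2 d, d = m * z - v ^- 2 *: (z * m) & d = 0.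
  by exists 0; rewrite // mz subrr.
apply: (subr_cert (d := (1 - t ^+ 2) *: d1 + (1 - t ^- 2) *: (d2 + v ^+ 2 *: d1)
  + (kp * (t^-1 - t ^- 2) - c2 / t) *: d3 + (kp * (t - t ^+ 2) - c2 * t) *: d4)).
  by rewrite d10 d20 d30 d40 !(mulr0, mul0r, scaler0, addr0, subr0).
rewrite d1E d2E d3E d4E /b /b1 /c1 /c2.
nc_ring A; field; rewrite ?t0 ?v0 -?expr2 ?vt //.
Qed.

(** Induction on the order [2r + 1], applying its largest quadratic factor to [V]. The result
    combines [C * m * V], [b * m * V] and [m * V * b], killed by the remaining factors because
    [m * V] has the weight of the preceding order and these operators commute with multiplication by
    [C] and [b], with [m * m * V], killed by a still smaller product. At order 3 no smaller product
    exists, but the coefficient of [m * m * V] is zero. *)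
Lemma lract_cartan (e kp : F) x z m C r V : (2 : F) != 0 ->
  x * z = C * m - e *: (1 + v ^- 2 *: (m * m)) ->
  z * x = v ^+ 2 *: (x * z) + (e * (v ^+ 2 - 1)) *: (1 - m * m) ->
  m * x = v ^+ 2 *: (x * m) -> m * z = v ^- 2 *: (z * m) ->
  C * (x + z + kp *: m) = (x + z + kp *: m) * C ->
  V * x = v ^- (2 * r) *: (x * V) -> V * z = v ^+ (2 * r) *: (z * V) ->
  V * m = m * V ->
  lract (x + z + kp *: m) (ttR v e (2 * r).+1) V = 0.
Proof.
move=> n2 xz zx mx mz; set b := x + z + kp *: m => Cb.
elim: r {-2}r (leqnn r) V => [|r0 IH] r.
  rewrite leqn0 => /eqP -> V; rewrite muln0 expr0 invr1 !scale1r => Vx Vz Vm.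
  have -> : ttR v e 1 = 'X - 'X%:P.
    by rewrite /ttR /= muln0 !expr0 invr1 mulr1 subr0 mulr1 mul1r.
  rewrite (rmorphB (lract b)) lend_subE lract_l lract_r /b mulrDr mulrDr Vx Vz.
  by rewrite -scalerAr Vm scalerAl -!mulrDl subrr.
case: r => [|r] ler V Vx Vz Vm; first exact: IH.
pose t := v ^+ (2 * r.+1).
have t0 : t != 0 by rewrite expf_neq0.
(* For [t = v ^ 2] this is [2 * v ^ 2]; for higher [t] a zero would make [v] a root of unity. *)
have vt : v ^+ 2 + t != 0.
  rewrite /t exp2S -{1}[v ^+ 2]mulr1 -mulrDr mulf_neq0 ?expf_neq0 //.
  case: r {ler Vx Vz t t0} => [|r]; first by rewrite muln0 expr0.
  apply/negP; rewrite addr_eq0 => /eqP h.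
  have /v1/negP[] : (0 < 2 * (2 * r.+1))%N by [].
  by rewrite mulnC exprM -[v ^+ _]opprK -h sqrrN expr1n.
have [Vx' Vz'] : m * V * x = v ^- (2 * r) *: (x * (m * V)) /\
    m * V * z = v ^+ (2 * r) *: (z * (m * V)).
  rewrite -!mulrA Vx Vz -!scalerAr !mulrA mx mz -!scalerAl !scalerA exp2S.
  by split; congr (_ *: _); field; rewrite ?v0 ?expf_neq0.
have Vm' : m * V * m = m * (m * V) by rewrite -mulrA Vm.
have kill P u w : u = C * (m * V) \/ u = b * (m * V) \/ u = m * V * b ->
    lract b P (m * V) = 0 -> lract b P (w *: u) = 0.
  move=> hu h; rewrite lendZ.
  suff -> : lract b P u = 0 by rewrite scaler0.
  case: hu => [->|[->|->]].
  - have cC := lract_comm (f := lmul C) (b := b) P.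
    have -> : lract b P (C * (m * V)) = (lract b P * lmul C) (m * V) by [].
    rewrite -cC ?lend_mulE ?h ?lend0 //; last exact: lrmulC.
    by apply: lend_ext => w' /=; rewrite !mulrA Cb.
  - rewrite -(lract_l b) -lend_mulE -(rmorphM (lract b)) mulrC.
    by rewrite (rmorphM (lract b)) lend_mulE h lend0.
  - rewrite -(lract_r b) -lend_mulE -(rmorphM (lract b)) mulrC.
    by rewrite (rmorphM (lract b)) lend_mulE h lend0.
have h1 : lract b (ttR v e (2 * r).+1) (m * V) = 0 by apply: IH.
have NE : ((2 * r.+1).+1 = (2 * r).+3)%N by rewrite mulnS.
rewrite NE (ttR_step v0) mulrC (rmorphM (lract b)) lend_mulE.
rewrite -[(2 * r).+2]/(2 + 2 * r)%N -mulnS -/t.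
have -> : lract b (ttD (cst F e) 'X 'X%:P (cst F t^-1) (cst F t)) V =
    b * b * V - (t + t^-1) *: (b * V * b) + V * b * b - (e * (t - t^-1) ^+ 2) *: V.
  rewrite /ttD -(rmorphD (cst F)) -(rmorphB (cst F)) -(rmorphXn (cst F)).
  rewrite -(rmorphM (cst F)) !(rmorphB (lract b), rmorphD (lract b)).
  rewrite !expr2 !(rmorphM (lract b)).
  move: (lract_l b) (lract_r b) (lract_cst b (t^-1 + t))
    (lract_cst b (e * ((t^-1 - t) * (t^-1 - t)))).
  move: (lract b 'X) (lract b 'X%:P) (lract b (cst F _)) (lract b (cst F _)).
  move=> X1 Y1 k1 k2 hX hY hk1 hk2.
  rewrite !lend_addE !lend_oppE !lend_mulE hk1 hk2 !hX !hY !mulrA [t + _]addrC.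
  by congr (_ - _ *: _); ring.
pose b1 := t^-1 *: x + t *: z + kp *: m.
have Vb : V * b = b1 * V.
  by rewrite /b /b1 mulrDr mulrDr !mulrDl Vx Vz -scalerAr Vm -!scalerAl.
have -> : b * b * V - (t + t^-1) *: (b * V * b) + V * b * b - (e * (t - t^-1) ^+ 2) *: V
  = (b * b - (t + t^-1) *: (b * b1) + b1 * b1 - (e * (t - t^-1) ^+ 2) *: 1) * V.
  rewrite Vb -[b * V * b]mulrA Vb -[b1 * V * b]mulrA Vb.
  by nc_ring A; ring.
have := cartan_step kp t0 vt xz zx mx mz; rewrite /= -/b -/b1 => ->.
set w1 := _ + _ * v ^+ 2; set w2 := _ - _ / t; set w3 := _ / (_ * _); set w4 := _ - kp * _.
have w40 : r = 0%N -> w4 = 0.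
  move=> r0E; have tE : t = v ^+ 2 by rewrite /t r0E muln1.
  rewrite /w4 /w2 /w3 tE; field.
  by rewrite v0 andbT -{2}tE vt.
clearbody b b1 w1 w2 w3 w4.
have -> : (w1 *: (C * m) + w2 *: (b * m) + w3 *: (m * b1) + w4 *: (m * m)) * V =
    w1 *: (C * (m * V)) + w2 *: (b * (m * V)) + w3 *: (m * V * b) + w4 *: (m * (m * V)).
  by rewrite -[m * V * b]mulrA Vb; nc_ring A; ring.
rewrite (lendD (lract b _)) (lendD (lract b _)) (lendD (lract b _)).
rewrite (kill _ (C * (m * V))) //; last by left.
rewrite (kill _ (b * (m * V))) //; last by right; left.
rewrite (kill _ (m * V * b)) //; last by right; right.
rewrite !add0r lendZ.
have [r0E|r_gt0] := posnP r; first by rewrite w40 // scale0r.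
suff -> : lract b (ttR v e (2 * r).+1) (m * (m * V)) = 0 by rewrite scaler0.
case: r r_gt0 ler Vx' Vz' {Vx Vz t t0 vt h1 NE b1 Vb kill w40} => // r _ ler Vx' Vz'.
rewrite mulnS add2n (ttR_step v0) (rmorphM (lract b)) lend_mulE.
rewrite IH ?lend0 //; first exact: ltnW.
- rewrite -mulrA Vx' -scalerAr !mulrA mx -!scalerAl scalerA exp2S.
  by congr (_ *: _); field; rewrite ?v0 ?expf_neq0.
- rewrite -mulrA Vz' -scalerAr !mulrA mz -!scalerAl scalerA exp2S.
  by congr (_ *: _); field; rewrite ?v0 ?expf_neq0.
by rewrite -mulrA Vm'.
Qed.

End CartanTerm.

Import Order.TTheory Num.Theory.

(** * Quantum groups *)

Section CartanFacts.
Variables (I : finType) (C : cartan_datum I) (D : root_datum C).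

Local Notation a := (cartan D).
Local Notation eps := (eps C).
Local Notation N i j := (one_sub_a D i j).

Lemma eps_cdot i : (eps i)%:Z * 2 = C i i.
Proof.
rewrite /Defs.eps gez0_abs; first by rewrite divzK // cdot_even.
by rewrite divz_ge0 // ltW // cdot_gt0.
Qed.

Lemma eps_gt0 i : (0 < eps i)%N.
Proof. by have := cdot_gt0 C i; rewrite -eps_cdot; case: (eps i). Qed.

Lemma cartan_eps i j : a i j * (eps i)%:Z = C i j.
Proof.
have := pairing_simple D i j; rewrite -/(a i j) -eps_cdot => h.
have : 2 * (a i j * (eps i)%:Z) = 2 * C i j by rewrite -h; ring.
by move/(mulfI (isT : (2 : int) != 0)).
Qed.

Lemma cartan_diag i : a i i = 2.
Proof.
have := cartan_eps i i; rewrite -eps_cdot [RHS]mulrC => /mulIf -> //.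
by rewrite eqz_nat -lt0n eps_gt0.
Qed.

Lemma cartan_le0 i j : i != j -> a i j <= 0.
Proof.
move=> ij; rewrite -(pmulr_lle0 _ (_ : 0 < (eps i)%:Z)) ?ltz_nat ?eps_gt0 //.
by rewrite cartan_eps cdot_le0.
Qed.

Lemma one_sub_aE i j : i != j -> 1 - a i j = (N i j)%:Z.
Proof. by move=> /cartan_le0 h; rewrite /one_sub_a gez0_abs //; lia. Qed.

Lemma one_sub_a_gt0 i j : i != j -> (0 < N i j)%N.
Proof. by move=> ij; have := one_sub_aE ij; have := cartan_le0 ij; lia. Qed.

Lemma cartanE i j : i != j -> a i j = - (N i j).-1%:Z.
Proof. by move=> ij; have := one_sub_aE ij; have := one_sub_a_gt0 ij; lia. Qed.

Variables (F : fieldType) (q : F).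
Local Notation qi := (qi C q).

Section NotRoot.
Hypotheses (q0 : q != 0) (q1 : forall n, (0 < n)%N -> q ^+ n != 1).

Lemma qi_neq0 i : qi i != 0.
Proof. by rewrite expf_neq0. Qed.

Lemma qi_not_root i n : (0 < n)%N -> qi i ^+ n != 1.
Proof. by move=> n0; rewrite /Defs.qi -exprM q1 // muln_gt0 eps_gt0. Qed.

End NotRoot.

Lemma qi_exp i (m : int) : qi i ^ m = q ^ (m * (eps i)%:Z).
Proof. by rewrite /Defs.qi [q ^+ _]exprnP exprz_exp mulrC. Qed.

Lemma qi_cartan i j : qi i ^ a i j = q ^ C i j.
Proof. by rewrite qi_exp cartan_eps. Qed.

Lemma qi_cartanC i j : qi i ^ a i j = qi j ^ a j i.
Proof. by rewrite !qi_cartan cdotC. Qed.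

Lemma qi_cartanNC i j : qi i ^ (- a i j) = qi j ^ (- a j i).
Proof. by rewrite !qi_exp !mulNr !cartan_eps cdotC. Qed.

Lemma qi_cartanV i j : i != j -> qi i ^ a i j = qi i ^- (N i j).-1.
Proof. by move=> ij; rewrite cartanE // exprnN. Qed.

Lemma qi_cartanNV i j : i != j -> qi i ^ (- a i j) = qi i ^+ (N i j).-1.
Proof. by move=> ij; rewrite cartanE // opprK. Qed.

Variable T : diagram_involution D.

Lemma cartan_tau i j : a (T i) (T j) = a i j.
Proof. by rewrite /cartan -tauY_coroot -tauX_root tau_pairing. Qed.

Lemma eps_tau i : eps (T i) = eps i.
Proof. by rewrite /Defs.eps tau_cdot. Qed.

Lemma qi_tau i : qi (T i) = qi i.
Proof. by rewrite /Defs.qi eps_tau. Qed.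

Lemma one_sub_a_tau i j : N (T i) (T j) = N i j.
Proof. by rewrite /one_sub_a cartan_tau. Qed.

Lemma tau_neq i j : i != j -> T i != T j.
Proof. by apply: contra => /eqP /(inv_inj (tauK T)) ->. Qed.

End CartanFacts.

Lemma ychain_eq0 (F : fieldType) (v a : F) (A : algType F) (x y : A) k :
  (0 < k)%N -> x * y = a *: (y * x) -> ychain v a x y k = 0.
Proof.
move=> k0 xy; elim: k k0 => // k IH _; case: k IH => [|k] IH.
  by rewrite /= muln0 expr0 mulr1 xy subrr.
by rewrite [ychain _ _ _ _ _]/= -/(ychain v a x y k.+1) IH // mulr0 mul0r scaler0 subrr.
Qed.

Section QuantumRelations.
Variables (I : finType) (C : cartan_datum I) (D : root_datum C).
Variables (F : fieldType) (q : F).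
Hypotheses (q0 : q != 0) (q1 : forall n, (0 < n)%N -> q ^+ n != 1).
Variables (A : algType F) (E Fo : I -> A) (K : rdY D -> A).

Local Notation a := (cartan D).
Local Notation eps := (eps C).
Local Notation qi := (qi C q).
Local Notation N i j := (one_sub_a D i j).
Local Notation dq i := (qi i - (qi i)^-1).
Local Notation h := (simple_coroot D).
Local Notation al := (simple_root D).

(** The Serre relations are left out because these hypotheses also have to cover the operators on
    the free algebra, where left multiplications by the [F_i] satisfy no Serre relation. *)
Record quantum_triple : Prop := QuantumTriple {
  qt_K0 : K 0 = 1;
  qt_KK : forall y y', K y * K y' = K (y + y');
  qt_KE : forall y i, K y * E i = q ^ pairing y (al i) *: (E i * K y);
  qt_KF : forall y i, K y * Fo i = q ^ (- pairing y (al i)) *: (Fo i * K y);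
  qt_EF : forall i j, E i * Fo j - Fo j * E i =
    ((i == j)%:R / dq i) *: (K (h i *+ eps i) - K (- (h i *+ eps i))) }.

Hypothesis qt : quantum_triple.

Local Notation Kt i := (K (h i *+ eps i)).
Local Notation KV i := (K (- (h i *+ eps i))).

Lemma KtKV i : Kt i * KV i = 1.
Proof. by rewrite (qt_KK qt) subrr (qt_K0 qt). Qed.

Lemma KVKt i : KV i * Kt i = 1.
Proof. by rewrite (qt_KK qt) addNr (qt_K0 qt). Qed.

Lemma KKC y y' : K y * K y' = K y' * K y.
Proof. by rewrite !(qt_KK qt) addrC. Qed.

Lemma pairing_mulrn (y : rdY D) x n : pairing (y *+ n) x = pairing y x * n%:Z.
Proof.
have p0 : pairing (0 : rdY D) x = 0.
  by apply: (@addrI _ (pairing 0 x)); rewrite -pairingDl !addr0.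
elim: n => [|n IH]; first by rewrite mulr0n mulr0.
by rewrite mulrS pairingDl IH intS mulrDr mulr1.
Qed.

Lemma pairingN (y : rdY D) x : pairing (- y) x = - pairing y x.
Proof.
apply: (@addrI _ (pairing y x)); rewrite -pairingDl !subrr.
by rewrite -[0]/((0 : rdY D) *+ 0) pairing_mulrn mulr0.
Qed.

Lemma KtE i j : Kt i * E j = qi i ^ a i j *: (E j * Kt i).
Proof. by rewrite (qt_KE qt) pairing_mulrn qi_exp. Qed.

Lemma KtF i j : Kt i * Fo j = qi i ^ (- a i j) *: (Fo j * Kt i).
Proof. by rewrite (qt_KF qt) pairing_mulrn qi_exp mulNr. Qed.

Lemma KVE i j : KV i * E j = qi i ^ (- a i j) *: (E j * KV i).
Proof. by rewrite (qt_KE qt) pairingN pairing_mulrn qi_exp mulNr. Qed.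

Lemma KVF i j : KV i * Fo j = qi i ^ a i j *: (Fo j * KV i).
Proof. by rewrite (qt_KF qt) pairingN pairing_mulrn qi_exp opprK. Qed.

Lemma EF_comm i j : i != j -> E i * Fo j = Fo j * E i.
Proof.
by move=> ij; apply/eqP; rewrite -subr_eq0 (qt_EF qt) (negbTE ij) mul0r scale0r.
Qed.

Lemma EF_diag i : E i * Fo i - Fo i * E i = (dq i)^-1 *: (Kt i - KV i).
Proof. by rewrite (qt_EF qt) eqxx mul1r. Qed.

Lemma serre_ychain i j (x y : A) : i != j ->
  serre D q i j x y = (-1) ^+ N i j *: ychain (qi i) (qi i ^- (N i j).-1) x y (N i j).
Proof.
move=> ij; rewrite /serre (one_sub_aE D ij) -chain_serre -/(ttR (qi i) 0 (N i j)).
by rewrite -serre_ttR //; [exact: qi_neq0|exact: qi_not_root].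
Qed.

Lemma serre_ychainV i j (x y : A) : i != j ->
  serre D q i j x y = (-1) ^+ N i j *: ychain (qi i)^-1 ((qi i)^-1 ^- (N i j).-1) x y (N i j).
Proof.
move=> ij; rewrite /serre (one_sub_aE D ij) -chain_serre.
rewrite -/(ttR (qi i)^-1 0 (N i j)) ttR_inv; [|exact: qi_neq0|exact: qi_not_root].
by rewrite -serre_ttR //; [exact: qi_neq0|exact: qi_not_root].
Qed.

Lemma serreB i j (x y y' : A) :
  serre D q i j x (y - y') = serre D q i j x y - serre D q i j x y'.
Proof.
rewrite /serre -sumrB; apply: eq_bigr => n _.
by rewrite mulrBr mulrBl scalerBr.
Qed.

Lemma serreZ i j c (x y : A) :
  serre D q i j x (c *: y) = c *: serre D q i j x y.
Proof.
rewrite /serre scaler_sumr; apply: eq_bigr => n _.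
by rewrite -scalerAr -scalerAl !scalerA mulrC.
Qed.

Lemma serre_derivation i j (e x y : A) : e * x = x * e ->
  e * serre D q i j x y - serre D q i j x y * e = serre D q i j x (e * y - y * e).
Proof.
move=> ex; rewrite serreB; congr (_ - _).
  rewrite /serre mulr_sumr; apply: eq_bigr => n _.
  rewrite -scalerAr !mulrA; congr (_ *: (_ * _ * _)).
  by rewrite (commrX n (ex : GRing.comm e x)).
rewrite /serre mulr_suml; apply: eq_bigr => n _.
rewrite -scalerAl -!mulrA; congr (_ *: (_ * (_ * _))).
by rewrite (commrX _ (ex : GRing.comm e x)).
Qed.

(** Already the first commutator of the chain vanishes: for [Kt j] with the parameter [qi i], for
    [KV j] with its inverse. Both forms of the Serre element are therefore used. *)
Lemma serre_Kt i j (x : A) : i != j ->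
  Kt j * x = qi i ^ (- a i j) *: (x * Kt j) -> KV j * x = qi i ^ a i j *: (x * KV j) ->
  serre D q i j x (Kt j - KV j) = 0.
Proof.
move=> ij Kx Vx; rewrite serreB serre_ychain // serre_ychainV //.
have N0 := one_sub_a_gt0 D ij.
have qn : qi i ^+ (N i j).-1 != 0 by rewrite expf_neq0 ?qi_neq0.
rewrite !ychain_eq0 ?scaler0 ?subr0 //.
  by rewrite Vx qi_cartanV // scalerA exprVn invrK mulfV ?scale1r.
by rewrite Kx qi_cartanNV // scalerA mulVf ?scale1r.
Qed.

(** For [k = i] this is [serre_commute]. Otherwise [E_k] commutes with [F_i], so the commutator
    affects only [F_j]: it is zero, or a Serre element in a difference of torus elements, which
    vanishes by [serre_Kt]. *)
Lemma serreF_comm i j k : i != j ->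
  E k * serre D q i j (Fo i) (Fo j) = serre D q i j (Fo i) (Fo j) * E k.
Proof.
move=> ij; have [-> {k}|ki] := eqVneq k i.
  rewrite serre_ychain // -scalerAr -scalerAl; congr (_ *: _).
  apply: (@serre_commute F (qi i) _ _ A (E i) (Fo i) (Kt i) (KV i));
    [exact: qi_neq0|exact: qi_not_root|exact: one_sub_a_gt0|exact: KtKV|exact: KVKt|..].
  - by rewrite KVF cartan_diag.
  - exact: EF_diag.
  - exact: EF_comm.
  - by rewrite KVF qi_cartanV.
have EFi := EF_comm ki; apply/eqP; rewrite -subr_eq0 serre_derivation //.
have [->|kj] := eqVneq k j; last first.
  by rewrite (EF_comm kj) serreB subrr.
rewrite EF_diag serreZ serre_Kt ?scaler0 //.
  by rewrite KtF (qi_cartanNC D q i).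
by rewrite KVF (qi_cartanC D q i).
Qed.

End QuantumRelations.

(** The Chevalley involution, by which results on the [F_i] transfer to the [E_i]. *)
Lemma quantum_triple_swap (I : finType) (C : cartan_datum I) (D : root_datum C)
  (F : fieldType) (q : F) (A : algType F) (E Fo : I -> A) (K : rdY D -> A) :
  quantum_triple q E Fo K -> quantum_triple q Fo E (fun y => K (- y)).
Proof.
case=> K0 KK KE KF EF; split=> [|y y'|y i|y i|i j].
- by rewrite oppr0.
- by rewrite KK opprD.
- by rewrite KF pairingN opprK.
- by rewrite KE pairingN.
rewrite opprK -opprB EF -scalerN opprB eq_sym.
by case: eqP => [->|_] //; rewrite !mul0r !scale0r.
Qed.

Lemma serreE_comm (I : finType) (C : cartan_datum I) (D : root_datum C)
  (F : fieldType) (q : F) (q0 : q != 0) (q1 : forall n, (0 < n)%N -> q ^+ n != 1)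
  (A : algType F) (E Fo : I -> A) (K : rdY D -> A) (i j k : I) :
  quantum_triple q E Fo K -> i != j ->
  Fo k * serre D q i j (E i) (E j) = serre D q i j (E i) (E j) * Fo k.
Proof. by move=> /quantum_triple_swap qt ij; apply: (serreF_comm q0 q1 qt). Qed.

(** For positive [n] the factor with [l = n - 1] is zero, so the term [H] of [lract_tau_chain]
    survives only at Serre order 1. *)
Lemma tau_coef (F : fieldType) (v : F) n : v != 0 -> 1 - v ^+ 2 != 0 ->
  (1 - v ^+ (2 * n.+1)) / (1 - v ^+ 2)
    * \prod_(0 <= l < n) (1 - (v ^- n) ^+ 2 * v ^+ (2 * l.+1)) = (n == 0)%:R.
Proof.
move=> v0 v2; case: n => [|n]; first by rewrite muln1 big_nil divff ?mulr1.
rewrite big_nat_recr //= exprVn -exprM (mulnC n.+1) mulVf ?expf_neq0 //.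
by rewrite subrr !mulr0.
Qed.

(** * Relations between the generators of the coideal subalgebra *)

Section CoidealRelations.
Variables (I : finType) (C : cartan_datum I) (D : root_datum C).
Variables (T : diagram_involution D).
Variables (F : fieldType) (q : F).
Hypotheses (q0 : q != 0) (q1 : forall n, (0 < n)%N -> q ^+ n != 1).
Hypothesis two_neq0 : (2 : F) != 0.
Variables (A : algType F) (E Fo : I -> A) (K : rdY D -> A).
Hypothesis qt : quantum_triple q E Fo K.
Hypothesis serreE : forall i j, i != j -> serre D q i j (E i) (E j) = 0.
Hypothesis serreF : forall i j, i != j -> serre D q i j (Fo i) (Fo j) = 0.
Variables (vs kp : I -> F).

Local Notation a := (cartan D).
Local Notation qi := (qi C q).
Local Notation N i j := (one_sub_a D i j).
Local Notation dq i := (qi i - (qi i)^-1).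
Local Notation h := (simple_coroot D).
Local Notation Kt i := (K (h i *+ eps C i)).
Local Notation KV i := (K (- (h i *+ eps C i))).
Local Notation Z i := (vs i *: (E (T i) * KV i)).
Local Notation W j := (E (T j) * KV j).

Definition coideal_gen i : A := Fo i + Z i + kp i *: KV i.
Local Notation b := coideal_gen.

Let v0 i : qi i != 0. Proof. exact: qi_neq0. Qed.
Let v1 i n : (0 < n)%N -> qi i ^+ n != 1. Proof. exact: qi_not_root. Qed.

Lemma ychainF i j : i != j -> ychain (qi i) (qi i ^- (N i j).-1) (Fo i) (Fo j) (N i j) = 0.
Proof.
move=> ij; have := serreF ij; rewrite serre_ychain // => /(congr1 ( *:%R ((-1) ^+ N i j))).
by rewrite scalerA -exprD addnn -mul2n exprM sqrrN expr1n expr1n scale1r scaler0.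
Qed.

Lemma ychainE i j : i != j ->
  ychain (qi i)^-1 ((qi i)^-1 ^- (N i j).-1) (Z i) (W j) (N i j) = 0.
Proof.
move=> ij; rewrite -[W j]scale1r ychain_scale mulr1.
have [c ->] : exists c : F, ychain (qi i)^-1 ((qi i)^-1 ^- (N i j).-1)
    (E (T i) * KV i) (W j) (N i j) = c *: (ychain (qi i)^-1
      ((qi i)^-1 ^- (N i j).-1) (E (T i)) (E (T j)) (N i j) * (KV i ^+ N i j * KV j)).
  apply: ychain_twist; first exact: (KVE qt).
  - exact: (KVE qt).
  - rewrite (KVE qt); congr (_ *: _).
    by rewrite !qi_exp !mulNr !cartan_eps -[C i _](tau_cdot T) tauK cdotC.
  - exact: (KKC qt).
have := serreE (tau_neq T ij); rewrite serre_ychainV ?tau_neq //.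
rewrite qi_tau one_sub_a_tau => /(congr1 ( *:%R ((-1) ^+ N i j))).
rewrite scalerA -exprD addnn -mul2n exprM sqrrN expr1n expr1n scale1r scaler0 => ->.
by rewrite mul0r !scaler0.
Qed.

Section FixedNode.
Variables (i j : I).
Hypotheses (ij : i != j) (Ti : T i = i).

Local Notation v := (qi i).
Local Notation x := (Fo i).
Local Notation z := (Z i).
Local Notation m := (KV i).
Let e := v * vs i / (v - v^-1) ^+ 2.

Let d0 : v - v^-1 != 0. Proof. exact: (sub_inv_neq0 (v0 i) (@v1 i)). Qed.

Let mx : m * x = v ^+ 2 *: (x * m).
Proof. by rewrite (KVF qt) cartan_diag. Qed.

Let mz : m * z = v ^- 2 *: (z * m).
Proof.
rewrite -scalerAr mulrA (KVE qt) Ti cartan_diag -!scalerAl !scalerA -exprnN.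
by rewrite mulrC.
Qed.

Let zx : z * x = v ^+ 2 *: (x * z) + (e * (v ^+ 2 - 1)) *: (1 - m * m).
Proof.
have EXE : E i * x = x * E i + (v - v^-1)^-1 *: (Kt i - m).
  by rewrite -(EF_diag qt) addrC subrK.
have -> : e * (v ^+ 2 - 1) = vs i * v ^+ 2 / (v - v^-1).
  by rewrite /e; field; rewrite v0 (sqr_sub1_neq0 (@v1 i)).
rewrite Ti; transitivity (vs i *: (v ^+ 2 *: (E i * x * m))).
  by rewrite -scalerAl -!mulrA mx -scalerAr.
rewrite EXE -(KtKV qt i); move: (v - v^-1)^-1 => d.
by nc_ring A; ring.
Qed.

Let xz : x * z = v^-1 ^+ 2 *: (z * x) + (e * (v^-1 ^+ 2 - 1)) *: (1 - m * m).
Proof.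
rewrite zx scalerDr !scalerA -exprMn mulVf // expr1n scale1r -addrA -scalerDl.
have -> : v^-1 ^+ 2 * (e * (v ^+ 2 - 1)) + e * (v^-1 ^+ 2 - 1) = 0.
  by move: e => e0; field; exact: v0.
by rewrite scale0r addr0.
Qed.

Let lract_Fj : lract (b i) (ttR v e (N i j)) (Fo j) = 0.
Proof.
rewrite /ttR (chain_lract _ zx mx) ?ychainF //.
  rewrite Ti -scalerAl -scalerAr -mulrA (KVF qt) qi_cartanV // -scalerAr scalerA mulrC.
  by rewrite -scalerA !mulrA (EF_comm qt).
by rewrite (KVF qt) qi_cartanV.
Qed.

Let lract_Ej : lract (b i) (ttR v e (N i j)) (W j) = 0.
Proof.
have iTj : i != T j by rewrite -[i in i != _]Ti tau_neq.
rewrite -(ttR_inv (v0 i) (@v1 i)) /ttR /coideal_gen [x + z]addrC (chain_lract _ xz) ?ychainE //.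
- by rewrite mz exprVn.
- rewrite mulrA -(EF_comm qt) 1?eq_sym // -!mulrA (KVF qt) -scalerAr scalerA.
  by rewrite (qi_cartanC D q) qi_cartanV // exprVn invrK mulfV ?scale1r ?expf_neq0.
rewrite mulrA (KVE qt) -[a i _](cartan_tau T) Ti tauK qi_cartanNV //.
by rewrite exprVn invrK -scalerAl -!mulrA (KKC qt).
Qed.

Let lract_Kj : T j = j -> (2 %| a i j)%Z -> lract (b i) (ttR v e (N i j)) (KV j) = 0.
Proof.
move=> Tj /dvdzP[r' ar].
have [r Nr] : exists r, N i j = (2 * r).+1.
  exists `|r'|%N; have := one_sub_aE D ij; have := cartan_le0 D ij; rewrite ar; lia.
(* Evenness of [a_ij] has made the order odd, as [lract_cartan] requires. The element [c] is [vs i]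
   times the quantum Casimir element of the rank one subalgebra at [i]. *)
rewrite Nr; pose c : A := vs i *: (x * E i + ((v - v^-1) ^- 2) *: (v *: Kt i + v^-1 *: m)).
have xE : E i * x = x * E i + (v - v^-1)^-1 *: (Kt i - m).
  by rewrite -(EF_diag qt) addrC subrK.
have Ktx : Kt i * x = v ^- 2 *: (x * Kt i).
  by rewrite (KtF qt) cartan_diag -exprnN.
have KtE' : Kt i * E i = v ^+ 2 *: (E i * Kt i) by rewrite (KtE qt) cartan_diag.
have mE : m * E i = v ^- 2 *: (E i * m) by rewrite (KVE qt) cartan_diag -exprnN.
have fld := (v0 i, sqr_sub1_neq0 (@v1 i)).
have cx : GRing.comm c x.
  rewrite /GRing.comm /c -!scalerAl -!scalerAr mulrDl mulrDr -mulrA xE.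
  rewrite -!scalerAl -!scalerAr mulrDl mulrDr -!scalerAl Ktx mx.
  by nc_ring A; field; rewrite ?fld.
have cE : GRing.comm c (E i).
  rewrite /GRing.comm /c -!scalerAl -!scalerAr mulrDl mulrDr (mulrA (E i)) xE.
  rewrite -!scalerAl -!scalerAr mulrDl !mulrDr mulrDl -!scalerAl mulrBl KtE' mE.
  by nc_ring A; field; rewrite ?fld.
have cm : GRing.comm c m.
  rewrite /GRing.comm /c -!scalerAl -!scalerAr mulrDl mulrDr (mulrA m) mx.
  rewrite -!scalerAl -!mulrA mE mulrDl -!scalerAl (KKC qt (h i *+ _)).
  by nc_ring A; field; rewrite ?fld.
have ccZ (w : F) (y : A) : GRing.comm c y -> GRing.comm c (w *: y).
  by rewrite /GRing.comm => cy; rewrite -scalerAr cy scalerAl.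
apply: (@lract_cartan _ _ _ _ _ _ _ _ _ _ c) => //.
- exact: v1.
- by rewrite Ti /c -(KtKV qt i) /e; nc_ring A; field; rewrite ?fld.
- by apply: commrD; [apply: commrD => //; rewrite Ti; apply/ccZ/commrM|apply/ccZ].
- by rewrite (KVF qt) (qi_cartanC D q) qi_cartanV // Nr.
- rewrite Ti -scalerAr mulrA (KVE qt) (qi_cartanNC D q) qi_cartanNV // Nr.
  by rewrite -!scalerAl !scalerA mulrC -!mulrA (KKC qt).
exact: (KKC qt).
Qed.

Lemma coideal_serre_fixed (p p' : 'Z_2) :
  (kp j != 0 -> T j = j /\ (2 %| a i j)%Z) ->
  (p' == 1) = (p == 1) (+) ~~ odd (N i j) ->
  \sum_(0 <= n < (N i j).+1) (-1) ^+ n *: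
    (idivpow v (vs i) (b i) p' n * b j * idivpow v (vs i) (b i) p (N i j - n)) = 0.
Proof.
move=> kpj pp'; apply: (scalerI (qfact_neq0 (v0 i) (@v1 i) (N i j))).
rewrite /= scaler0 (idiv_ttR (v0 i) (@v1 i)) // -/e; apply/eqP; rewrite scaler_eq0 signr_eq0 /=.
rewrite {2}/coideal_gen !lendD !lract_scale lract_Fj lract_Ej scaler0 !add0r.
have [->|/kpj[Tj aij]] := eqVneq (kp j) 0; first by rewrite scale0r.
by rewrite lract_Kj // scaler0.
Qed.

End FixedNode.

Section MovedNode.
Variables (i j : I).
Hypotheses (ij : i != j) (Ti : T i != i) (kpi : kp i = 0).

Local Notation v := (qi i).
Local Notation x := (Fo i).
Local Notation z := (Z i).

Let bE : b i = x + z + 0 *: 0.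
Proof. by rewrite /coideal_gen kpi !scale0r. Qed.

Let zx : z * x = v ^+ 2 *: (x * z).
Proof.
rewrite -scalerAl -scalerAr -mulrA (KVF qt) cartan_diag -scalerAr mulrA.
by rewrite (EF_comm qt) // !scalerA mulrC -!mulrA.
Qed.

Let zx0 : z * x = v ^+ 2 *: (x * z) + (0 * (v ^+ 2 - 1)) *: (1 - 0 * 0).
Proof. by rewrite mul0r scale0r addr0 zx. Qed.

Let xz0 : x * z = v^-1 ^+ 2 *: (z * x) + (0 * (v^-1 ^+ 2 - 1)) *: (1 - 0 * 0).
Proof.
rewrite zx scalerA -exprMn mulVf // expr1n scale1r.
by rewrite mul0r scale0r addr0.
Qed.

Let m0 (w : F) (y : A) : 0 * y = w *: (y * 0).
Proof. by rewrite mul0r mulr0 scaler0. Qed.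

Lemma coideal_serre_moved : j != T i -> (kp j != 0 -> T j = j) ->
  \sum_(0 <= n < (N i j).+1) (-1) ^+ n *:
    (divpow v (b i) n * b j * divpow v (b i) (N i j - n)) = 0.
Proof.
move=> jTi kpj; apply: (scalerI (qfact_neq0 (v0 i) (@v1 i) (N i j))).
rewrite /= scaler0 (divpow_ttR (v0 i) (@v1 i)) //; apply/eqP.
rewrite scaler_eq0 signr_eq0 /=.
have iTj : i != T j by apply: contra jTi => /eqP ->; rewrite tauK.
have LF : lract (b i) (ttR v 0 (N i j)) (Fo j) = 0.
  rewrite /ttR bE (chain_lract _ zx0) ?ychainF //.
  rewrite -scalerAl -scalerAr -mulrA (KVF qt) qi_cartanV // -scalerAr scalerA mulrC.
  by rewrite -scalerA !mulrA (EF_comm qt) // eq_sym.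
have LE : lract (b i) (ttR v 0 (N i j)) (W j) = 0.
  rewrite -(ttR_inv (v0 i) (@v1 i)) /ttR bE [x + z]addrC (chain_lract _ xz0) ?ychainE //.
  rewrite mulrA -(EF_comm qt) 1?eq_sym // -!mulrA (KVF qt) -scalerAr scalerA.
  by rewrite (qi_cartanC D q) qi_cartanV // exprVn invrK mulfV ?scale1r ?expf_neq0.
rewrite {2}/coideal_gen !lendD !lract_scale LF LE scaler0 !add0r.
have [->|/kpj Tj] := eqVneq (kp j) 0; first by rewrite scale0r.
rewrite bE scale0r addr0 lract_vchain ?scaler0 //; first exact: v1.
- exact: one_sub_a_gt0.
- by rewrite (KVF qt) (qi_cartanC D q) qi_cartanV.
rewrite -scalerAr mulrA (KVE qt) -{1}Tj -[a _ _](cartan_tau T) !tauK Tj.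
rewrite (qi_cartanNC D q) qi_cartanNV //.
by rewrite -!scalerAl !scalerA mulrC -!mulrA (KKC qt).
Qed.

(** The summand [F_j] yields the first term, and [E_i * KV j], treated with [x] and [z] exchanged
    and [v] inverted, the second. Each leaves a multiple of [H] when [a_ij = 0]; the two multiples
    cancel because then [vs i = vs j]. *)
Lemma coideal_serre_tau : j = T i -> kp j = 0 ->
  (a i j = 0 -> vs i = vs j) ->
  let n := (N i j).-1 in
  lract (b i) (ttR v 0 (N i j)) (b j) =
    (vs i * v ^ a i j / (v - v^-1) * \prod_(0 <= l < n) (1 - v ^+ (2 * l.+2)))
      *: (b i ^+ n * (Kt j * KV i))
    - (vs j / (v - v^-1) * \prod_(0 <= l < n) (1 - v^-1 ^+ (2 * l.+2)))
      *: (b i ^+ n * (Kt i * KV j)).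
Proof.
move=> jE kpj vsij n.
have NE : N i j = n.+1 by rewrite prednK // one_sub_a_gt0.
have Tj : T j = i by rewrite jE tauK.
have qij : qi j = v by rewrite jE qi_tau.
have aji : a j i = a i j by rewrite -(cartan_tau T) Tj -jE.
have fld := (v0 i, sqr_sub1_neq0 (@v1 i)).
pose H := KV j * KV i.
have v2 : 1 - v ^+ 2 != 0 by rewrite subr_eq0 eq_sym v1.
have v2V : 1 - v^-1 ^+ 2 != 0 by rewrite subr_eq0 eq_sym inv_not_root //; exact: v1.
have An : v ^ a i j = v ^- n by rewrite qi_cartanV.
have AnV : v ^ (- a i j) = v ^+ n by rewrite qi_cartanNV.
have vn0 : v ^+ n != 0 by rewrite expf_neq0.
have KVjx : KV j * x = v ^- n *: (x * KV j) by rewrite (KVF qt) aji qij An.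
have Ktjx : Kt j * x = v ^+ n *: (x * Kt j) by rewrite (KtF qt) aji qij AnV.
have KVix : KV i * x = v ^+ 2 *: (x * KV i) by rewrite (KVF qt) cartan_diag.
have Ktix : Kt i * x = v ^- 2 *: (x * Kt i) by rewrite (KtF qt) cartan_diag.
have KViE : KV i * E j = v ^+ n *: (E j * KV i) by rewrite (KVE qt) AnV.
have KtiE : Kt i * E j = v ^- n *: (E j * Kt i) by rewrite (KtE qt) An.
have KVjE : KV j * E j = v ^- 2 *: (E j * KV j) by rewrite (KVE qt) cartan_diag qij.
have KtjE : Kt j * E j = v ^+ 2 *: (E j * Kt j) by rewrite (KtE qt) cartan_diag qij.
have KVjFj : KV i * Fo j = v ^- n *: (Fo j * KV i) by rewrite (KVF qt) An.
have EFj : E j * Fo j = Fo j * E j + (v - v^-1)^-1 *: (Kt j - KV j).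
  by rewrite -qij -(EF_diag qt) addrC subrK.
have EFi : E i * x = x * E i + (v - v^-1)^-1 *: (Kt i - KV i).
  by rewrite -(EF_diag qt) addrC subrK.
have YF : ychain v (v ^- n) x (Fo j) n.+1 = 0 by rewrite -NE ychainF.
have YE : ychain v^-1 (v^-1 ^- n) z (W j) n.+1 = 0 by rewrite -NE ychainE.
have HE : H * E j = (v ^+ n / v ^+ 2) *: (E j * H).
  by rewrite /H -mulrA KViE -scalerAr (mulrA (KV j)) KVjE -scalerAl scalerA -mulrA.
have GE : Kt j * KV i * E j = (v ^+ n * v ^+ 2) *: (E j * (Kt j * KV i)).
  by rewrite -mulrA KViE -scalerAr (mulrA (Kt j)) KtjE -scalerAl scalerA -mulrA.
have G'E : Kt i * KV j * E j = (v ^- 2 / v ^+ n) *: (E j * (Kt i * KV j)).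
  by rewrite -mulrA KVjE -scalerAr (mulrA (Kt i)) KtiE -scalerAl scalerA -mulrA.
have HVi : KV i * H = H * KV i by rewrite /H !(qt_KK qt) addrC.
have GVi : KV i * (Kt j * KV i) = Kt j * KV i * KV i by rewrite !(qt_KK qt) addrC.
have G'Vi : KV i * (Kt i * KV j) = Kt i * KV j * KV i by rewrite !(qt_KK qt) addrC.
have LF : lract (b i) (ttR v 0 (N i j)) (Fo j) =
    (vs i * v ^ a i j / (v - v^-1) * \prod_(0 <= l < n) (1 - v ^+ (2 * l.+2)))
      *: (b i ^+ n * (Kt j * KV i))
    - ((n == 0)%:R * (vs i * v ^ a i j / (v - v^-1))) *: H.
  rewrite /ttR -/n bE scale0r addr0 NE.
  rewrite (@lract_tau_chain _ v _ A (v ^- n) (vs i * v ^ a i j / (v - v^-1)) x z (Fo j)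
    (Kt j * KV i) H) //; last first.
  - rewrite -jE -!scalerAr -!scalerAl (mulrA H) HE -scalerAl -(mulrA (E j) H) -HVi.
    rewrite !scalerA -!mulrA; congr (_ *: _).
    by move: (v ^+ n) vn0 => w w0; field; rewrite v0 w0.
  - rewrite /H -mulrA KVix -scalerAr (mulrA (KV j)) KVjx.
    by nc_ring A; ring.
  - rewrite -jE -!scalerAr -!scalerAl (mulrA _ (E j)) GE -scalerAl -(mulrA (E j) _ (KV i)) -GVi.
    rewrite !scalerA -!mulrA; congr (_ *: _).
    by move: (v ^+ n) vn0 => w w0; field.
  - rewrite -mulrA KVix -scalerAr (mulrA (Kt j)) Ktjx.
    by move: (v ^+ n) vn0 => w w0; nc_ring A; field.
  - rewrite -jE -!scalerAl -(mulrA (E j)) KVjFj -!scalerAr (mulrA (E j)) EFj An.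
    by rewrite /H; nc_ring A; ring.
  - exact: invr_neq0.
  - exact: v1.
  rewrite YF add0r tau_coef //; congr (_ - _).
  have [->|_] := eqVneq n 0%N; first by rewrite mulrC expr0 mul1r.
  by rewrite mul0r mulr0 !scale0r.
have LE : lract (b i) (ttR v 0 (N i j)) (W j) =
    - ((v - v^-1)^-1 * \prod_(0 <= l < n) (1 - v^-1 ^+ (2 * l.+2)))
      *: (b i ^+ n * (Kt i * KV j))
    + ((n == 0)%:R * (v - v^-1)^-1) *: H.
  rewrite -(ttR_inv (v0 i) (@v1 i)) /ttR -/n bE scale0r addr0 NE [x + z]addrC.
  rewrite (@lract_tau_chain _ v^-1 _ A (v^-1 ^- n) (- (v - v^-1)^-1) z x (W j)
    (Kt i * KV j) H) //; last first.
  - rewrite /H -[_ * x]mulrA KVix -scalerAr (mulrA (KV j)) KVjx.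
    by rewrite !exprVn invrK; move: (v ^+ n) vn0 => w w0; nc_ring A; field; rewrite v0 w0.
  - rewrite -jE -!scalerAr -!scalerAl (mulrA H) HE -scalerAl -(mulrA (E j) H) -HVi.
    rewrite !scalerA -!mulrA !exprVn invrK; congr (_ *: _).
    by move: (v ^+ n) vn0 => w w0; field; rewrite v0.
  - rewrite -[_ * x]mulrA KVjx -scalerAr (mulrA (Kt i)) Ktix.
    by rewrite !exprVn invrK; move: (v ^+ n) vn0 => w w0; nc_ring A; field; rewrite v0 w0.
  - rewrite -jE -!scalerAr -!scalerAl (mulrA _ (E j)) G'E -scalerAl -(mulrA (E j) _ (KV i)).
    rewrite -G'Vi !scalerA -!mulrA !exprVn invrK; congr (_ *: _).
    by move: (v ^+ n) vn0 => w w0; field; rewrite v0 w0.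
  - rewrite Tj -(mulrA (E i)) KVjx -scalerAr scalerA !exprVn invrK mulfV // scale1r.
    by rewrite (mulrA (E i)) EFi /H (KKC qt (- (h j *+ _))); nc_ring A; ring.
  - by rewrite zx scalerA -exprMn mulVf // expr1n scale1r.
  - by rewrite !exprVn invrK.
  - by apply: inv_not_root => //; exact: v1.
  rewrite YE add0r tau_coef ?invr_eq0 //; congr (_ *: _ + _).
    by rewrite mulNr.
  have [->|_] := eqVneq n 0%N; first by rewrite mulr1 !mul1r scaleNr opprK ?expr0 ?mul1r.
  by rewrite mul0r mulr0 !scale0r oppr0.
rewrite {2}/coideal_gen kpj scale0r addr0 lendD lract_scale LF LE scalerDr !scalerA.
rewrite addrACA [X in _ + X](_ : _ = 0); last first.
  have [n0|_] := eqVneq n 0%N; last by rewrite !mul0r mulr0 !scale0r oppr0 addr0.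
  have aij0 : a i j = 0 by rewrite cartanE // -/n n0 oppr0.
  by rewrite !mul1r vsij // aij0 expr0z mulr1 addNr.
by rewrite addr0 mulrN scaleNr (mulrA (vs j)).
Qed.

End MovedNode.

End CoidealRelations.

(** * Verma modules on the free algebra *)

Section FreeAlgebraInduction.
Variables (F : fieldType) (G : choiceType).
Local Notation V := (freealg F G).
Local Notation f := (freegen F).

Definition fword (w : seq G) : V := \prod_(g <- w) f g.

Lemma fword_nil : fword [::] = 1. Proof. exact: big_nil. Qed.
Lemma fword_cons g w : fword (g :: w) = f g * fword w.
Proof. exact: big_cons. Qed.
Lemma fword_cat w w' : fword (w ++ w') = fword w * fword w'.
Proof. exact: big_cat. Qed.

Lemma fword_malg (w : word G) : << w >> = fword w :> {malg F[word G]}.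
Proof.
elim: w => [|g w IH]; first by rewrite fword_nil.
rewrite fword_cons -IH freegen.unlock.
by rewrite [RHS](@malgM_def (word G) F) fgmulUU mulr1.
Qed.

Lemma freealg_span (P : V -> Prop) :
  P 0 -> (forall x y, P x -> P y -> P (x + y)) ->
  (forall c x, P x -> P (c *: x)) -> (forall w, P (fword w)) -> forall x, P x.
Proof.
move=> P0 PD PZ PW x; rewrite [x](@monalgE (word G) F).
suff H (r : seq (word G)) :
    P (\sum_(k <- r) << (x : {malg F[word G]})@_k *g k >>) by exact: H.
elim: r => [|w r IH]; first by rewrite big_nil.
rewrite big_cons; apply: PD => //.
have -> : << (x : {malg F[word G]})@_w *g w >> =
    (x : {malg F[word G]})@_w *: fword w :> {malg F[word G]}.
  apply/malgP => k; rewrite -fword_malg.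
  by rewrite (@mcoeffZ (word G) F) !mcoeffU mulr_natr.
exact/PZ/PW.
Qed.

Lemma freealg_ind (P : V -> Prop) :
  P 0 -> (forall x y, P x -> P y -> P (x + y)) ->
  (forall c x, P x -> P (c *: x)) -> P 1 ->
  (forall g x, P x -> P (f g * x)) -> forall x, P x.
Proof.
move=> P0 PD PZ P1 PM; apply: freealg_span => //; elim=> [|g w IH].
  by rewrite fword_nil.
by rewrite fword_cons; apply: PM.
Qed.

Lemma freealg_ind_r (P : V -> Prop) :
  P 0 -> (forall x y, P x -> P y -> P (x + y)) ->
  (forall c x, P x -> P (c *: x)) -> P 1 ->
  (forall g x, P x -> P (x * f g)) -> forall x, P x.
Proof.
move=> P0 PD PZ P1 PM; apply: freealg_span => //; elim/last_ind=> [|w g IH].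
  by rewrite fword_nil.
by rewrite -cats1 fword_cat fword_cons fword_nil mulr1; apply: PM.
Qed.

Lemma lend_eq (S T : lend V) :
  S 1 = T 1 -> (forall g x, S x = T x -> S (f g * x) = T (f g * x)) -> S = T.
Proof.
move=> ST1 STM; apply: lend_ext; apply: freealg_ind => // [|x y Sx Sy|c x Sx].
- by rewrite !lend0.
- by rewrite !lendD Sx Sy.
- by rewrite !lendZ Sx.
Qed.

Lemma freealg_eval_eq (A : algType F) (B : algType F) (phi : {lrmorphism A -> B})
    (u : G -> A) (w : G -> B) : (forall g, phi (u g) = w g) ->
  forall x, phi (freealg_eval u x) = freealg_eval w x.
Proof.
move=> uw; apply: freealg_ind => [|x y IHx IHy|c x IH||g x IH].
- by rewrite !raddf0.
- by rewrite !raddfD /= IHx IHy.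
- by rewrite !linearZ /= IH.
- by rewrite !rmorph1.
- by rewrite !rmorphM /= !freealg_evalE uw IH.
Qed.

Definition degtrunc_word n (w : word G) : V := if (size w < n)%N then fword w else 0.

Definition ftrunc n (x : V) : V := mmap (GRing.in_alg V) (degtrunc_word n) x.

Lemma ftruncP n c x y : ftrunc n (c *: x + y) = c *: ftrunc n x + ftrunc n y.
Proof.
rewrite /ftrunc.
have D u w : mmap (GRing.in_alg V) (degtrunc_word n) (u + w) =
    mmap (GRing.in_alg V) (degtrunc_word n) u + mmap (GRing.in_alg V) (degtrunc_word n) w.
  exact: (raddfD (mmap (GRing.in_alg V) (degtrunc_word n))).
rewrite D; congr (_ + _).
rewrite (mmapEw (@msuppZ_le (word G) F _ _)) mmapE scaler_sumr.
apply: eq_bigr => k _; rewrite (@mcoeffZ (word G) F) /=.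
by rewrite -!scalerAl !mul1r scalerA.
Qed.

(** Degree bounds are expressed by fixed points: [degtrunc n x = x] means that [x] involves only
    words of length less than [n]. *)
Definition degtrunc n : lend V := Lend (ftruncP n).

Lemma degtrunc_fword n w : degtrunc n (fword w) = if (size w < n)%N then fword w else 0.
Proof.
rewrite /= /ftrunc -{1}(fword_malg w).
rewrite (@mmapU (word G) F V (GRing.in_alg V) (degtrunc_word n)).
by rewrite /= scale1r mul1r.
Qed.

Lemma degtrunc0 x : degtrunc 0 x = 0.
Proof.
move: x; apply: freealg_span => [|x y Hx Hy|c x Hx|w].
- by rewrite lend0.
- by rewrite lendD Hx Hy addr0.
- by rewrite lendZ Hx scaler0.
- by rewrite degtrunc_fword.
Qed.

Lemma degtrunc1 n : degtrunc n.+1 1 = 1.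
Proof. by rewrite -fword_nil degtrunc_fword. Qed.

Lemma degtrunc_gen n g x : degtrunc n.+1 (f g * x) = f g * degtrunc n x.
Proof.
move: x; apply: freealg_span => [|x y Hx Hy|c x Hx|w].
- by rewrite mulr0 !lend0 mulr0.
- by rewrite mulrDr !lendD Hx Hy mulrDr.
- by rewrite -scalerAr !lendZ Hx scalerAr.
- by rewrite -fword_cons !degtrunc_fword /= ltnS fword_cons; case: ifP => _ //; rewrite mulr0.
Qed.

Lemma degtrunc_genr n g x : degtrunc n.+1 (x * f g) = degtrunc n x * f g.
Proof.
move: x; apply: freealg_span => [|x y Hx Hy|c x Hx|w].
- by rewrite mul0r !lend0 mul0r.
- by rewrite mulrDl !lendD Hx Hy mulrDl.
- by rewrite -scalerAl !lendZ Hx scalerAl.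
have -> : fword w * f g = fword (rcons w g).
  by rewrite -cats1 fword_cat fword_cons fword_nil mulr1.
rewrite !degtrunc_fword size_rcons ltnS; case: ifP => _; last by rewrite mul0r.
by rewrite -cats1 fword_cat fword_cons fword_nil mulr1.
Qed.

Lemma degtrunc_le m n x : (m <= n)%N -> degtrunc n (degtrunc m x) = degtrunc m x.
Proof.
move=> mn; move: x; apply: freealg_span => [|x y Hx Hy|c x Hx|w].
- by rewrite !lend0.
- rewrite (lendD (degtrunc m)) (lendD (degtrunc n)).
  exact: (congr2 +%R Hx Hy).
- by rewrite !lendZ Hx.
rewrite degtrunc_fword; case: ifP => wm; last by rewrite lend0.
by rewrite degtrunc_fword (leq_trans wm mn).
Qed.

End FreeAlgebraInduction.

Arguments degtrunc {F G} n.

(** * The action on the free algebra and its Serre ideal *)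

Section Verma.
Variables (I : finType) (C : cartan_datum I) (D : root_datum C).
Variables (F : fieldType) (q : F).
Hypotheses (q0 : q != 0) (q1 : forall n, (0 < n)%N -> q ^+ n != 1).
Variable lam : rdX D.

Local Notation V := (freealg F I).
Local Notation f := (freegen F).
Local Notation h := (simple_coroot D).
Local Notation al := (simple_root D).
Local Notation N i j := (one_sub_a D i j).
Local Notation qi := (qi C q).

Definition wt_twist (y : rdY D) : {lrmorphism V -> V} :=
  freealg_eval (fun j => q ^ (- pairing y (al j)) *: f j).

Lemma vermaK_lin y c x x' :
  q ^ pairing y lam *: wt_twist y (c *: x + x') =
  c *: (q ^ pairing y lam *: wt_twist y x) + q ^ pairing y lam *: wt_twist y x'.
Proof. by rewrite linearP scalerDr !scalerA mulrC. Qed.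

Definition vermaK y : lend V := Lend (vermaK_lin y).
Definition vermaF j : lend V := lmul (f j).
Definition vermaH i : lend V :=
  (qi i - (qi i)^-1)^-1 *: (vermaK (h i *+ eps C i) - vermaK (- (h i *+ eps C i))).

(* [E_i] is the unique solution of [E_i 1 = 0] and of the commutation rule with
   the [F_j]; it is read off the action of the free algebra on pairs (x, E_i x). *)
Definition verma_pair i j (u : V * V) : V * V :=
  (f j * u.1, f j * u.2 + (i == j)%:R *: vermaH i u.1).

Lemma verma_pairP i j c (u w : V * V) :
  verma_pair i j (c *: u + w) = c *: verma_pair i j u + verma_pair i j w.
Proof.
have Hl := lendP (vermaH i) c u.1 w.1.
rewrite /verma_pair; move: (vermaH i) Hl => H Hl; congr (_, _) => /=.
  by rewrite mulrDr scalerAr.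
rewrite Hl mulrDr -scalerAr !scalerDr !scalerA [_ * c]mulrC.
by rewrite addrACA.
Qed.

Definition verma_rep i : {lrmorphism V -> lend (V * V)%type} :=
  freealg_eval (fun j => Lend (verma_pairP i j)).

Lemma vermaE_lin i c x y :
  (verma_rep i (c *: x + y) (1, 0)).2 =
  c *: (verma_rep i x (1, 0)).2 + (verma_rep i y (1, 0)).2.
Proof. by rewrite raddfD /= linearZ. Qed.

Definition vermaE i : lend V := Lend (vermaE_lin i).

Lemma vermaE1 i : vermaE i 1 = 0.
Proof. by rewrite /= rmorph1. Qed.

Lemma verma_rep1 i x : (verma_rep i x (1, 0)).1 = x.
Proof.
move: x; apply: freealg_ind => [|x y Hx Hy|c x Hx||j x Hx].
- by rewrite raddf0.
- by rewrite raddfD /= Hx Hy.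
- by rewrite linearZ /= Hx.
- by rewrite rmorph1.
- by rewrite rmorphM /= freealg_evalE /= Hx.
Qed.

Lemma vermaEM i j x :
  vermaE i (f j * x) = f j * vermaE i x + (i == j)%:R *: vermaH i x.
Proof. by rewrite /= rmorphM /= freealg_evalE /= verma_rep1. Qed.

Lemma vermaK1 y : vermaK y 1 = q ^ pairing y lam *: 1.
Proof. by rewrite /= rmorph1. Qed.

Lemma vermaKM y j x :
  vermaK y (f j * x) = q ^ (- pairing y (al j)) *: (f j * vermaK y x).
Proof.
rewrite /= rmorphM /= freealg_evalE -scalerAl -scalerAr !scalerA.
by rewrite mulrC.
Qed.

Lemma verma_triple : quantum_triple q vermaE vermaF vermaK.
Proof.
have K0 : vermaK 0 = 1.
  apply: lend_eq => [|j x IH].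
    by rewrite vermaK1 -[0]/((0 : rdY D) *+ 0) pairing_mulrn mulr0 expr0z scale1r.
  rewrite vermaKM IH -[0]/((0 : rdY D) *+ 0) pairing_mulrn mulr0 oppr0 expr0z.
  by rewrite scale1r.
have KK y y' : vermaK y * vermaK y' = vermaK (y + y').
  apply: lend_eq => [|j x IH]; rewrite lend_mulE.
    rewrite !vermaK1 lendZ vermaK1 scalerA -expfzDr // pairingDl addrC.
    by [].
  move: IH; rewrite lend_mulE => IH.
  rewrite !vermaKM lendZ vermaKM IH scalerA -expfzDr // -opprD pairingDl addrC.
  by [].
have KF y i : vermaK y * vermaF i = q ^ (- pairing y (al i)) *: (vermaF i * vermaK y).
  by apply: lend_ext => x; rewrite lend_mulE lend_scaleE lend_mulE !lmulE vermaKM.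
have KH y i : vermaK y * vermaH i = vermaH i * vermaK y.
  by rewrite /vermaH -scalerAr -scalerAl mulrBr mulrBl !KK ![_ + y]addrC.
split=> // [y i|i j].
  apply: lend_eq => [|j x]; rewrite !lend_mulE !lend_scaleE !lend_mulE.
    by rewrite vermaE1 lend0 vermaK1 lendZ vermaE1 !scaler0.
  have KHx u : vermaK y (vermaH i u) = vermaH i (vermaK y u).
    by rewrite -lend_mulE KH lend_mulE.
  have EM := vermaEM i; move: (vermaH i) EM KHx => Hi EM KHx IH.
  rewrite EM vermaKM lendD vermaKM IH (lendZ (vermaK y)) KHx (lendZ (vermaE i) (q ^ (- pairing y (al j)))) EM.
  move: (vermaE i (vermaK y x)) (Hi (vermaK y x)) (f j) => u w fj.
  rewrite -[fj * (_ *: u)]scalerAr scalerA [LHS]addrC [RHS]scalerA [RHS]scalerDr [RHS]addrC.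
  have addl (x1 x2 x3 : V) : x2 = x3 -> x2 + x1 = x3 + x1 by move=> ->.
  rewrite [X in _ + X = _](_ : _ = (q ^ pairing y (al i) * q ^ (- pairing y (al j))) *: (fj * u)).
    apply: addl; case: eqP => [->|_]; last by rewrite (scale0r w) (scaler0 _ _).
    by rewrite !scale1r -expfzDr // subrr expr0z scale1r.
  by rewrite mulrC.
apply: lend_ext => x; rewrite lend_subE !lend_mulE lend_scaleE !lmulE.
by rewrite vermaEM addrC addKr /vermaH lend_scaleE scalerA.
Qed.

(** The operator kills the highest weight vector and commutes with every [F_k], and these generate
    the module from that vector. *)
Lemma verma_serreE i j : i != j -> serre D q i j (vermaE i) (vermaE j) = 0.
Proof.
move=> ij; apply: lend_eq => [|k x].
  rewrite /serre lend_sumE big1_seq // => n; rewrite mem_index_iota => /andP[_ /andP[_ +]].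
  rewrite ltnS leq_eqVlt lend_scaleE lend_mulE => /orP[/eqP ->|nN].
    by rewrite subnn expr0 lend_oneE lend_mulE vermaE1 lend0 scaler0.
  rewrite -(subnSK nN) [vermaE i ^+ (N i j - n.+1).+1]exprSr (lend_mulE (vermaE i ^+ (N i j - n.+1))) vermaE1.
  by rewrite !lend0 scaler0.
rewrite !lend_zeroE => IH.
have := serreE_comm q0 q1 k verma_triple ij => /(congr1 (fun g : lend V => g x)).
by rewrite !lend_mulE IH lend0 lmulE => <-.
Qed.

Definition serre_ideal : V -> Prop :=
  ideal_gen (fun y => exists i j, i != j /\ y = serre D q i j (f i) (f j)).

Lemma serre_lmul i j (x y : V) :
  serre D q i j (lmul x) (lmul y) = lmul (serre D q i j x y).
Proof.
have X n (w : V) : lmul w ^+ n = lmul (w ^+ n).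
  elim: n => [|n IH]; first by apply: lend_ext => u; rewrite !expr0 lmulE mul1r.
  by rewrite exprS IH exprS; apply: lend_ext => u /=; rewrite mulrA.
apply: lend_ext => u; rewrite /serre lend_sumE lmulE mulr_suml.
apply: eq_bigr => n _; rewrite lend_scaleE !X -scalerAl; congr (_ *: _).
by rewrite /= !mulrA.
Qed.

Lemma serre_idealZ c x : serre_ideal x -> serre_ideal (c *: x).
Proof. by move=> Hx; rewrite -[x]mul1r scalerAl; apply: ideal_genMl. Qed.

Lemma serre_ideal_K y x : serre_ideal x -> serre_ideal (vermaK y x).
Proof.
move=> Hx; apply: serre_idealZ.
elim: Hx => {x} [_ [i [j [ij ->]]]||x x' _ IHx _ IHx'|a x _ IH|x a _ IH].
- have -> : wt_twist y (serre D q i j (f i) (f j)) = serre D q i j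
      (q ^ (- pairing y (al i)) *: f i) (q ^ (- pairing y (al j)) *: f j).
    rewrite /serre raddf_sum; apply: eq_bigr => n _ /=.
    by rewrite linearZ /= !rmorphM !rmorphXn /= !freealg_evalE.
  rewrite serre_ychain // ychain_scale scalerA mulrC -scalerA -serre_ychain //.
  by apply/serre_idealZ/ideal_gen_in; exists i, j.
- by rewrite raddf0; apply: ideal_gen0.
- by rewrite raddfD; apply: ideal_genD.
- by rewrite rmorphM; apply: ideal_genMl.
- by rewrite rmorphM; apply: ideal_genMr.
Qed.

Lemma serre_ideal_H i x : serre_ideal x -> serre_ideal (vermaH i x).
Proof.
move=> Hx; apply: serre_idealZ; rewrite lend_subE -scaleN1r.
by apply: ideal_genD; [|apply: serre_idealZ]; apply: serre_ideal_K.
Qed.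

(** The rule [vermaEM] only peels generators off on the left. The claim is therefore strengthened to
    all products [a * x * b]: once [a] is used up, [E_k] moves past the Serre element by
    [serreF_comm] and acts on an arbitrary [b]. *)
Lemma serre_ideal_E k x : serre_ideal x -> serre_ideal (vermaE k x).
Proof.
suff H : serre_ideal x -> forall a b, serre_ideal (vermaE k (a * x * b)).
  by move=> /H /(_ 1 1); rewrite mul1r mulr1.
elim=> {x} [_ [i [j [ij ->]]]||x x' _ IHx _ IHx'|c x _ IH|x c _ IH] a b.
- have inS w : serre_ideal (serre D q i j (f i) (f j) * w).
    by apply/ideal_genMr/ideal_gen_in; exists i, j.
  move: a; apply: freealg_ind => [|a a' Ha Ha'|c a Ha||l a Ha].
  + by rewrite !mul0r lend0; apply: ideal_gen0.
  + by rewrite !mulrDl (lendD (vermaE k)); apply: ideal_genD; [apply: Ha|apply: Ha'].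
  + by rewrite -!scalerAl lendZ; apply: serre_idealZ.
  + rewrite mul1r -lmulE -serre_lmul.
    have := serreF_comm q0 q1 verma_triple k ij => /(congr1 (fun g : lend V => g b)).
    by rewrite !lend_mulE => ->; rewrite serre_lmul lmulE.
  rewrite -!mulrA vermaEM; apply: ideal_genD; first by apply: ideal_genMl; rewrite mulrA.
  by apply/serre_idealZ/serre_ideal_H/ideal_genMl/inS.
- by rewrite mulr0 mul0r lend0; apply: ideal_gen0.
- by rewrite mulrDr mulrDl lendD; apply: ideal_genD; [apply: IHx|apply: IHx'].
- by rewrite mulrA; apply: IH.
- by rewrite mulrA -(mulrA (a * x)); apply: IH.
Qed.

Definition verma_gen (x : Ugen D) : lend V :=
  match x with
  | UgenE i => vermaE i
  | UgenF i => vermaF i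
  | UgenK y => vermaK y
  end.

Definition verma : {lrmorphism freealg F (Ugen D) -> lend V} := freealg_eval verma_gen.

Lemma verma_serre_ideal u x : serre_ideal x -> serre_ideal (verma u x).
Proof.
move: u x; apply: freealg_ind => [|u u' Hu Hu'|c u Hu||g u Hu] x Hx.
- by rewrite rmorph0; apply: ideal_gen0.
- by rewrite rmorphD; apply: ideal_genD; [apply: Hu|apply: Hu'].
- by rewrite linearZ; apply/serre_idealZ/Hu.
- by rewrite rmorph1.
rewrite rmorphM lend_mulE /= freealg_evalE; have {}Hx := Hu _ Hx.
case: g => [i|i|y]; [exact: serre_ideal_E|exact: ideal_genMl|exact: serre_ideal_K].
Qed.

(** All relations hold as identities of operators except the Serre relations of the [F_i], which
    hold modulo the ideal; the latter is stable under the action. *)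
Lemma verma_ideal u x : ideal_gen (@Urel I C D F q) u -> serre_ideal (verma u x).
Proof.
have [K0 KK KE KF EF] := verma_triple.
have gE (g : Ugen D) : verma (freegen F g) = verma_gen g by rewrite /= freealg_evalE.
have z0 (S : lend V) y : S = 0 -> serre_ideal (S y).
  by move=> ->; apply: ideal_gen0.
have serreM i j (y y' : freealg F (Ugen D)) :
    verma (serre D q i j y y') = serre D q i j (verma y) (verma y').
  rewrite /serre raddf_sum; apply: eq_bigr => n _ /=.
  by rewrite linearZ /= !rmorphM !rmorphXn.
have Kn (y : rdY D) n : vermaK y ^+ n = vermaK (y *+ n).
  by elim: n => [|n IH]; rewrite ?expr0 ?mulr0n ?K0 // exprS IH KK -mulrS.
move=> Hu; elim: Hu x => {u} [u Hu||u u' _ IHu _ IHu'|a u _ IH|u a _ IH] x.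
- case: Hu => [|y y'|y i|y i|i j|i j ij|i j ij].
  + by apply: z0; rewrite rmorphB rmorph1 /= freealg_evalE /= K0 subrr.
  + by apply: z0; rewrite rmorphB rmorphM /= !freealg_evalE /= KK subrr.
  + by apply: z0; rewrite rmorphB /= freealg_eval_scalable !rmorphM /= !freealg_evalE /= KE subrr.
  + by apply: z0; rewrite rmorphB /= freealg_eval_scalable !rmorphM /= !freealg_evalE /= KF subrr.
  + apply: z0; rewrite !rmorphB /= freealg_eval_scalable !rmorphM rmorphB /fKt /fKtV !rmorphXn /= !freealg_evalE /=.
    by rewrite !Kn EF mulNrn subrr.
  + by apply: z0; rewrite serreM /= !freealg_evalE /= verma_serreE.
  + rewrite serreM /= !freealg_evalE /= serre_lmul.
    by apply/ideal_genMr/ideal_gen_in; exists i, j.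
- by rewrite rmorph0; apply: ideal_gen0.
- by rewrite rmorphD; apply: ideal_genD; [apply: IHu|apply: IHu'].
- by rewrite rmorphM; apply: verma_serre_ideal; apply: IH.
- by rewrite rmorphM; apply: IH.
Qed.

End Verma.

(** Artin's independence of characters modulo a subspace [N]: translating the argument by a point
    [x0] that separates [m] from [m0], and subtracting a multiple of the original sum, removes the
    term of [m0]. *)
Lemma character_indep (F : fieldType) (V : lmodType F) (N : V -> Prop)
    (X : zmodType) (M : eqType) (chi : M -> X -> F) (s : seq M) (g : M -> V) :
  (forall x y, N x -> N y -> N (x + y)) -> (forall c x, N x -> N (c *: x)) ->
  (forall m, chi m 0 = 1) ->
  (forall m x y, chi m (x + y) = chi m x * chi m y) ->
  (forall m m', m != m' -> exists x, chi m x != chi m' x) -> uniq s ->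
  (forall x, N (\sum_(m <- s) chi m x *: g m)) -> forall m, m \in s -> N (g m).
Proof.
move=> ND NZ c0 cD csep; elim: s g => // m0 s IH g /= /andP[m0s us] Ng.
have Ns m : m \in s -> N (g m).
  move=> ms; have /csep[x0 x0P] : m != m0.
    by apply: contraNneq m0s => <-.
  have := IH (fun m' => (chi m' x0 - chi m0 x0) *: g m') us.
  move=> /(_ _ m ms) H.
  have -> : g m = (chi m x0 - chi m0 x0)^-1 *: ((chi m x0 - chi m0 x0) *: g m).
    by rewrite scalerA mulVf ?scale1r // subr_eq0.
  apply/NZ/H => x.
  have -> : \sum_(m' <- s) chi m' x *: ((chi m' x0 - chi m0 x0) *: g m') =
      \sum_(m' <- m0 :: s) chi m' (x + x0) *: g m'
      + (- chi m0 x0) *: (\sum_(m' <- m0 :: s) chi m' x *: g m').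
    rewrite !big_cons scalerDr addrACA scalerA cD mulNr [chi m0 x0 * _]mulrC.
    rewrite scaleNr subrr add0r scaler_sumr -big_split; apply: eq_bigr => m' _ /=.
    by rewrite !scalerA -scalerDl cD; congr (_ *: _); ring.
  by apply: ND => //; apply: NZ.
move=> m; rewrite inE => /orP[/eqP ->|/Ns //].
have -> : g m0 = \sum_(m' <- m0 :: s) chi m' 0 *: g m' + -1 *: \sum_(m' <- s) g m'.
  rewrite big_cons c0 scale1r scaleN1r [X in _ + X - _](_ : _ = \sum_(m' <- s) g m').
    by rewrite addrK.
  by apply: eq_bigr => m' _; rewrite c0 scale1r.
have N0 : N 0 by have := NZ 0 _ (Ng 0); rewrite scale0r.
apply: (ND) => //; apply: NZ; rewrite big_seq; elim/big_rec: _ => [|m' x /Ns Hm Hx].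
  exact: N0.
exact: ND.
Qed.

(** * Leading terms of the action *)

Section VermaDegree.
Variables (I : finType) (C : cartan_datum I) (D : root_datum C).
Variables (T : diagram_involution D).
Variables (F : fieldType) (q : F).
Hypotheses (q0 : q != 0).
Variables (vs kp : I -> F).
Variable lam : rdX D.

Local Notation V := (freealg F I).
Local Notation f := (freegen F).
Local Notation vK := (vermaK q lam).
Local Notation vE := (vermaE q lam).
Local Notation vF := (vermaF F).
Local Notation h := (simple_coroot D).

Lemma degtrunc_vermaK n y x : degtrunc n (vK y x) = vK y (degtrunc n x).
Proof.
move: x n; apply: freealg_ind => [|x x' Hx Hx'|c x Hx||j x Hx] n.
- by rewrite !lend0.
- by rewrite !lendD Hx Hx'.
- by rewrite !(lendZ _ c) Hx.
- case: n => [|n]; first by rewrite !degtrunc0 lend0.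
  by rewrite vermaK1 (lendZ (degtrunc _)) !degtrunc1 vermaK1.
case: n => [|n]; first by rewrite !degtrunc0 lend0.
by rewrite vermaKM (lendZ (degtrunc _)) !degtrunc_gen Hx vermaKM.
Qed.

Lemma degtrunc_vermaH n i x : degtrunc n (vermaH q lam i x) = vermaH q lam i (degtrunc n x).
Proof.
have gZB (g k1 k2 : lend V) c : (forall y, g (k1 y) = k1 (g y)) ->
    (forall y, g (k2 y) = k2 (g y)) -> g ((c *: (k1 - k2)) x) = (c *: (k1 - k2)) (g x).
  by move=> h1 h2; rewrite !lend_scaleE lendZ !lend_subE lendB h1 h2.
exact: gZB (degtrunc_vermaK n _) (degtrunc_vermaK n _).
Qed.

Lemma degtrunc_vermaE n i x : degtrunc n (vE i x) = vE i (degtrunc n.+1 x).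
Proof.
move: x n; apply: freealg_ind => [|x x' Hx Hx'|c x Hx||j x Hx] n.
- by rewrite !lend0.
- by rewrite !lendD Hx Hx'.
- by rewrite !(lendZ _ c) Hx.
- by rewrite degtrunc1 vermaE1 lend0.
rewrite degtrunc_gen !vermaEM lendD (lendZ (degtrunc n)) degtrunc_vermaH; congr (_ + _).
case: n => [|n]; last by rewrite degtrunc_gen Hx.
by rewrite !degtrunc0 lend0 mulr0.
Qed.

Definition coideal_op : I -> lend V := coideal_gen T vE vF vK vs kp.

Definition coideal_rep : {lrmorphism V -> lend V} := freealg_eval coideal_op.

Lemma coideal_repM j x y : coideal_rep (f j * x) y = coideal_op j (coideal_rep x y).
Proof. by rewrite rmorphM /= freealg_evalE. Qed.

(* [B_j] acts as left multiplication by [F_j] up to terms of lower degree. *)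
Lemma coideal_rep_lead n g :
  let d := coideal_rep (degtrunc n.+1 g) 1 - degtrunc n.+1 g in degtrunc n d = d.
Proof.
move: g n; apply: freealg_ind => [|x x' Hx Hx'|c x Hx||j x Hx] n d.
- by rewrite /d lend0 rmorph0 subrr lend0.
- rewrite /d (lendD (degtrunc n.+1)) (rmorphD coideal_rep) lend_addE opprD addrACA lendD.
  by congr (_ + _); [apply: Hx|apply: Hx'].
- rewrite /d (lendZ (degtrunc n.+1)) (linearZ_LR coideal_rep) lend_scaleE -scalerBr.
  by rewrite (lendZ (degtrunc n)); congr (_ *: _); apply: Hx.
- by rewrite /d degtrunc1 rmorph1 subrr lend0.
rewrite /d degtrunc_gen; case: n {d} => [|n].
  by rewrite (degtrunc0 x) mulr0 rmorph0 subrr lend0.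
have He := Hx n; have Hy := degtrunc_le x (leqnn n.+1).
move: (degtrunc n.+1 x) He Hy => y He Hy; rewrite coideal_repM.
have [e eE He'] : exists2 e, coideal_rep y 1 = y + e & degtrunc n e = e.
  by exists (coideal_rep y 1 - y); [rewrite addrC subrK|exact: He].
have {}He : degtrunc n.+1 e = e by rewrite -He' degtrunc_le.
have Hye : degtrunc n.+1 (y + e) = y + e by rewrite lendD Hy He.
have [w wE] : exists w, w = y + e by exists (y + e).
rewrite -wE in eE Hye; rewrite eE.
have -> : coideal_op j w - f j * y = f j * e + vs j *: vE (T j) (vK (- (h j *+ eps C j)) w)
    + kp j *: vK (- (h j *+ eps C j)) w.
  rewrite /coideal_op /coideal_gen !lend_addE !lend_scaleE lend_mulE lmulE {1}wE mulrDr.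
  by rewrite -!addrA [f j * y + _]addrC -!addrA addNr addr0.
rewrite !lendD (lendZ _ (vs j)) (lendZ _ (kp j)) degtrunc_gen degtrunc_vermaE !degtrunc_vermaK.
have Hw2 : degtrunc n.+2 w = w by rewrite -Hye degtrunc_le.
by rewrite He' Hye Hw2.
Qed.

End VermaDegree.

(** * Relations of the coideal subalgebra *)

Section Naturality.
Variables (F : fieldType) (A B : algType F) (phi : {lrmorphism A -> B}).

Lemma lrmorph_divpow v b n : phi (divpow v b n) = divpow v (phi b) n.
Proof. by rewrite /divpow linearZ rmorphXn. Qed.

Lemma lrmorph_idivpow v s b p n : phi (idivpow v s b p n) = idivpow v s (phi b) p n.
Proof.
rewrite /idivpow linearZ rmorphM rmorphXn rmorph_prod; congr (_ *: (_ * _)).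
apply: eq_bigr => j _; rewrite (rmorphB phi) (rmorphXn phi); congr (_ - _).
exact: rmorph_alg.
Qed.

Lemma lrmorph_serre (I : finType) (C : cartan_datum I) (D : root_datum C) (q : F) i j x y :
  phi (serre D q i j x y) = serre D q i j (phi x) (phi y).
Proof.
rewrite /serre (linear_sum phi); apply: eq_bigr => n _.
by rewrite linearZ !rmorphM !rmorphXn.
Qed.

End Naturality.

(** The product starts at [1 - v ^ 4]; supplying [1 - v ^ 2] and splitting off the last factor gives
    the Pochhammer symbol and [[n + 1]]. The latter is the quotient of the factorials of the orders
    [n + 1] and [n] that occur on the two sides of the inhomogeneous relation. *)
Lemma qpoch_tau (F : fieldType) (v : F) n :
  v != 0 -> (forall n, (0 < n)%N -> v ^+ n != 1) ->
  v ^- n * \prod_(0 <= l < n) (1 - v ^+ (2 * l.+2)) =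
  qint v n.+1 * qpoch (v ^+ 2) (v ^+ 2) n.
Proof.
move=> v0 v1; have v2 : 1 - v ^+ 2 != 0 by rewrite subr_eq0 eq_sym v1.
pose P m := \prod_(0 <= l < m) (1 - v ^+ (2 * l.+1)).
have qE : qpoch (v ^+ 2) (v ^+ 2) n = P n.
  by apply: eq_bigr => l _; rewrite -exprS -exprM.
have E1 : P n.+1 = (1 - v ^+ 2) * \prod_(0 <= l < n) (1 - v ^+ (2 * l.+2)).
  by rewrite /P big_nat_recl // muln1.
have E2 : P n.+1 = P n * (1 - v ^+ (2 * n.+1)) by rewrite /P big_nat_recr.
rewrite qE; apply: (mulfI v2); rewrite mulrCA -E1 E2 qintE.
rewrite mul2n -addnn exprD exprS; have := expf_neq0 n v0; have := sqr_sub1_neq0 v1.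
by move: (P n) (v ^+ n) => g w vv w0; field; rewrite v0 w0 vv.
Qed.

Lemma scaled_qcomm (F : fieldType) (A : algType F) (k e z : A) (c d : F) :
  k * e = c *: (e * k) -> k * z = z * k -> k * (d *: (e * z)) = c *: (d *: (e * z) * k).
Proof.
by move=> ke kz; rewrite -scalerAr mulrA ke -!scalerAl -!mulrA kz !scalerA mulrC.
Qed.

(** This reduces the commutation relation for [a_ij = 0] to a Serre relation of order 1. *)
Lemma serre_idivpow1 (F : fieldType) (A : algType F) (v s : F) (t t' : 'Z_2) (x y : A) :
  qfact v 1 = 1 -> \sum_(0 <= n < 2) (-1) ^+ n *:
    (idivpow v s x t' n * y * idivpow v s x t (1 - n)) = - (x * y - y * x).
Proof.
move=> f1; have f0 : qfact v 0 = 1 by rewrite /qfact big_nil.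
rewrite big_nat_recl // big_nat1 /idivpow /= f0 f1 !big_nil invr1 !scale1r !mulr1.
by rewrite !(expr0, expr1, mul1r, mulr1, scale1r, scaleN1r) opprB.
Qed.

Lemma serre_divpow1 (F : fieldType) (A : algType F) (v : F) (x y : A) :
  qfact v 1 = 1 -> \sum_(0 <= n < 2) (-1) ^+ n *:
    (divpow v x n * y * divpow v x (1 - n)) = - (x * y - y * x).
Proof.
move=> f1; have f0 : qfact v 0 = 1 by rewrite /qfact big_nil.
rewrite big_nat_recl // big_nat1 /divpow subn0 subnn f0 f1 invr1 !scale1r.
by rewrite !(expr0, expr1, mul1r, mulr1, scale1r, scaleN1r) opprB.
Qed.

(** * Verification of the relations in the quantum group *)

Section CoidealInU.
Variables (I : finType) (C : cartan_datum I) (D : root_datum C).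
Variables (T : diagram_involution D).
Variables (F : fieldType) (q : F).
Hypotheses (q0 : q != 0) (q1 : forall n, (0 < n)%N -> q ^+ n != 1).
Hypothesis two_neq0 : (2 : F) != 0.
Variables (vs kp : I -> F).
Hypothesis vs_tau : forall i, cartan D i (T i) = 0 -> vs i = vs (T i).
Hypothesis kp_cond : forall i,
  ~ (T i = i /\ forall k, T k = k -> (2 %| cartan D k i)%Z) -> kp i = 0.

Local Notation a := (cartan D).
Local Notation qi := (qi C q).
Local Notation N i j := (one_sub_a D i j).
Local Notation h := (simple_coroot D).
Local Notation pi := (quot_pi (Urel_proper (D := D) (q := q))).

Lemma pi_rel x : Urel q x -> pi x = 0.
Proof.
by move=> xR; rewrite -(rmorph0 pi); apply/quot_piP; rewrite subr0; apply: ideal_gen_in.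
Qed.

Lemma pi_eq x y : Urel q (x - y) -> pi x = pi y.
Proof. by move=> xR; apply/quot_piP; apply: ideal_gen_in. Qed.

Lemma uK0 : uK q (0 : rdY D) = 1.
Proof. by rewrite -(rmorph1 pi); apply: pi_eq; apply: Urel_K0. Qed.

Lemma uKD (y y' : rdY D) : uK q y * uK q y' = uK q (y + y').
Proof. by rewrite /uK -(rmorphM pi); apply: pi_eq; apply: Urel_KK. Qed.

Lemma uK_expn (y : rdY D) n : uK q y ^+ n = uK q (y *+ n).
Proof.
by elim: n => [|n IH]; rewrite ?expr0 ?mulr0n ?uK0 // exprS IH uKD -mulrS.
Qed.

Lemma U_triple : quantum_triple q (uE D q) (uF D q) (uK (D := D) q).
Proof.
split=> [|y y'|y i|y i|i j]; [exact: uK0|exact: uKD|..].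
- rewrite /uK /uE -!(rmorphM pi) -(linearZ_LR pi); apply: pi_eq; exact: Urel_KE.
- rewrite /uK /uF -!(rmorphM pi) -(linearZ_LR pi); apply: pi_eq; exact: Urel_KF.
rewrite -mulNrn -!uK_expn /uK /uE /uF -!(rmorphXn pi) -!(rmorphM pi) -!(rmorphB pi).
rewrite -(linearZ_LR pi); apply: pi_eq; exact: Urel_EF.
Qed.

Lemma U_serreE i j : i != j -> serre D q i j (uE D q i) (uE D q j) = 0.
Proof. by move=> ij; rewrite -(lrmorph_serre pi); apply: pi_rel; apply: Urel_SE. Qed.

Lemma U_serreF i j : i != j -> serre D q i j (uF D q i) (uF D q j) = 0.
Proof. by move=> ij; rewrite -(lrmorph_serre pi); apply: pi_rel; apply: Urel_SF. Qed.

Local Notation b := (uB q T vs kp).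

Lemma uBE i : b i = coideal_gen T (uE D q) (uF D q) (uK (D := D) q) vs kp i.
Proof. by rewrite /uB /uKtV uK_expn mulNrn. Qed.

Lemma kp_fixed i : kp i != 0 -> T i = i /\ forall k, T k = k -> (2 %| a k i)%Z.
Proof. by move=> kpi; apply: contrapT => /kp_cond /eqP; apply/negP. Qed.

Lemma kp_moved i : T i != i -> kp i = 0.
Proof. by move=> Ti; apply: kp_cond => -[/eqP TiE _]; rewrite TiE in Ti. Qed.

Lemma uB_fixed i j (p p' : 'Z_2) : i != j -> T i = i ->
  (p' == 1) = (p == 1) (+) ~~ odd (N i j) ->
  \sum_(0 <= n < (N i j).+1) (-1) ^+ n *:
    (idivpow (qi i) (vs i) (b i) p' n * b j * idivpow (qi i) (vs i) (b i) p (N i j - n)) = 0.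
Proof.
move=> ij Ti pp'.
have := coideal_serre_fixed q0 q1 two_neq0 U_triple U_serreE U_serreF vs ij Ti _ pp'.
by rewrite !uBE; apply => /kp_fixed[Tj Hk]; split=> //; apply: Hk.
Qed.

Lemma uB_moved i j : i != j -> T i != i -> j != T i ->
  \sum_(0 <= n < (N i j).+1) (-1) ^+ n *:
    (divpow (qi i) (b i) n * b j * divpow (qi i) (b i) (N i j - n)) = 0.
Proof.
move=> ij Ti jTi; rewrite !uBE.
apply: (coideal_serre_moved q0 q1 U_triple U_serreE U_serreF vs ij Ti (kp_moved Ti) jTi).
by move=> /kp_fixed[].
Qed.

Lemma uB_tau i : T i != i ->
  \sum_(0 <= n < (N i (T i)).+1) (-1) ^ (n%:Z + a i (T i)) *:
      (divpow (qi i) (b i) n * b (T i) * divpow (qi i) (b i) (N i (T i) - n)) =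
  let m := `|a i (T i)|%N in
  (qi i - (qi i)^-1)^-1 *:
    ((qi i ^ a i (T i) * qpoch (qi i ^- 2) (qi i ^- 2) m * vs (T i)) *:
       (divpow (qi i) (b i) m * uK q (Yi_coroot T i))
     - (qpoch (qi i ^+ 2) (qi i ^+ 2) m * vs i) *:
       (divpow (qi i) (b i) m * uK q (- Yi_coroot T i))).
Proof.
move=> Ti; set j := T i; have ij : i != j by rewrite eq_sym.
set n := `|a i j|%N.
have v0 : qi i != 0 by apply: qi_neq0.
have v1 m : (0 < m)%N -> qi i ^+ m != 1 by apply: qi_not_root.
have nE : n = (N i j).-1 by rewrite /n cartanE // abszN.
have NE : N i j = n.+1 by rewrite nE prednK // one_sub_a_gt0.
have kpj : kp j = 0 by apply: kp_moved; rewrite /j tauK eq_sym.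
have := coideal_serre_tau q0 q1 U_triple U_serreE U_serreF ij Ti (kp_moved Ti)
  (erefl j) kpj (@vs_tau i).
rewrite -!uBE -nE => Hl.
have G1 : uK q (h j *+ eps C j) * uK q (- (h i *+ eps C i)) = uK q (- Yi_coroot T i : rdY D).
  by rewrite (qt_KK U_triple) /= mulrnBl opprB /j eps_tau.
have G2 : uK q (h i *+ eps C i) * uK q (- (h j *+ eps C j)) = uK q (Yi_coroot T i : rdY D).
  by rewrite (qt_KK U_triple) /= mulrnBl /j eps_tau.
have := divpow_ttR v0 v1 (N i j) (b i) (b j); rewrite Hl G1 G2 NE qfactS => HS.
have fn : qfact (qi i) n != 0 by exact: qfact_neq0.
have qn : qint (qi i) n.+1 != 0 by exact: qint_neq0.
have aE : a i j = - n%:Z by rewrite nE cartanE.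
have sgn k : (-1) ^ (k%:Z + a i j) = (-1) ^+ n * (-1) ^+ k :> F.
  rewrite aE expfzDr ?oppr_eq0 ?oner_eq0 // mulrC -exprnP -exprnN.
  by rewrite -exprVn invrN invr1.
under eq_bigr do rewrite sgn -scalerA.
rewrite -scaler_sumr /=; apply: (scalerI (mulf_neq0 qn fn)).
rewrite [LHS]scalerA mulrC -[LHS]scalerA HS /divpow -!scalerAl !scalerA.
have := qpoch_tau n v0 v1; have := qpoch_tau n (invr_neq0 v0) (inv_not_root v1).
rewrite qint_inv !exprVn invrK aE -exprnN => gV g.
move: (b i ^+ n * _) (b i ^+ n * _) (qpoch _ _ _) (qpoch _ _ _) (\prod_(0 <= l < n) _)
  (\prod_(0 <= l < n) _) gV g => u u' p1 p2 g2 g1 gV g.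

have vn0 : qi i ^+ n != 0 by rewrite expf_neq0.
have {}g : g2 = qi i ^+ n * (qint (qi i) n.+1 * p1) by rewrite -g mulrA mulfV ?mul1r.
have {}gV : g1 = (qi i ^+ n)^-1 * (qint (qi i) n.+1 * p2) by rewrite -gV mulrA mulVf ?mul1r.
rewrite exprS mulN1r mulrN -expr2 -exprM mulnC exprM sqrrN expr1n expr1n g gV.
move: (qi i ^+ n) vn0 (qfact _ _) fn (qint _ _) qn (_ - _)^-1 => w w0 fa fa0 c c0 d.
by nc_ring (U D q : algType F); field; rewrite fa0 w0.
Qed.

Local Notation ev := (freealg_eval (Uigen_val q T vs kp)).

Lemma one_sub_a0 i j : a i j = 0 -> N i j = 1%N.
Proof. by rewrite /one_sub_a => ->. Qed.

(** Since [a_ij = 1 - N], the parity prescribed on the left is exactly the one for which [isq_ttR]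
    applies. *)
Lemma parity_one_sub_a i j (p : 'Z_2) : i != j ->
  ((a i j)%:~R + p == 1) = (p == 1) (+) ~~ odd (N i j).
Proof.
move=> ij; have -> : a i j = 1 - (N i j)%:Z by rewrite -(one_sub_aE D ij) opprB addrC subrK.
have Z2 (n : nat) : n%:R = (odd n)%:R :> 'Z_2.
  by rewrite -[in LHS](odd_double_half n) natrD -mul2n natrM char_Zp // mul0r addr0.
rewrite intrD intrN /= -[(N i j)%:~R]/((N i j)%:R) Z2.
by case: (odd (N i j)); case: p => [[|[|]]].
Qed.

Lemma pairing_Yi (mu : Yi T) i :
  pairing (mu : rdY D) (simple_root D (T i)) = - pairing (mu : rdY D) (simple_root D i).
Proof.
rewrite -(tau_pairing T) tauX_root tauK -pairingN; congr pairing.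
exact/eqP/(Yi_valP mu).
Qed.

Lemma uK_uB (mu : Yi T) i : uK q mu * b i =
  q ^ (- pairing (mu : rdY D) (simple_root D i)) *: (b i * uK q mu).
Proof.
rewrite uBE /coideal_gen !mulrDr !mulrDl !scalerDr; congr (_ + _ + _).
- by rewrite (qt_KF U_triple).
- by apply: scaled_qcomm; [rewrite (qt_KE U_triple) pairing_Yi|apply: (KKC U_triple)].
(* If [kp i] is nonzero then [i] is fixed, and the pairing of [mu] with the simple root equals its
   own opposite; so it is zero and the torus summand needs no scalar. *)
have [->|/kp_fixed[Ti _]] := eqVneq (kp i) 0; first by rewrite !scale0r mul0r mulr0 scaler0.
have := pairing_Yi mu i; rewrite Ti => /eqP; rewrite -addr_eq0 -mulr2n mulrn_eq0 /=.
by move=> /eqP ->; rewrite oppr0 expr0z scale1r -scalerAr -scalerAl (KKC U_triple).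
Qed.

Lemma Uirel_eval p x : Uirel q T vs p x -> ev x = 0.
Proof.
have evD v y k : ev (divpow v y k) = divpow v (ev y) k := lrmorph_divpow _ v y k.
have evI v s y t k : ev (idivpow v s y t k) = idivpow v s (ev y) t k :=
  lrmorph_idivpow _ v s y t k.
have evM y z : ev (y * z) = ev y * ev z by rewrite rmorphM.
have evZ c y : ev (c *: y) = c *: ev y by rewrite freealg_eval_scalable.
have evS m (G : nat -> _) : ev (\sum_(0 <= n < m) G n) = \sum_(0 <= n < m) ev (G n).
  by rewrite raddf_sum.
have evB y z : ev (y - z) = ev y - ev z by rewrite rmorphB.
have eB i : ev (freegen F (UigenB T i)) = b i by exact: freealg_evalE.
have eD v i k : ev (divpow v (freegen F (UigenB T i)) k) = divpow v (b i) k.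
  by rewrite evD eB.
have eI v s i t k : ev (idivpow v s (freegen F (UigenB T i)) t k) = idivpow v s (b i) t k.
  by rewrite evI eB.
have eDK v i k mu : ev (divpow v (freegen F (UigenB T i)) k * freegen F (UigenK mu)) =
    divpow v (b i) k * uK q mu.
  by rewrite evM eD freealg_evalE.
have eZM c y1 y2 y3 u1 u2 u3 : ev y1 = u1 -> ev y2 = u2 -> ev y3 = u3 ->
    ev (c *: (y1 * y2 * y3)) = c *: (u1 * u2 * u3).
  by move=> <- <- <-; rewrite evZ !evM.
have eZB c d1 d2 y1 y2 u1 u2 : ev y1 = u1 -> ev y2 = u2 ->
    ev (c *: (d1 *: y1 - d2 *: y2)) = c *: (d1 *: u1 - d2 *: u2).
  by move=> <- <-; rewrite evZ evB !evZ.
case=> {x} [mu|mu mu'|mu i|i j ij aij Tij|i j ij jTi Ti|i Ti|i j ij Ti].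
- by rewrite rmorphB rmorphM rmorph1 /= !freealg_evalE /= uKD subrr uK0 subrr.
- by rewrite rmorphB rmorphM /= !freealg_evalE /= uKD subrr.
- rewrite evB evZ !evM !freealg_evalE /=; apply/eqP; rewrite subr_eq0; apply/eqP.
  exact: uK_uB.
- rewrite evB !evM !freealg_evalE /=.
  have N1 := one_sub_a0 aij.
  have f1 : qfact (qi i) 1 = 1.
    rewrite qfactS /qfact big_nil mulr1 qintE expr1 divff // sub_inv_neq0 //.
      exact: qi_neq0.
    exact: qi_not_root.
  apply: oppr_inj; rewrite oppr0; have [Ti|Ti] := eqVneq (T i) i.
    (* Idivided powers of order at most 1 do not depend on the parity, so any value serves here. *)
    have := uB_fixed ij Ti (parity_one_sub_a 0 ij); rewrite N1.
    by move=> H; apply: etrans H; apply/esym/serre_idivpow1.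
  have jTi : j != T i by rewrite eq_sym.
  have := uB_moved ij Ti jTi; rewrite N1.
  by move=> H; apply: etrans H; apply/esym/serre_divpow1.
- rewrite /serre_div evS -[RHS](uB_moved ij Ti jTi); apply: eq_bigr => n _.
  exact: eZM (eD _ _ _) (eB j) (eD _ _ _).
- rewrite evB; apply/eqP; rewrite subr_eq0; apply/eqP.
  apply: etrans (etrans (uB_tau Ti) _).
    rewrite /serre_tau_lhs evS; apply: eq_bigr => n _.
    exact: eZM (eD _ _ _) (eB _) (eD _ _ _).
  exact/esym/(eZB _ _ _ _ _ _ _ (eDK _ _ _ _) (eDK _ _ _ _)).
rewrite /serre_idiv evS -[RHS](uB_fixed ij Ti (parity_one_sub_a (p i) ij)).
apply: eq_bigr => n _; exact: eZM (eI _ _ _ _ _) (eB j) (eI _ _ _ _ _).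
Qed.

End CoidealInU.

(** * Completeness of the relations *)

Section WordDegree.
Variables (F : fieldType) (G : choiceType).
Local Notation V := (freealg F G).
Local Notation f := (freegen F).
Implicit Types x y : V.

(** The bounds are strict: the degrees are at most [m - 1] and [n], so their sum is less than
    [m + n]. *)
Lemma degtruncM m n x y : degtrunc m x = x -> degtrunc n.+1 y = y ->
  degtrunc (m + n) (x * y) = x * y.
Proof.
move=> <- <-; move: x y; apply: freealg_span => [|x x' Hx Hx'|c x Hx|w] y.
- by rewrite lend0 mul0r lend0.
- rewrite (lendD (degtrunc m)) (mulrDl (degtrunc m x)) (lendD (degtrunc (m + n))).
  by congr (_ + _); [exact: Hx|exact: Hx'].
- by rewrite (lendZ (degtrunc m)) -scalerAl (lendZ (degtrunc (m + n))); congr (_ *: _); exact: Hx.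
move: y; apply: freealg_span => [|y y' Hy Hy'|c y Hy|w'].
- by rewrite lend0 mulr0 lend0.
- rewrite (lendD (degtrunc n.+1)) (mulrDr _ (degtrunc n.+1 y)) (lendD (degtrunc (m + n))).
  by congr (_ + _); [exact: Hy|exact: Hy'].
- by rewrite (lendZ (degtrunc n.+1)) -scalerAr (lendZ (degtrunc (m + n))); congr (_ *: _); exact: Hy.
rewrite !degtrunc_fword; case: ifP => wm; last by rewrite mul0r lend0.
case: ifP => wn; last by rewrite mulr0 lend0.
by rewrite -fword_cat degtrunc_fword size_cat; case: ifP => //; lia.
Qed.

Lemma degtrunc_exp g n : degtrunc n.+1 (f g ^+ n) = f g ^+ n :> V.
Proof.
elim: n => [|n IH]; first by rewrite expr0 degtrunc1.
by rewrite exprS degtrunc_gen IH.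
Qed.

Lemma degtrunc_up m n x : (m <= n)%N -> degtrunc m x = x -> degtrunc n x = x.
Proof. by move=> mn <-; rewrite degtrunc_le. Qed.

Lemma degtrunc_prod_sqr g (c : nat -> F) k :
  let d : V := \prod_(1 <= j < k.+1) (f g ^+ 2 - (c j)%:A) - f g ^+ (2 * k) in
  degtrunc (2 * k) d = d.
Proof.
pose P m : V := \prod_(1 <= j < m.+1) (f g ^+ 2 - (c j)%:A).
have PS m : P m.+1 = P m * (f g ^+ 2 - (c m.+1)%:A) by rewrite /P big_nat_recr.
move=> d; rewrite {}/d -/(P k).
elim: k => [|k IH]; first by rewrite /P big_nil expr0 subrr lend0.
rewrite PS mulnS addnC exprD.
have -> : P k * (f g ^+ 2 - (c k.+1)%:A) - f g ^+ (2 * k) * f g ^+ 2 =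
    (P k - f g ^+ (2 * k)) * f g ^+ 2 - c k.+1 *: P k.
  by rewrite mulrBr mulrBl -scalerAr mulr1 addrAC.
have H2 : degtrunc (2 * k + 2) (P k) = P k.
  have -> : P k = (P k - f g ^+ (2 * k)) + f g ^+ (2 * k) by rewrite subrK.
  rewrite lendD; congr (_ + _); first exact: degtrunc_up (leq_addr _ _) IH.
  by apply: degtrunc_up (degtrunc_exp _ _); rewrite addn2 ltnW.
rewrite lendB (lendZ _ (c k.+1)) H2; congr (_ - _).
exact: degtruncM IH (degtrunc_exp _ _).
Qed.

Lemma degtrunc_idivpow v s p n g : qfact v n != 0 ->
  let d : V := qfact v n *: idivpow v s (f g) p n - f g ^+ n in degtrunc n d = d.
Proof.
move=> fn d; rewrite /d /idivpow scalerA mulfV // scale1r.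
set P : V := \prod_(1 <= j < _) _.
have HP : degtrunc (2 * n./2) (P - f g ^+ (2 * n./2)) = P - f g ^+ (2 * n./2).
  exact: degtrunc_prod_sqr.
have nE : n = (odd n + 2 * n./2)%N by rewrite mul2n odd_double_half.
have -> : f g ^+ odd n * P - f g ^+ n = f g ^+ odd n * (P - f g ^+ (2 * n./2)).
  by rewrite mulrBr -exprD -nE.
rewrite {1}nE; case: (odd n); last by rewrite expr0 mul1r.
by rewrite expr1 add1n degtrunc_gen HP.
Qed.

Lemma degtrunc_expM g n m y : degtrunc m y = y ->
  degtrunc (n + m) (f g ^+ n * y) = f g ^+ n * y.
Proof.
move=> Hy; elim: n => [|n IH]; first by rewrite expr0 mul1r.
by rewrite exprS -mulrA addSn degtrunc_gen IH.
Qed.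

Lemma degtrunc_sum m (J : Type) (r : seq J) (P : pred J) (E : J -> V) :
  (forall j, P j -> degtrunc m (E j) = E j) ->
  degtrunc m (\sum_(j <- r | P j) E j) = \sum_(j <- r | P j) E j.
Proof.
move=> HE; elim/big_rec: _ => [|j x Pj IH]; first exact: lend0.
by rewrite lendD IH HE.
Qed.

Lemma fword_nseq n g : fword F (nseq n g) = f g ^+ n :> V.
Proof. by elim: n => [|n IH]; rewrite ?fword_nil ?expr0 //= fword_cons IH exprS. Qed.

End WordDegree.

Section SerreDegree.
Variables (I : finType) (C : cartan_datum I) (D : root_datum C).
Variables (F : fieldType) (q : F).
Hypotheses (q0 : q != 0) (q1 : forall n, (0 < n)%N -> q ^+ n != 1).
Variables (i j : I).
Hypothesis ij : i != j.
Local Notation V := (freealg F I).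
Local Notation f := (freegen F).
Local Notation N := (one_sub_a D i j).
Local Notation v := (qi C q i).
Local Notation S := (serre D q i j (f i) (f j)).

(** Serre elements are homogeneous of degree [N + 1], so truncation keeps or kills such a product as
    a whole. *)
Lemma degtrunc_serre_word m (w w' : seq I) :
  degtrunc m (fword F w * S * fword F w') =
  if (size w + N.+1 + size w' < m)%N then fword F w * S * fword F w' else 0.
Proof.
have E : fword F w * S * fword F w' = \sum_(0 <= n < N.+1)
    ((-1) ^+ n * qbinom v (1 - cartan D i j) n) *:
      fword F (w ++ (nseq n i ++ j :: nseq (N - n) i) ++ w').
  rewrite /serre mulr_sumr mulr_suml; apply: eq_bigr => n _.
  rewrite -scalerAr -scalerAl; congr (_ *: _).
  by rewrite !fword_cat fword_cons !fword_nseq !mulrA.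
rewrite E lend_sum big_seq [X in if _ then X else _]big_seq.
have sz n : (n < N.+1)%N ->
    size (w ++ (nseq n i ++ j :: nseq (N - n) i) ++ w') = (size w + N.+1 + size w')%N.
  by move=> nN; rewrite !size_cat /= !size_nseq; lia.
case: ifP => wm.
  apply: eq_bigr => n; rewrite mem_index_iota => /andP[_ nN].
  by rewrite lendZ degtrunc_fword sz // wm.
rewrite big1 // => n; rewrite mem_index_iota => /andP[_ nN].
by rewrite lendZ degtrunc_fword sz // wm scaler0.
Qed.

(** Up to its factorial, an idivided power is the ordinary power plus terms of lower degree;
    exchanging one factor at a time lowers the degree of each summand. The idivided relation can
    thus replace the Serre element modulo shorter words. *)
Lemma degtrunc_serre_idiv (s : F) (p p' : 'Z_2) :
  let d : V := S - qfact v N *: (\sum_(0 <= n < N.+1) (-1) ^+ n *: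
    (idivpow v s (f i) p' n * f j * idivpow v s (f i) p (N - n))) in
  degtrunc N.+1 d = d.
Proof.
have v0 : v != 0 by exact: qi_neq0.
have v1 n : (0 < n)%N -> v ^+ n != 1 by exact: qi_not_root.
have fn n : qfact v n != 0 by exact: qfact_neq0.
move=> d; have -> : d = \sum_(0 <= n < N.+1) ((-1) ^+ n * qbinom v N n) *:
   (f i ^+ n * f j * f i ^+ (N - n) - (qfact v n *: idivpow v s (f i) p' n) * f j
     * (qfact v (N - n) *: idivpow v s (f i) p (N - n))).
  rewrite /d /serre (one_sub_aE D ij) scaler_sumr -sumrB; apply: eq_big_nat => n /andP[_ nN].
  rewrite scalerBr; congr (_ - _); rewrite -!scalerAl -!scalerAr !scalerA.
  congr (_ *: _); rewrite qbinomE //; move: (fn n) (fn (N - n)%N) => f1 f2.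
  by field; rewrite f1 f2.
rewrite big_seq; apply: degtrunc_sum => n; rewrite mem_index_iota => /andP[_ nN].
rewrite lendZ; congr (_ *: _).
set A := qfact v n *: _; set A' := qfact v (N - n) *: _.
have HA : degtrunc n (A - f i ^+ n) = A - f i ^+ n by apply: degtrunc_idivpow.
have HA' : degtrunc (N - n) (A' - f i ^+ (N - n)) = A' - f i ^+ (N - n).
  by apply: degtrunc_idivpow.
have HA2 : degtrunc (N - n).+1 A' = A'.
  have -> : A' = (A' - f i ^+ (N - n)) + f i ^+ (N - n) by rewrite subrK.
  by rewrite lendD degtrunc_exp (degtrunc_up _ HA').
have NE : N.+1 = (n + (N - n).+1)%N by lia.
have -> : f i ^+ n * f j * f i ^+ (N - n) - A * f j * A' =
    - ((A - f i ^+ n) * (f j * A')) - f i ^+ n * (f j * (A' - f i ^+ (N - n))).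
  by nc_ring (freealg F I : algType F); ring.
have E1 : degtrunc N.+1 ((A - f i ^+ n) * (f j * A')) = (A - f i ^+ n) * (f j * A').
  by rewrite NE; apply: degtruncM HA _; rewrite degtrunc_gen HA2.
have E2 : degtrunc N.+1 (f i ^+ n * (f j * (A' - f i ^+ (N - n)))) =
    f i ^+ n * (f j * (A' - f i ^+ (N - n))).
  by rewrite NE; apply: degtrunc_expM; rewrite degtrunc_gen HA'.
have fixB (g : lend V) x y : g x = x -> g y = y -> g (- x - y) = - x - y.
  by rewrite lendB lendN => -> ->.
exact: fixB E1 E2.
Qed.

End SerreDegree.

(** * Filtration by word length modulo the relations *)

Section Filtration.
Variables (I : finType) (C : cartan_datum I) (D : root_datum C).
Variables (T : diagram_involution D).
Variables (F : fieldType) (q : F).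
Hypotheses (q0 : q != 0) (q1 : forall n, (0 < n)%N -> q ^+ n != 1).
Variables (vs : I -> F) (p : I -> 'Z_2).

Local Notation V := (freealg F I).
Local Notation f := (freegen F).
Local Notation W := (freealg F (Uigen T)).
Local Notation B i := (freegen F (UigenB T i)).
Local Notation K mu := (freegen F (UigenK mu)).
Local Notation J := (@ideal_gen F W (Uirel q T vs p)).
Local Notation N i j := (one_sub_a D i j).

Definition iota_B : {lrmorphism V -> W} := freealg_eval (fun i => B i).

Lemma iota_gen i : iota_B (f i) = B i.
Proof. by rewrite /= freealg_evalE. Qed.

Lemma iota_BZ c x : iota_B (c *: x) = c *: iota_B x.
Proof. exact: freealg_eval_scalable. Qed.

Lemma iota_BM x y : iota_B (x * y) = iota_B x * iota_B y.
Proof. exact: rmorphM. Qed.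

Lemma ideal_genZ c (x : W) : J x -> J (c *: x).
Proof. by move=> Hx; rewrite -[x]mul1r scalerAl; apply: ideal_genMl. Qed.

Lemma ideal_genB (x y : W) : J x -> J y -> J (x - y).
Proof. by move=> Hx Hy; rewrite -scaleN1r; apply: ideal_genD => //; apply: ideal_genZ. Qed.

Lemma ideal_gen_sum (L : eqType) (r : seq L) (E : L -> W) :
  (forall t, t \in r -> J (E t)) -> J (\sum_(t <- r) E t).
Proof.
move=> HE; rewrite big_seq; elim/big_rec: _ => [|t x tr IH]; first exact: ideal_gen0.
by apply: ideal_genD => //; apply: HE.
Qed.

Definition nform (s : seq (V * Yi T)) n : W :=
  \sum_(t <- s) iota_B (degtrunc n t.1) * K t.2.

(* [Fil n x]: modulo the relations, [x] is a combination of monomials in the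
   [B_i] of length less than [n], multiplied on the right by elements [K_mu]. *)
Definition Fil n (x : W) : Prop := exists s, J (x - nform s n).

Lemma Fil_ideal n (x y : W) : J (x - y) -> Fil n y -> Fil n x.
Proof.
move=> Hxy [s Hs]; exists s; have -> : x - nform s n = (x - y) + (y - nform s n).
  by rewrite addrA subrK.
exact: ideal_genD.
Qed.

Lemma Fil_in n (x : W) : J x -> Fil n x.
Proof. by move=> Hx; exists [::]; rewrite /nform big_nil subr0. Qed.

Lemma FilD n x y : Fil n x -> Fil n y -> Fil n (x + y).
Proof.
move=> [s Hs] [t Ht]; exists (s ++ t); rewrite /nform big_cat opprD addrACA.
exact: ideal_genD.
Qed.

Lemma FilZ n c x : Fil n x -> Fil n (c *: x).
Proof.
move=> [s Hs]; exists [seq (c *: t.1, t.2) | t <- s].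
have -> : nform [seq (c *: t.1, t.2) | t <- s] n = c *: nform s n.
  rewrite /nform big_map scaler_sumr; apply: eq_bigr => t _.
  by rewrite [_.1]/= [_.2]/= lendZ iota_BZ scalerAl.
by rewrite -scalerBr; apply: ideal_genZ.
Qed.

Lemma Fil_sum n (L : Type) (r : seq L) (P : pred L) (E : L -> W) :
  (forall t, P t -> Fil n (E t)) -> Fil n (\sum_(t <- r | P t) E t).
Proof.
move=> HE; elim/big_rec: _ => [|t x tr IH]; first exact/Fil_in/ideal_gen0.
by apply: FilD => //; apply: HE.
Qed.

Lemma Fil_le m n x : (m <= n)%N -> Fil m x -> Fil n x.
Proof.
move=> mn [s Hs]; exists [seq (degtrunc m t.1, t.2) | t <- s].
have -> : nform [seq (degtrunc m t.1, t.2) | t <- s] n = nform s m.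
  by rewrite /nform big_map; apply: eq_bigr => t _; rewrite [_.1]/= degtrunc_le.
exact: Hs.
Qed.

(** The presentation does not list [K_0 = 1]; it results from comparing the two torus relations at
    weight zero. *)
Lemma rel_K0 : J (K 0 - 1).
Proof.
have h1 : J (K 0 * K (- 0) - 1) by apply: ideal_gen_in; apply: Uirel_KV.
have h2 : J (K 0 * K (- 0) - K (0 + - 0)) by apply: ideal_gen_in; apply: Uirel_KK.
rewrite subrr in h2; have := ideal_genB h1 h2.
by rewrite opprB addrC addrA subrK.
Qed.

Lemma Fil_iota n g : degtrunc n g = g -> Fil n (iota_B g).
Proof.
move=> Hg; exists [:: (g, 0)]; rewrite /nform big_seq1 [_.1]/= [_.2]/= Hg.
rewrite -{1}[iota_B g]mulr1 -mulrBr; apply: ideal_genMl.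
by rewrite -opprB -scaleN1r; apply: ideal_genZ; exact: rel_K0.
Qed.

Lemma Fil_Bl n i x : Fil n x -> Fil n.+1 (B i * x).
Proof.
move=> [s Hs]; exists [seq (f i * t.1, t.2) | t <- s].
have -> : nform [seq (f i * t.1, t.2) | t <- s] n.+1 = B i * nform s n.
  rewrite /nform big_map mulr_sumr; apply: eq_bigr => t _.
  by rewrite [_.1]/= degtrunc_gen iota_BM iota_gen -mulrA.
by rewrite -mulrBr; apply: ideal_genMl.
Qed.

Lemma Fil_Br n i x : Fil n x -> Fil n.+1 (x * B i).
Proof.
move=> [s Hs]; pose c (mu : Yi T) := q ^ (- pairing (mu : rdY D) (simple_root D i)).
exists [seq (c t.2 *: (t.1 * f i), t.2) | t <- s].
set s' := map _ _; pose E t := iota_B (degtrunc n t.1) * (K t.2 * B i - c t.2 *: (B i * K t.2)).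
have nE : nform s n * B i = \sum_(t <- s) E t + nform s' n.+1.
  rewrite /nform big_map mulr_suml -big_split; apply: eq_bigr => t _.
  rewrite [_.1]/= [_.2]/= lendZ degtrunc_genr iota_BZ iota_BM iota_gen /E mulrBr.
  by rewrite -[_ *: _ * _]scalerAl -[_ * (_ *: _)]scalerAr !mulrA; apply/esym/subrK.
have -> : x * B i - nform s' n.+1 = (x - nform s n) * B i + \sum_(t <- s) E t.
  by rewrite mulrBl nE opprD [- _ - _]addrC addrA subrK.
apply: ideal_genD; first exact: ideal_genMr.
apply: ideal_gen_sum => t _; apply: ideal_genMl; apply: ideal_gen_in; exact: Uirel_KB.
Qed.

Lemma Fil_Kr n mu x : Fil n x -> Fil n (x * K mu).
Proof.
move=> [s Hs]; exists [seq (t.1, t.2 + mu) | t <- s].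
set s' := map _ _; pose E t := iota_B (degtrunc n t.1) * (K t.2 * K mu - K (t.2 + mu)).
have nE : nform s n * K mu = \sum_(t <- s) E t + nform s' n.
  rewrite /nform big_map mulr_suml -big_split; apply: eq_bigr => t _.
  by rewrite [_.1]/= [_.2]/= /E mulrBr !mulrA; apply/esym/subrK.
have -> : x * K mu - nform s' n = (x - nform s n) * K mu + \sum_(t <- s) E t.
  by rewrite mulrBl nE opprD [- _ - _]addrC addrA subrK.
apply: ideal_genD; first exact: ideal_genMr.
apply: ideal_gen_sum => t _; apply: ideal_genMl; apply: ideal_gen_in; exact: Uirel_KK.
Qed.

Lemma Fil_words n x w w' : Fil n x ->
  Fil (size w + n + size w') (iota_B (fword F w) * x * iota_B (fword F w')).
Proof.
move=> Hx; have {}Hx : Fil (size w + n) (iota_B (fword F w) * x).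
  elim: w => [|i w IH]; first by rewrite fword_nil rmorph1 mul1r.
  by rewrite fword_cons iota_BM iota_gen -mulrA; apply: Fil_Bl.
elim/last_ind: w' => [|w' i IH]; first by rewrite fword_nil rmorph1 mulr1 addn0.
rewrite -cats1 fword_cat fword_cons fword_nil mulr1 iota_BM iota_gen mulrA.
by rewrite size_cat addn1 addnS; apply: Fil_Br.
Qed.

Lemma Fil_all x : exists n, Fil n x.
Proof.
move: x; apply: freealg_ind_r => [|x y [m Hx] [n Hy]|c x [n Hx]||g x [n Hx]].
- by exists 0%N; apply/Fil_in/ideal_gen0.
- exists (maxn m n); apply: FilD.
    exact: Fil_le (leq_maxl _ _) Hx.
  exact: Fil_le (leq_maxr _ _) Hy.
- by exists n; apply: FilZ.
- by exists 1%N; rewrite -(rmorph1 iota_B); apply: Fil_iota; rewrite degtrunc1.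
by case: g => [i|mu]; [exists n.+1; apply: Fil_Br|exists n; apply: Fil_Kr].
Qed.

End Filtration.

(** * Straightening of Serre elements *)

Section Straightening.
Variables (I : finType) (C : cartan_datum I) (D : root_datum C).
Variables (T : diagram_involution D).
Variables (F : fieldType) (q : F).
Hypotheses (q0 : q != 0) (q1 : forall n, (0 < n)%N -> q ^+ n != 1).
Variables (vs : I -> F) (p : I -> 'Z_2).

Local Notation V := (freealg F I).
Local Notation f := (freegen F).
Local Notation W := (freealg F (Uigen T)).
Local Notation B i := (freegen F (UigenB T i)).
Local Notation K mu := (freegen F (UigenK mu)).
Local Notation J := (@ideal_gen F W (Uirel q T vs p)).
Local Notation N i j := (one_sub_a D i j).
Local Notation a := (cartan D).
Local Notation qi := (qi C q).
Local Notation iota := (iota_B T F).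
Local Notation Fil := (Fil q vs p).

Lemma iota_BD x y : iota (x + y) = iota x + iota y.
Proof. exact: rmorphD. Qed.

Lemma iota_B0 : iota 0 = 0.
Proof. exact: rmorph0. Qed.

Lemma iota_sum (L : Type) (r : seq L) (P : pred L) (E : L -> V) :
  iota (\sum_(t <- r | P t) E t) = \sum_(t <- r | P t) iota (E t).
Proof. exact: raddf_sum. Qed.

Lemma serre_divpow (A : algType F) i j (x y : A) : i != j ->
  serre D q i j x y = qfact (qi i) (N i j) *: \sum_(0 <= n < (N i j).+1)
    (-1) ^+ n *: (divpow (qi i) x n * y * divpow (qi i) x (N i j - n)).
Proof.
move=> ij; have fn n : qfact (qi i) n != 0.
  by apply: qfact_neq0; [exact: qi_neq0|exact: qi_not_root].
rewrite /serre (one_sub_aE D ij) scaler_sumr; apply: eq_big_nat => n /andP[_ nN].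
rewrite /divpow -!scalerAl -scalerAr !scalerA; congr (_ *: _).
rewrite qbinomE //; [|exact: qi_neq0|exact: qi_not_root].
by field; rewrite !fn.
Qed.

(** A Serre element has degree [N + 1], so the bound gains one. For fixed [i] it differs from a
    multiple of a relator by shorter words; for moved [i] it is itself such a multiple if [j] is not
    [tau i]; for [j = tau i] the relation replaces it by words of length [N - 1]. *)
Lemma Fil_serre i j : i != j -> Fil (N i j).+1 (iota (serre D q i j (f i) (f j))).
Proof.
have iM x y z x' y' z' : iota x = x' -> iota y = y' -> iota z = z' ->
    iota (x * y * z) = x' * y' * z'.
  by move=> <- <- <-; rewrite !iota_BM.
have iI v s k t n : iota (idivpow v s (f k) t n) = idivpow v s (B k) t n.
  by rewrite -iota_gen; apply: lrmorph_idivpow.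
have iII v s k l t t' n n' : iota (idivpow v s (f k) t n * f l * idivpow v s (f k) t' n') =
    idivpow v s (B k) t n * B l * idivpow v s (B k) t' n'.
  exact: iM (iI v s k t n) (iota_gen T F l) (iI v s k t' n').
have iD v k n : iota (divpow v (f k) n) = divpow v (B k) n.
  by rewrite -iota_gen; apply: lrmorph_divpow.
have iS k l : iota (serre D q k l (f k) (f l)) = serre D q k l (B k) (B l).
  by rewrite -!iota_gen; apply: lrmorph_serre.
move=> ij; have [Ti|Ti] := eqVneq (T i) i.
  have := degtrunc_serre_idiv D q0 q1 ij (vs i) (p i) ((a i j)%:~R + p i).
  cbv zeta; set X := \sum_(0 <= n < _) _; set d : V := _ - _ => Hd.
  have E : iota (serre D q i j (f i) (f j)) - iota d =
      qfact (qi i) (N i j) *: serre_idiv q T vs p i j.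
    have -> : serre D q i j (f i) (f j) = d + qfact (qi i) (N i j) *: X by rewrite subrK.
    rewrite iota_BD addrC addKr iota_BZ; congr (_ *: _).
    rewrite /serre_idiv /X iota_sum; apply: eq_bigr => n _.
    by rewrite iota_BZ iII.
  apply: (Fil_ideal (y := iota d)); last exact: Fil_iota.
  by rewrite E; apply/ideal_genZ/ideal_gen_in; apply: Uirel_idiv.
rewrite iS (serre_divpow _ _ ij); apply: FilZ.
have [jT|jT] := eqVneq j (T i); last first.
  by apply/Fil_in/ideal_gen_in; apply: Uirel_serre.
subst j; set m := `|a i (T i)|%N.
have nE : m = (N i (T i)).-1 by rewrite /m cartanE // abszN.
have aE : a i (T i) = - m%:Z by rewrite nE cartanE.
have -> : \sum_(0 <= n < (N i (T i)).+1) (-1) ^+ n *: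
    (divpow (qi i) (B i) n * B (T i) * divpow (qi i) (B i) (N i (T i) - n)) =
    (-1) ^+ m *: serre_tau_lhs q T i.
  rewrite /serre_tau_lhs scaler_sumr; apply: eq_bigr => n _; rewrite scalerA aE.
  congr (_ *: _); rewrite expfzDr ?oppr_eq0 ?oner_eq0 // -exprnP -exprnN.
  by rewrite mulrC -mulrA mulVf ?mulr1 // expf_neq0 // oppr_eq0 oner_eq0.
apply: FilZ; apply: (Fil_ideal (y := serre_tau_rhs q T vs i)).
  by apply: ideal_gen_in; apply: Uirel_tau.
have Hm mu : Fil (N i (T i)).+1 (divpow (qi i) (B i) m * K mu).
  apply: Fil_Kr; rewrite -iD; apply: Fil_iota.
  rewrite /divpow (lendZ _ (qfact _ _)^-1); congr (_ *: _).
  by apply: degtrunc_up (degtrunc_exp _ _ _); rewrite nE ltnS leq_pred.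
rewrite /serre_tau_rhs; apply: FilZ; apply: FilD; first exact: FilZ.
by rewrite -scaleN1r; do 2!apply: FilZ.
Qed.

(** With arbitrary factors [b] and [c] on both sides, everything reduces to a Serre element between
    two words. By homogeneity the truncation of that product is zero or the product itself, and
    [Fil_serre] shortens it inside the words. *)
Lemma Fil_str x n : serre_ideal D q x -> Fil n (iota (degtrunc n.+1 x)).
Proof.
suff H : serre_ideal D q x -> forall b c, Fil n (iota (degtrunc n.+1 (b * x * c))).
  by move=> /H /(_ 1 1); rewrite mul1r mulr1.
have F0 : Fil n (iota 0) by rewrite iota_B0; apply/Fil_in/ideal_gen0.
have FD (y z : V) : Fil n (iota (degtrunc n.+1 y)) -> Fil n (iota (degtrunc n.+1 z)) ->
    Fil n (iota (degtrunc n.+1 (y + z))).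
  by rewrite lendD iota_BD; apply: FilD.
have FZ k (y : V) : Fil n (iota (degtrunc n.+1 y)) -> Fil n (iota (degtrunc n.+1 (k *: y))).
  by rewrite (lendZ _ k) iota_BZ; apply: FilZ.
elim=> {x} [_ [i [j [ij ->]]]||x x' _ IHx _ IHx'|y x _ IH|x y _ IH] b c.
- move: b c; apply: freealg_span => [|b b' Hb Hb'|k b Hb|w] c.
  + by rewrite !mul0r lend0.
  + by rewrite !mulrDl; apply: FD; [apply: Hb|apply: Hb'].
  + by rewrite -!scalerAl; apply/FZ/Hb.
  move: c; apply: freealg_span => [|c c' Hc Hc'|k c Hc|w'].
  + by rewrite mulr0 lend0.
  + by rewrite mulrDr; apply: FD; [apply: Hc|apply: Hc'].
  + by rewrite -scalerAr; apply/FZ/Hc.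
  rewrite (degtrunc_serre_word D q0 ij) !ltnS; case: (leqP (size w + (N i j).+1 + size w') n) => wn //.
  rewrite !iota_BM.
  exact: Fil_le wn (Fil_words _ _ (Fil_serre ij)).
- by rewrite mulr0 mul0r lend0.
- by rewrite mulrDr mulrDl; apply: FD; [apply: IHx|apply: IHx'].
- by rewrite mulrA; apply: IH.
- by rewrite mulrA -(mulrA (b * x)); apply: IH.
Qed.

End Straightening.

Section SumFibers.
Variables (A B : eqType) (M : nmodType).

Lemma sum_fibers (s : seq (A * B)) (G : A * B -> M) :
  \sum_(t <- s) G t = \sum_(mu <- undup [seq t.2 | t <- s]) \sum_(t <- s | t.2 == mu) G t.
Proof.
rewrite (exchange_big_dep xpredT) //= big_seq [RHS]big_seq; apply: eq_bigr => t ts.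
rewrite -big_filter (_ : [seq mu <- _ | _] = [:: t.2]) ?big_seq1 //.
have tU : t.2 \in undup [seq t.2 | t <- s] by rewrite mem_undup map_f.
rewrite -(filter_pred1_uniq (undup_uniq _) tU); apply: eq_filter => mu.
exact: eq_sym.
Qed.

End SumFibers.

(** * The kernel of the evaluation map *)

Section Presentation.
Variables (I : finType) (C : cartan_datum I) (D : root_datum C).
Variables (T : diagram_involution D).
Variables (F : fieldType) (q : F).
Hypotheses (q0 : q != 0) (q1 : forall n, (0 < n)%N -> q ^+ n != 1).
Hypothesis two_neq0 : (2 : F) != 0.
Variables (vs kp : I -> F) (p : I -> 'Z_2).
Hypothesis vs_tau : forall i, cartan D i (T i) = 0 -> vs i = vs (T i).
Hypothesis kp_cond : forall i,
  ~ (T i = i /\ forall k, T k = k -> (2 %| cartan D k i)%Z) -> kp i = 0.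

Local Notation V := (freealg F I).
Local Notation W := (freealg F (Uigen T)).
Local Notation UF := (freealg F (Ugen D)).
Local Notation B i := (freegen F (UigenB T i)).
Local Notation K mu := (freegen F (UigenK mu)).
Local Notation J := (@ideal_gen F W (Uirel q T vs p)).
Local Notation iota := (iota_B T F).
Local Notation Fil := (Fil q vs p).
Local Notation pi := (quot_pi (Urel_proper (D := D) (q := q))).
Local Notation ev := (freealg_eval (Uigen_val q T vs kp)).

Lemma exprz_inj (m n : int) : q ^ m = q ^ n -> m = n.
Proof.
move=> qmn; have : q ^ (m - n) = 1 by rewrite expfzDr // qmn -expfzDr // subrr expr0z.
case: (m - n =P 0) => [/eqP|/eqP]; first by rewrite subr_eq0 => /eqP.
have H k : q ^ k.+1%:Z <> 1 by apply/eqP; rewrite -exprnP q1.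
case: (m - n) => [[|k]|k] mn0 // ; first by move/H.
by rewrite NegzE -exprnN => /(congr1 GRing.inv); rewrite invrK invr1 => /H.
Qed.

Lemma pairing0r (mu : rdY D) : pairing mu 0 = 0.
Proof. by have /eqP := pairingDr mu 0 0; rewrite addr0 -subr_eq0 opprD addNKr oppr_eq0 => /eqP. Qed.

(** If all values agreed, [mu - mu'] would pair to zero with the whole weight lattice, because [q]
    is not a root of unity, and perfectness of the pairing would make it zero. *)
Lemma character_sep (mu mu' : Yi T) : mu != mu' ->
  exists lam, q ^ pairing (mu : rdY D) lam != q ^ pairing (mu' : rdY D) lam.
Proof.
move=> neq; apply: contrapT => H; case/eqP: neq; apply/val_inj.
have [h [_ hU]] := pairing_perfectr (\0 : {additive rdX D -> int}).
have e0 : pairing (0 : rdY D) =1 fun=> 0.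
  by move=> x; rewrite -[0]/((0 : rdY D) *+ 0) pairing_mulrn mulr0.
apply/eqP; rewrite -subr_eq0 -(hU _ e0); apply/eqP/esym/hU => x.
rewrite pairingDl pairingN; apply/eqP; rewrite subr_eq0; apply/eqP.
by apply: exprz_inj; apply: contrapT => /eqP neq; apply: H; exists x.
Qed.

(** The Verma operators are defined on the free algebra over the generators of [U] and respect its
    relations only modulo the Serre ideal, so the [B_i] and [K_mu] have to be lifted there. *)
Definition lift_gen (g : Uigen T) : UF :=
  match g with
  | UigenB i => freegen F (@UgenF I C D i)
      + vs i *: (freegen F (@UgenE I C D (T i)) * fKtV D F i) + kp i *: fKtV D F i
  | UigenK mu => freegen F (@UgenK I C D mu)
  end.

Definition lift : {lrmorphism W -> UF} := freealg_eval lift_gen.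

Lemma pi_lift x : pi (lift x) = ev x.
Proof.
have piD y z : pi (y + z) = pi y + pi z by exact: rmorphD.
have piZ c y : pi (c *: y) = c *: pi y by exact: linearZ_LR.
have piM y z : pi (y * z) = pi y * pi z by exact: rmorphM.
have piX y n : pi (y ^+ n) = pi y ^+ n by exact: rmorphXn.
have E i : pi (lift_gen (UigenB T i)) = uB q T vs kp i.
  by rewrite /lift_gen /uB /fKtV 2!piD 2!piZ piM piX.
by apply: (freealg_eval_eq (phi := pi)) => -[i|mu] //; exact: E.
Qed.

Lemma verma_lift_M lam x y :
  verma q lam (lift (x * y)) = verma q lam (lift x) * verma q lam (lift y).
Proof.
have -> : lift (x * y) = lift x * lift y by exact: rmorphM.
exact: rmorphM.
Qed.

Lemma verma_lift_sum lam (L : Type) (r : seq L) (E : L -> W) :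
  verma q lam (lift (\sum_(t <- r) E t)) = \sum_(t <- r) verma q lam (lift (E t)).
Proof.
have -> : lift (\sum_(t <- r) E t) = \sum_(t <- r) lift (E t) by exact: raddf_sum.
exact: raddf_sum.
Qed.

Lemma verma_lift_B lam g : verma q lam (lift (iota g)) = coideal_rep T q vs kp lam g.
Proof.
pose r : {lrmorphism W -> lend V} := freealg_eval (fun g => verma q lam (lift_gen g)).
have rE x : verma q lam (lift x) = r x by apply: freealg_eval_eq.
rewrite rE; apply: (freealg_eval_eq (phi := r)) => i.
have -> : r (B i) = verma q lam (lift_gen (UigenB T i)) by exact: freealg_evalE.
have gE (u : Ugen D) : verma q lam (freegen F u) = verma_gen q lam u by exact: freealg_evalE.
have Kn y n : vermaK q lam y ^+ n = vermaK q lam (y *+ n).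
  have t := verma_triple q0 lam; elim: n => [|n IH].
    by rewrite expr0 mulr0n (qt_K0 t).
  by rewrite exprS IH (qt_KK t) -mulrS.
have vD y z : verma q lam (y + z) = verma q lam y + verma q lam z by exact: rmorphD.
have vZ c y : verma q lam (c *: y) = c *: verma q lam y by exact: linearZ_LR.
have vM y z : verma q lam (y * z) = verma q lam y * verma q lam z by exact: rmorphM.
have vX y n : verma q lam (y ^+ n) = verma q lam y ^+ n by exact: rmorphXn.
rewrite /lift_gen /fKtV 2!vD 2!vZ vM vX !gE.
by rewrite [verma_gen _ _ (UgenK _)]/= Kn mulNrn.
Qed.

Lemma verma_lift_K lam (mu : Yi T) : verma q lam (lift (K mu)) = vermaK q lam mu.
Proof.
have -> : lift (K mu) = freegen F (@UgenK I C D mu) by exact: freealg_evalE.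
exact: freealg_evalE.
Qed.

Lemma ev0_serre_ideal x lam : ev x = 0 -> serre_ideal D q (verma q lam (lift x) 1).
Proof.
rewrite -pi_lift => H; have /quot_piP : pi (lift x) = pi 0.
  by rewrite H; apply/esym; exact: (rmorph0 pi).
by rewrite subr0; apply: verma_ideal.
Qed.

Lemma ideal_eval0 x : J x -> ev x = 0.
Proof.
elim=> {x} [x xR||x y _ Hx _ Hy|y x _ Hx|x y _ Hx].
- exact: Uirel_eval xR.
- exact: rmorph0.
- by rewrite rmorphD /= Hx Hy addr0.
- by rewrite rmorphM /= Hx mulr0.
- by rewrite rmorphM /= Hx mul0r.
Qed.

(* The top component of an element killed by the evaluation is found by letting
   it act on the highest weight vector of every Verma module: the characters
   [lam |-> q ^ <mu, lam>] separate the [K_mu], and each coefficient has to be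
   congruent to lower terms modulo the Serre ideal. *)
Lemma Fil_eval0 n x : Fil n x -> ev x = 0 -> J x.
Proof.
elim: n x => [|n IH] x [s Hs] x0.
  have s0 : nform s 0 = 0 by apply: big1 => t _; rewrite degtrunc0 iota_B0 mul0r.
  by move: Hs; rewrite s0 subr0.
pose U := undup [seq t.2 | t <- s].
pose G mu : V := \sum_(t <- [seq t <- s | t.2 == mu]) t.1.
have sE : nform s n.+1 = \sum_(mu <- U) iota (degtrunc n.+1 (G mu)) * K mu.
  rewrite /nform sum_fibers; apply: eq_bigr => mu _.
  rewrite -big_filter lend_sum iota_sum mulr_suml; apply: eq_big_seq => t.
  by rewrite mem_filter => /andP[/eqP -> _].
have s0 : ev (nform s n.+1) = 0.
  have := ideal_eval0 Hs; rewrite rmorphB /= x0 sub0r => /eqP.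
  by rewrite oppr_eq0 => /eqP.
pose N (y : V) := exists2 z, serre_ideal D q z & degtrunc n (y - z) = y - z.
have NG mu : mu \in U -> N (degtrunc n.+1 (G mu)).
  pose chi (mu : Yi T) (lam : rdX D) : F := q ^ pairing (mu : rdY D) lam.
  apply: (character_indep (chi := chi) (g := fun mu => degtrunc n.+1 (G mu))).
  - move=> y y' [z Hz Hyz] [z' Hz' Hyz']; exists (z + z'); first exact: ideal_genD.
    by rewrite opprD addrACA lendD Hyz Hyz'.
  - move=> c y [z Hz Hyz]; exists (c *: z); first exact: serre_idealZ.
    by rewrite -scalerBr (lendZ _ c) Hyz.
  - by move=> m; rewrite /chi pairing0r.
  - by move=> m lam lam'; rewrite /chi pairingDr expfzDr.
  - exact: character_sep.
  - exact: undup_uniq.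
  (* The witness is the image of the highest weight vector under the vanishing element; by
     [coideal_rep_lead] it agrees with the character sum up to lower degree. *)
  move=> lam; exists (verma q lam (lift (nform s n.+1)) 1); first exact: ev0_serre_ideal.
  rewrite sE.
  have -> : verma q lam (lift (\sum_(mu <- U) iota (degtrunc n.+1 (G mu)) * K mu)) 1 =
      \sum_(mu <- U) chi mu lam *: coideal_rep T q vs kp lam (degtrunc n.+1 (G mu)) 1.
    rewrite verma_lift_sum lend_sumE; apply: eq_bigr => m _.
    by rewrite verma_lift_M lend_mulE verma_lift_K vermaK1 verma_lift_B (lendZ _ (q ^ _)).
  rewrite -sumrB; apply: degtrunc_sum => m _.
  rewrite -scalerBr (lendZ _ (chi m lam)); congr (_ *: _).
  have := coideal_rep_lead T q vs kp lam n (G m); cbv zeta.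
  set u := coideal_rep _ _ _ _ _ _ _; set w := degtrunc n.+1 _ => H.
  by rewrite -opprB lendN H.
apply: IH x0; apply: (Fil_ideal Hs); rewrite sE big_seq; apply: Fil_sum => mu muU.
apply: Fil_Kr; have [z Hz Hd] := NG mu muU; have := degtrunc_le (G mu) (leqnn n.+1).
move: (degtrunc n.+1 (G mu)) Hd => g Hd Hg.
(* The degree of [z] is bounded through [g] and [g - z], so [z] is its own truncation and [Fil_str]
   applies to it. *)
have zE : degtrunc n.+1 z = z.
  have -> : z = g - (g - z) by rewrite opprB addrC subrK.
  by rewrite lendB Hg (degtrunc_up (leqnSn n) Hd).
have -> : g = (g - z) + degtrunc n.+1 z by rewrite zE subrK.
by rewrite iota_BD; apply: FilD; [apply: Fil_iota|apply: Fil_str].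
Qed.

Lemma Ui_image u : Ui q T vs kp u <-> exists x, ev x = u.
Proof.
split=> [|[x <-]].
  elim=> {u} [u [[i ->]|[mu ->]]||u w _ [x <-] _ [y <-]|c u _ [x <-]|u w _ [x <-] _ [y <-]].
  - by exists (B i); rewrite freealg_evalE.
  - by exists (K mu); rewrite freealg_evalE.
  - by exists 1; rewrite rmorph1.
  - by exists (x + y); rewrite rmorphD.
  - by exists (c *: x); rewrite freealg_eval_scalable.
  - by exists (x * y); rewrite rmorphM.
move: x; apply: freealg_ind => [|x y Hx Hy|c x Hx||g x Hx].
- by rewrite rmorph0 -(scale0r 1); apply/subalg_genZ/subalg_gen1.
- by rewrite rmorphD; apply: subalg_genD.
- by rewrite freealg_eval_scalable; apply: subalg_genZ.
- by rewrite rmorph1; apply: subalg_gen1.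
rewrite rmorphM; apply: subalg_genM => //; apply: subalg_gen_in; rewrite /= freealg_evalE.
by case: g => [i|mu]; [left; exists i|right; exists mu].
Qed.

Lemma presentation : presented_by (Ui q T vs kp) (Uigen_val q T vs kp) (Uirel q T vs p).
Proof.
split=> [u|x]; first exact: Ui_image.
split; last exact: ideal_eval0.
by have [n Hn] := Fil_all q vs p x; apply: Fil_eval0 Hn.
Qed.

End Presentation.

(** * The field of rational functions *)

Section FractionField.
Variable K : fieldType.
Local Notation tofrac := (@tofrac {poly K}).

Lemma tofracX_neq0 : tofrac 'X != 0.
Proof. by rewrite tofrac_eq0 polyX_eq0. Qed.

Lemma tofracX_not_root n : (0 < n)%N -> tofrac 'X ^+ n != 1.
Proof.
move=> n0; rewrite -rmorphXn -(rmorph1 tofrac) tofrac_eq; apply/eqP.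
by move=> /(congr1 (fun r : {poly K} => size r)); rewrite size_polyXn size_poly1; case: n n0.
Qed.

Lemma two_frac_neq0 : [pchar K] =i pred0 -> (2 : {fraction {poly K}}) != 0.
Proof.
move=> ch; rewrite -(rmorph_nat tofrac) tofrac_eq0 -polyC_natr polyC_eq0.
by have /pcharf0P -> := ch.
Qed.

End FractionField.

Theorem theorem3p1
  (I : finType) (C : cartan_datum I) (D : root_datum C)
  (T : diagram_involution D)
  (K : fieldType) (charK0 : [pchar K] =i pred0)
  (varsigma kappa : I -> {fraction {poly K}})
  (varsigma_neq0 : forall i, varsigma i != 0)
  (varsigma_tau : forall i, cartan D i (T i) = 0 ->
     varsigma i = varsigma (T i))
  (kappa_cond : forall i,
     ~ (T i = i /\ forall k, T k = k -> (2 %| cartan D k i)%Z) ->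
     kappa i = 0)
  (p : I -> 'Z_2) :
  let q : {fraction {poly K}} := tofrac 'X in
  presented_by (Ui q T varsigma kappa)
    (Uigen_val q T varsigma kappa) (Uirel q T varsigma p).
Proof.
move=> q; apply: presentation => //.
- exact: tofracX_neq0.
- exact: tofracX_not_root.
- exact: two_frac_neq0.
Qed.
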